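(* Let $K$ be an algebraically closed field, and let $A$ be the free noncommutative $K$-algebra generated in degree one by elements $x,y$. Let $\xi$ be a natural number. Let $I$ denote the ideal generated in $A$ by homogeneous elements $f_1,f_2,\dots,f_\xi\in A$. Suppose that, for each $i$, there are exactly $r_i$ elements among $f_1,\dots,f_\xi$ with degrees larger than $2^i$ and not exceeding $2^{i+1}$. Assume that there are no elements among $f_1,\dots,f_\xi$ with degree $k$ if $2^n+2^{n-1}+2^{n-2}<k<2^{n+1}+2^n$ for some $n$. Denote $Y=\{n: r_n\neq 0\}$. Suppose that for all $n\in Y$ and $m\in\{0\}\cup Y$ with $m<n$ we have $$2^{3n+4}\prod_{i<n,\ i\in Y} r_i^{32}<r_n<2^{2^{n-m-3}}.$$ Then $A/I$ contains a free noncommutative graded subalgebra in two generators, and these generators are (images of) monomials of the same degree. In particular, $A/I$ is not Jacobson radical. Moreover, $A/I$ can be homomorphically mapped onto a graded, prime, Noetherian algebra with linear growth which satisfies a polynomial identity.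
   Context: Graded means graded by the additive semigroup of natural numbers. A graded $K$-algebra $R$, with homogeneous components $R(n)$, has linear growth if there is a number $c$ such that $\dim_K R(n)\le c$ for all $n$. A monomial of degree $k$ is a product $x_1\cdots x_k$ with all $x_i\in\{x,y\}$. An algebra is Jacobson radical if it equals its own Jacobson radical.
   Formalization: The formal theorem additionally assumes that every f_i has degree larger than 1; without this the claim fails, e.g. for f_1 = x, f_2 = y, where all r_i = 0 and A/I = K. *)

(* Defs.v *)
(* MathComp with classical sets; free algebras are the monoid algebras of free
   monoids provided by [monalg] (multinomials).

   Algebras are unital associative K-algebras.  The notion "Jacobson radical
   algebra" is only of interest for algebras without unit, so the Jacobson
   radical is defined below for any nonunital subalgebra of a unital algebra; it
   applies both to a unital algebra ([setT]) and to the part of positive degree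
   of a graded algebra. *)
From HB Require Import structures.
From mathcomp Require Import all_boot all_order all_algebra.
From mathcomp Require Import generic_quotient ring_quotient.
From mathcomp Require Import finmap monalg.
From mathcomp Require Import boolp classical_sets.

Set Implicit Arguments.
Unset Strict Implicit.
Unset Printing Implicit Defensive.

Import Order.TTheory GRing.Theory Num.Theory.

Local Open Scope classical_set_scope.
Local Open Scope quotient_scope.
Local Open Scope ring_scope.

(* K<X_0, ..., X_(n-1)> *)
Section FreeAlgebra.
Variables (K : fieldType) (n : nat).

Definition freealg : Type := {malg K[{fmonom 'I_n}]}.

HB.instance Definition _ := GRing.Lalgebra.on freealg.

Fact freealg_scalerAr (k : K) (p q : freealg) : k *: (p * q) = p * (k *: q).
Proof.
have C (r : freealg) : r * k%:MP = k *: r.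
  rewrite malgM_def malgZ_def fgmulgU; apply: eq_bigr => w _.
  by rewrite mulm1 mulrC.
rewrite -[k *: q]mul_malgC mulrA C; exact: scalerAl.
Qed.

HB.instance Definition _ :=
  GRing.Lalgebra_isAlgebra.Build K freealg freealg_scalerAr.

Definition monomial (w : seq 'I_n) : freealg :=
  \prod_(i <- w) (<< FMonom [:: i] >> : freealg).

Definition homogeneous (k : nat) : set freealg :=
  [set p | forall w : {fmonom 'I_n}, p@_w != 0 -> size w = k].

(* the value p(b_0, ..., b_(n-1)); as a function of p, this is the algebra
   morphism sending X_i to b_i *)
Definition fa_eval (B : algType K) (b : 'I_n -> B) (p : freealg) : B :=
  \sum_(w <- msupp p) p@_w *: \prod_(i <- (w : seq 'I_n)) b i.

Definition const_coef (p : freealg) : K := p@_(mone : {fmonom 'I_n}).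

Fact const_coefM (p q : freealg) :
  const_coef (p * q) = const_coef p * const_coef q.
Proof. exact: (@mcoeff1g_is_multiplicative {fmonom 'I_n} K).1. Qed.

End FreeAlgebra.

Section Ideals.
Variables (K : fieldType) (B : algType K).
Implicit Types S L J : set B.

Definition is_subspace S :=
  S 0 /\ forall (k : K) a b, S a -> S b -> S (k *: a + b).

Definition is_left_ideal L :=
  is_subspace L /\ forall a b, L b -> L (a * b).

Definition is_right_ideal L :=
  is_subspace L /\ forall a b, L a -> L (a * b).

Definition is_ideal J := is_left_ideal J /\ is_right_ideal J.

Definition ideal_gen (X : set B) : set B :=
  [set a | forall J, is_ideal J -> X `<=` J -> J a].

Lemma ideal_gen_is_ideal (X : set B) : is_ideal (ideal_gen X).
Proof.
split; split; first split.
- by move=> J [[[J0 _] _] _] _.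
- move=> k a b Ia Ib J hJ XJ; have [[[_ hD] _] _] := hJ.
  by apply: hD; [apply: Ia | apply: Ib].
- move=> a b Ib J hJ XJ; have [[_ hM] _] := hJ.
  by apply: hM; apply: Ib.
- split; first by move=> J [[[J0 _] _] _] _.
  move=> k a b Ia Ib J hJ XJ; have [[[_ hD] _] _] := hJ.
  by apply: hD; [apply: Ia | apply: Ib].
- move=> a b Ia J hJ XJ; have [_ [_ hM]] := hJ.
  by apply: hM; apply: Ia.
Qed.

Lemma sub_ideal_gen (X : set B) : X `<=` ideal_gen X.
Proof. by move=> a Xa J _; apply. Qed.

Record properIdeal := ProperIdeal {
  pideal_set :> set B;
  pideal_ideal : is_ideal pideal_set;
  pideal_proper : ~ pideal_set 1
}.

End Ideals.

(* The library only has quotients of commutative rings as rings; the underlying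
   additive quotient is reused. *)
Section QuotientAlgebra.
Variables (K : fieldType) (B : algType K) (I : properIdeal B).

Definition pideal_pred : pred B := fun a => `[< pideal_set I a >].

Fact pideal_zmod_closed : zmod_closed pideal_pred.
Proof.
have [[[I0 ID] _] _] := pideal_ideal I.
split; first exact/asboolP.
move=> a b /asboolP Ia /asboolP Ib; apply/asboolP.
by rewrite -scaleN1r addrC; apply: ID.
Qed.

HB.instance Definition _ := GRing.isZmodClosed.Build B pideal_pred
  pideal_zmod_closed.

Definition pideal_closed : zmodClosed B :=
  GRing.ZmodClosed.clone B pideal_pred _.

Definition quotalg : Type := Quotient.quot pideal_closed.

HB.instance Definition _ := GRing.Zmodule.on quotalg.

Definition quot_pi (a : B) : quotalg :=
  \pi_(Quotient.quot pideal_closed) a.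

Definition quot_repr (q : quotalg) : B :=
  repr (q : Quotient.quot pideal_closed).

Lemma quot_reprK : cancel quot_repr quot_pi.
Proof. exact: reprK. Qed.

Lemma quot_piE a b : quot_pi a = quot_pi b <-> pideal_set I (a - b).
Proof.
split=> [/eqP | h].
  by rewrite /quot_pi -Quotient.idealrBE => /asboolP.
by apply/eqP; rewrite /quot_pi -Quotient.idealrBE; exact/asboolP.
Qed.

Lemma quot_pi_surj (q : quotalg) : exists a, quot_pi a = q.
Proof. by exists (quot_repr q); exact: quot_reprK. Qed.

Fact quot_pi_is_zmod_morphism : zmod_morphism quot_pi.
Proof.
exact: (raddfB \pi_(Quotient.quot pideal_closed)).
Qed.

HB.instance Definition _ := GRing.isZmodMorphism.Build B quotalg quot_pi
  quot_pi_is_zmod_morphism.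

Let repr_pi a : pideal_set I (quot_repr (quot_pi a) - a).
Proof. by apply/quot_piE; rewrite quot_reprK. Qed.

Let idealD a b : pideal_set I a -> pideal_set I b -> pideal_set I (a + b).
Proof.
move=> Ia Ib; have [[[_ ID] _] _] := pideal_ideal I.
by rewrite -[a]scale1r; apply: ID.
Qed.

Let idealZ (k : K) a : pideal_set I a -> pideal_set I (k *: a).
Proof.
move=> Ia; have [[[I0 ID] _] _] := pideal_ideal I.
by rewrite -[_ *: _]addr0; apply: ID.
Qed.

Let idealMl a b : pideal_set I b -> pideal_set I (a * b).
Proof. by have [[_ IM] _] := pideal_ideal I; apply: IM. Qed.

Let idealMr a b : pideal_set I a -> pideal_set I (a * b).
Proof. by have [_ [_ IM]] := pideal_ideal I; apply: IM. Qed.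

Definition quot_one : quotalg := quot_pi 1.
Definition quot_mul (p q : quotalg) : quotalg :=
  quot_pi (quot_repr p * quot_repr q).
Definition quot_scale (k : K) (q : quotalg) : quotalg :=
  quot_pi (k *: quot_repr q).

Fact quot_piM a b : quot_pi (a * b) = quot_mul (quot_pi a) (quot_pi b).
Proof.
symmetry; apply/quot_piE; set a' := quot_repr _; set b' := quot_repr _.
have -> : a' * b' - a * b = a' * (b' - b) + (a' - a) * b.
  by rewrite mulrBr mulrBl addrA subrK.
by apply: idealD; [apply: idealMl | apply: idealMr]; exact: repr_pi.
Qed.

Fact quot_piZ k a : quot_pi (k *: a) = quot_scale k (quot_pi a).
Proof.
by symmetry; apply/quot_piE; rewrite -scalerBr; apply: idealZ; exact: repr_pi.
Qed.

Fact quot_mulA : associative quot_mul.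
Proof.
move=> p q r; rewrite -(quot_reprK p) -(quot_reprK q) -(quot_reprK r).
by rewrite -!quot_piM mulrA.
Qed.

Fact quot_mul1 : left_id quot_one quot_mul.
Proof. by move=> p; rewrite -(quot_reprK p) -quot_piM mul1r. Qed.

Fact quot_mulr1 : right_id quot_one quot_mul.
Proof. by move=> p; rewrite -(quot_reprK p) -quot_piM mulr1. Qed.

Fact quot_mulDl : left_distributive quot_mul +%R.
Proof.
move=> p q r; rewrite -(quot_reprK p) -(quot_reprK q) -(quot_reprK r).
by rewrite -raddfD -!quot_piM mulrDl raddfD.
Qed.

Fact quot_mulDr : right_distributive quot_mul +%R.
Proof.
move=> p q r; rewrite -(quot_reprK p) -(quot_reprK q) -(quot_reprK r).
by rewrite -raddfD -!quot_piM mulrDr raddfD.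
Qed.

Fact quot_one_neq0 : quot_one != 0.
Proof.
apply/eqP; rewrite -(raddf0 quot_pi) => /quot_piE; rewrite subr0.
exact: pideal_proper.
Qed.

HB.instance Definition _ := GRing.Zmodule_isNzRing.Build quotalg
  quot_mulA quot_mul1 quot_mulr1 quot_mulDl quot_mulDr quot_one_neq0.

Fact quot_scaleA a b (q : quotalg) :
  quot_scale a (quot_scale b q) = quot_scale (a * b) q.
Proof. by rewrite -(quot_reprK q) -!quot_piZ scalerA. Qed.

Fact quot_scale1 : left_id 1 quot_scale.
Proof. by move=> q; rewrite -(quot_reprK q) -quot_piZ scale1r. Qed.

Fact quot_scaleDr : right_distributive quot_scale +%R.
Proof.
move=> k p q; rewrite -(quot_reprK p) -(quot_reprK q).
by rewrite -raddfD -!quot_piZ scalerDr raddfD.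
Qed.

Fact quot_scaleDl (q : quotalg) : {morph quot_scale^~ q : a b / a + b}.
Proof.
by move=> a b; rewrite -(quot_reprK q) -!quot_piZ scalerDl raddfD.
Qed.

HB.instance Definition _ := GRing.Zmodule_isLmodule.Build K quotalg
  quot_scaleA quot_scale1 quot_scaleDr quot_scaleDl.

Fact quot_scalerAl (k : K) (p q : quotalg) : k *: (p * q) = (k *: p) * q.
Proof.
rewrite -(quot_reprK p) -(quot_reprK q).
by rewrite -[RHS]/(quot_mul (quot_scale _ _) _)
  -[LHS]/(quot_scale _ (quot_mul _ _)) -!(quot_piZ, quot_piM) scalerAl.
Qed.

HB.instance Definition _ := GRing.Lmodule_isLalgebra.Build K quotalg
  quot_scalerAl.

Fact quot_scalerAr (k : K) (p q : quotalg) : k *: (p * q) = p * (k *: q).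
Proof.
rewrite -(quot_reprK p) -(quot_reprK q).
by rewrite -[RHS]/(quot_mul _ (quot_scale _ _))
  -[LHS]/(quot_scale _ (quot_mul _ _)) -!(quot_piZ, quot_piM) scalerAr.
Qed.

HB.instance Definition _ := GRing.Lalgebra_isAlgebra.Build K quotalg
  quot_scalerAr.

Fact quot_pi_is_monoid_morphism : monoid_morphism quot_pi.
Proof. by split=> // a b; exact: quot_piM. Qed.

HB.instance Definition _ := GRing.isMonoidMorphism.Build B quotalg quot_pi
  quot_pi_is_monoid_morphism.

Fact quot_pi_is_scalable : scalable quot_pi.
Proof. by move=> k a; exact: quot_piZ. Qed.

HB.instance Definition _ := GRing.isScalable.Build K B quotalg *:%R quot_pi
  quot_pi_is_scalable.

End QuotientAlgebra.

(* A grading is the family of the homogeneous components R(0), R(1), ... *)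
Section Graded.
Variables (K : fieldType) (B : algType K).
Implicit Types (g : nat -> set B) (S : set B).

Definition is_grading g :=
  [/\ forall n, is_subspace (g n),
      forall m n a b, g m a -> g n b -> g (m + n)%N (a * b),
      forall a, exists N (c : nat -> B),
        (forall n, g n (c n)) /\ a = \sum_(n < N) c n
    & forall N (c : nat -> B), (forall n, g n (c n)) ->
        \sum_(n < N) c n = 0 -> forall n, (n < N)%N -> c n = 0].

(* the span of the components of degree at least 1 *)
Definition positive_part g : set B :=
  [set a | exists N (c : nat -> B),
     (forall n, g n (c n)) /\ a = \sum_(n < N) c n.+1].

(* S is the sum of its intersections with the components *)
Definition graded_subset g S :=
  forall a, S a -> exists N (c : nat -> B),
    (forall n, (g n `&` S) (c n)) /\ a = \sum_(n < N) c n.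

(* S is spanned by c of its elements, possibly with repetitions *)
Definition dim_le S (c : nat) :=
  exists v : 'I_c -> B, (forall i, S (v i)) /\
    forall a, S a -> exists k : 'I_c -> K, a = \sum_i k i *: v i.

Definition linear_growth g := exists c : nat, forall n, dim_le (g n) c.

End Graded.

Section RingNotions.
Variables (K : fieldType) (B : algType K).
Implicit Types (L J S : set B).

Definition subalg_gen n (b : 'I_n -> B) : set B :=
  [set a | exists p : freealg K n, a = fa_eval b p].

Definition free_generators n (b : 'I_n -> B) :=
  injective (fa_eval b : freealg K n -> B).

Definition prime_alg :=
  forall J1 J2, is_ideal J1 -> is_ideal J2 ->
    (forall a b, J1 a -> J2 b -> a * b = 0) -> J1 = [set 0] \/ J2 = [set 0].

Definition ascending (L : nat -> set B) := forall n, L n `<=` L n.+1.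

Definition stationary (L : nat -> set B) :=
  exists N, forall n, (N <= n)%N -> L n = L N.

Definition noetherian_alg :=
  (forall L : nat -> set B, (forall n, is_left_ideal (L n)) ->
     ascending L -> stationary L) /\
  (forall L : nat -> set B, (forall n, is_right_ideal (L n)) ->
     ascending L -> stationary L).

Definition satisfies_PI :=
  exists n (p : freealg K n), p != 0 /\ forall b : 'I_n -> B, fa_eval b p = 0.

(* In the next four definitions, S is a subspace of B closed under products,
   seen as an algebra that need not have a unit.  A left ideal L of S is modular
   (or regular) when S has a right unit modulo L; if S has a unit, every left
   ideal is modular. *)
Definition is_left_ideal_in S L :=
  [/\ is_subspace L, L `<=` S & forall s a, S s -> L a -> L (s * a)].

Definition max_modular_left_ideal_in S L :=
  [/\ is_left_ideal_in S L,
      exists2 e, S e & forall s, S s -> L (s - s * e),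
      L <> S
    & forall L', is_left_ideal_in S L' -> L `<=` L' -> L' = L \/ L' = S].

Definition jacobson_radical S : set B :=
  [set a | S a /\ forall L, max_modular_left_ideal_in S L -> L a].

Definition is_jacobson_radical S := jacobson_radical S = S.

End RingNotions.

(* The algebra A/I of the theorem: A = K<x,y> with x = X_0, y = X_1, and I
   is generated by homogeneous f_j of degree d_j.  Relations of degree 0 or 1
   are not counted by the r_i, and must be excluded: with f = (x, y), or with
   f = (1), A/I would have no free subalgebra. *)
Section Relations.
Variables (K : fieldType) (xi : nat).
Variables (f : 'I_xi -> freealg K 2) (d : 'I_xi -> nat).
Hypothesis f_homog : forall j, homogeneous (d j) (f j).
Hypothesis d_gt1 : forall j, (1 < d j)%N.

Fact rel_ideal_proper : ~ ideal_gen (range f) 1.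
Proof.
pose J : set (freealg K 2) := [set p | const_coef p = 0].
have J_ideal : is_ideal J.
  have JS : is_subspace J.
    split=> [|k p q Jp Jq]; rewrite /J /=; first exact: mcoeff0.
    rewrite /const_coef mcoeffD mcoeffZ.
    by rewrite [X in _ * X]Jp [X in _ + X]Jq mulr0 addr0.
  by split; split=> // p q; rewrite /J /= const_coefM => ->;
    rewrite (mulr0, mul0r).
have fJ : range f `<=` J.
  move=> _ [j _ <-]; apply: contrapT => /eqP/(f_homog (j := j)).
  by rewrite fm1 => dj; have := d_gt1 j; rewrite -dj.
move=> /(_ J J_ideal fJ); rewrite /J /= => /eqP.
by rewrite /const_coef mcoeff1 eqxx oner_eq0.
Qed.

Definition rel_ideal : properIdeal (freealg K 2) :=
  ProperIdeal (ideal_gen_is_ideal (range f)) rel_ideal_proper.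

Definition rel_alg := quotalg rel_ideal.
HB.instance Definition _ := GRing.Algebra.on rel_alg.

Definition rel_pi (p : freealg K 2) : rel_alg := quot_pi rel_ideal p.

Definition rel_comp (n : nat) : set rel_alg := rel_pi @` homogeneous n.

End Relations.

Arguments rel_pi {K xi f d} f_homog d_gt1 p.
Arguments rel_comp {K xi f d} f_homog d_gt1 n _.

(* r n is the number of relations of degree in ]2^n, 2^(n+1)], and Y is the
   support of r.  In the exponent, n - m - 3 is truncated at 0; this does not
   change the condition: when n - m < 3 the untruncated bound 2^(2^(n-m-3)) is
   less than 2 and the truncated one is 2, and both contradict the lower bound,
   which exceeds 2. *)
Definition sparse_counts (r : nat -> nat) :=
  forall n m : nat, r n <> 0%N -> (m = 0%N \/ r m <> 0%N) -> (m < n)%N ->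
    (2 ^ (3 * n + 4) * \prod_(i < n | r i != 0) r i ^ 32 < r n
       < 2 ^ (2 ^ (n - m - 3)))%N.

(* Whether 2^n + 2^(n-1) + 2^(n-2) < k < 2^(n+1) + 2^n; the powers are rational
   since for n < 2 the exponents can be negative. *)
Definition in_gap (n k : nat) : bool :=
  (2 ^ n%:Z + 2 ^ (n%:Z - 1) + 2 ^ (n%:Z - 2) < k%:R :> rat) &&
  (k%:R < 2 ^ (n%:Z + 1) + 2 ^ n%:Z :> rat).

(* Main.v *)
(* A linear functional g on words of length Y is spread over A by tensor powers.
   We build two functionals phi_0, phi_1 on words of some length N such that every
   concatenation of phi_0's and phi_1's annihilates u f_j v for all words u, v and
   all j.  The dyadic ranges are treated one after the other: at each range the new
   phi_i are combinations of concatenations of the old ones, which takes care of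
   the old relations, and the few new relations (compared with the exponentially
   many concatenations) impose fewer equations than there are coefficients.

   Words e_0, e_1 dual to phi_0, phi_1 then generate a free subalgebra of A/I.
   Let P be the quotient of A by the largest ideal annihilated by all tensor powers
   of phi_0.  It has bounded components and is prime because phi_0 is multiplicative
   on concatenations.  A generic element z of degree N is regular on P, whence
   P_(n+N) = z P_n = P_n z for large n; so P is finitely generated over K[z] on both
   sides, hence Noetherian, and it acts on itself by matrices over K[z], hence is
   PI.  Finally e_0 is not quasi-regular in A/I since all its powers are nonzero. *)
From HB Require Import structures.
Require Import Defs.
From mathcomp Require Import all_boot all_order all_algebra all_fingroup.
From mathcomp Require Import finmap monalg.
From mathcomp Require Import boolp classical_sets.
From mathcomp Require Import zify ring.

Set Implicit Arguments.
Unset Strict Implicit.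
Unset Printing Implicit Defensive.

Import Order.TTheory GRing.Theory Num.Theory.

Local Open Scope classical_set_scope.
Local Open Scope ring_scope.

(** * Functionals on words *)

(** The obstacle is the number of equations. A relation of degree [k] can sit at [Y] offsets against
    pieces of length [Y]. At each offset, expanding the missed or protruding letters on bases gives
    about [D ^ 2 * 2 ^ E] equations, where [E] counts the complete old blocks among [2 * Y - k] or
    [k - Y] letters. The unknowns are the coefficients of the [2 ^ Q] concatenations of [Q] old
    blocks. The gaps confine the degrees counted by [r n] to [[24, 28]] in units of [2 ^ (n - 4)],
    and pieces of 17 units keep both letter counts at most 11. So [E] is about [11/17 * Q], and the
    remaining factor [2 ^ (6/17 * Q)] has to beat [r n], the length and [D ^ 2]; a [Q] of order
    [log2 (r n)] does so. Then [D] grows at each stage by a factor at most [r n ^ 5], and the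
    factors [r_i ^ 32] in the lower bound on [r n] pay for the [D] accumulated earlier. The upper
    bound on [r n] ensures that [Q] old blocks, each lengthened by padding, can fill exactly 17
    units. *)

Section LinearExtension.
Variables (K : fieldType) (n : nat).
Implicit Types p : freealg K n.

Definition mon (w : seq 'I_n) : freealg K n := << FMonom w >>.

Lemma mon_cat u v : mon (u ++ v) = mon u * mon v.
Proof.
rewrite /mon malgM_def fgmulUU mulr1; congr (<< _ *g _ >>).
by apply/eqP; rewrite fmP fmM.
Qed.

Lemma mon_nil : mon [::] = 1.
Proof. by apply/malgP=> k; rewrite mcoeffU1 mcoeff1 eq_sym; congr (_%:R); rewrite !fmP fm1. Qed.

Lemma monomialE w : monomial K w = mon w.
Proof.
elim: w => [|x w IH]; first by rewrite /monomial big_nil mon_nil.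
by rewrite /monomial big_cons -/(monomial K w) IH -[x :: w]cat1s mon_cat.
Qed.

Lemma mcoeff_mon w w' : (mon w)@_(FMonom w') = (w == w')%:R.
Proof. by rewrite mcoeffU1 fmP. Qed.

Lemma mon_homog w : homogeneous (size w) (mon w).
Proof. by move=> v; rewrite mcoeffU1; case: (FMonom w =P v) => [<-|_] //; rewrite eqxx. Qed.

Lemma monE p : p = \sum_(w <- msupp p) p@_w *: mon w.
Proof.
rewrite [LHS]monalgE; apply: eq_bigr => w _.
by apply/malgP=> k; rewrite mcoeffZ !mcoeffU fmK mulr_natr.
Qed.

Variable V : lmodType K.
Implicit Types F : seq 'I_n -> V.

Definition lin_ext F p : V := \sum_(w <- msupp p) p@_w *: F w.

Lemma lin_extEw F p (d : {fset {fmonom 'I_n}}) :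
  (msupp p `<=` d)%fset -> lin_ext F p = \sum_(w <- d) p@_w *: F w.
Proof.
move=> le; rewrite [LHS](big_fset_incl _ le) => //= x xd /mcoeff_outdom ->.
by rewrite scale0r.
Qed.

Lemma lin_ext_is_linear F : linear (lin_ext F).
Proof.
move=> a p q; pose d := (msupp p `|` msupp q `|` msupp (a *: p + q))%fset.
rewrite !(@lin_extEw F _ d); first last.
- exact: fsubsetUr.
- by rewrite /d -fsetUA fsubsetUl.
- by apply: fsubset_trans (fsubsetUl _ _); apply: fsubsetUr.
rewrite scaler_sumr -big_split /=; apply: eq_bigr => w _.
by rewrite mcoeffD mcoeffZ scalerDl scalerA.
Qed.

HB.instance Definition _ F :=
  GRing.isLinear.Build K (freealg K n) V _ (lin_ext F) (lin_ext_is_linear F).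

Lemma lin_ext_mon F w : lin_ext F (mon w) = F w.
Proof. by rewrite (lin_extEw _ msuppU_le) big_seq_fset1 mcoeffUU scale1r. Qed.

End LinearExtension.

Section Pairing.
Variable K : fieldType.
Local Notation word := (seq 'I_2).
Local Notation A := (freealg K 2).
Implicit Types (p : A) (L g : word -> K).

Definition pairing L p : K := \sum_(w <- msupp p) p@_w * L w.

Lemma pairing_is_linear L : scalar (pairing L).
Proof. exact: (@lin_ext_is_linear K 2 K^o). Qed.

HB.instance Definition _ L :=
  GRing.isLinear.Build K A K *%R (pairing L) (pairing_is_linear L).

Lemma pairing_mon L w : pairing L (mon K w) = L w.
Proof. exact: (@lin_ext_mon K 2 K^o). Qed.

Lemma eq_pairing L L' k p : homogeneous k p ->
  (forall w, size w = k -> L w = L' w) -> pairing L p = pairing L' p.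
Proof.
move=> hp eL; apply: eq_big_seq => w; rewrite -mcoeff_neq0 => /hp sw.
by rewrite eL.
Qed.

Lemma pairing_sumL (I : Type) (r : seq I) (P : pred I) (c : I -> K) (F : I -> word -> K) p :
  pairing (fun w => \sum_(i <- r | P i) c i * F i w) p
  = \sum_(i <- r | P i) c i * pairing (F i) p.
Proof.
rewrite /pairing.
under eq_bigr do rewrite mulr_sumr.
rewrite exchange_big /=; apply: eq_bigr => i _; rewrite mulr_sumr.
by apply: eq_bigr => w _; rewrite mulrCA.
Qed.

Lemma pairingZL (c : K) L p : pairing (fun w => c * L w) p = c * pairing L p.
Proof. by rewrite /pairing mulr_sumr; apply: eq_bigr => w _; rewrite mulrCA. Qed.

Lemma pairingZR (c : K) L p : pairing (fun w => L w * c) p = pairing L p * c.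
Proof. by rewrite mulrC -pairingZL; apply: eq_bigr => w _; rewrite [L w * c]mulrC. Qed.

Lemma pairing_eq0 L k p : homogeneous k p -> (forall w, size w = k -> L w = 0) ->
  pairing L p = 0.
Proof.
move=> hp h; rewrite (@eq_pairing L (fun=> 0) k) //.
by apply: big1 => w _; rewrite mulr0.
Qed.

(** Vanishing of [L] on [u p v] for all words [u] and [v]: in this form annihilation passes from [p]
    to the two-sided ideal that it generates. *)
Definition kills L p := forall u v : word, pairing (fun w => L (u ++ w ++ v)) p = 0.

(** The base case tests for an empty remainder, so the product vanishes on words that are too long;
    for short words this follows from the supports of the factors. *)
Fixpoint tprod (Y : nat) (gs : seq (word -> K)) (w : word) : K :=
  if gs is g :: gs' then g (take Y w) * tprod Y gs' (drop Y w) else (w == [::])%:R.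

Definition supported Y g := forall w, g w != 0 -> size w = Y.

Definition allsupp Y (gs : seq (word -> K)) := forall i, (i < size gs)%N -> supported Y (nth (fun=> 0) gs i).

Lemma allsupp_cons Y g gs : allsupp Y (g :: gs) -> supported Y g /\ allsupp Y gs.
Proof. by move=> h; split; [exact: (h 0%N) | move=> i hi; exact: (h i.+1)]. Qed.

Lemma allsupp_map Y (I : Type) (g : I -> word -> K) s :
  (forall i, supported Y (g i)) -> allsupp Y (map g s).
Proof.
move=> h; elim: s => [|a s IH]; first by case.
case=> [_|i]; first exact: h.
exact: IH.
Qed.

Lemma tprod_supp Y gs : allsupp Y gs -> supported (size gs * Y) (tprod Y gs).
Proof.
elim: gs => [_|g gs IH /allsupp_cons[hg hgs]] w /=.
  by case: (w =P [::]) => [->|_] //; rewrite eqxx.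
rewrite mulf_eq0 negb_or => /andP[/hg ht /(IH hgs) hd].
by rewrite -[w](cat_take_drop Y) size_cat ht hd mulSn.
Qed.

Lemma tprod_cat Y gs1 gs2 u v : size u = (size gs1 * Y)%N ->
  tprod Y (gs1 ++ gs2) (u ++ v) = tprod Y gs1 u * tprod Y gs2 v.
Proof.
elim: gs1 u => [|g gs1 IH] u /=; first by move/size0nil ->; rewrite eqxx mul1r.
rewrite mulSn => su; have hY : (Y <= size u)%N by rewrite su leq_addr.
rewrite takel_cat // drop_cat; case: ltnP => [lY|gY].
  by rewrite IH ?mulrA // size_drop su; lia.
have sY : size u = Y by lia.
have -> : drop Y u = [::] by rewrite drop_oversize ?sY.
rewrite sY subnn drop0 -[v]cat0s IH /= ?mulrA //.
by move: su; rewrite sY; lia.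
Qed.

Lemma tprod1 Y g w : supported Y g -> tprod Y [:: g] w = g w.
Proof.
move=> hg /=; case: eqP => [/nilP|/eqP h].
  rewrite /nilp size_drop subn_eq0 => h.
  by rewrite mulr1 take_oversize.
rewrite mulr0; apply/esym/eqP; apply: contraTT h => /hg sw.
by rewrite drop_oversize ?sw // negbK.
Qed.

Lemma kills_supp Y L k p u v : supported Y L -> homogeneous k p ->
  (size u + k + size v)%N <> Y -> pairing (fun w => L (u ++ w ++ v)) p = 0.
Proof.
move=> hL hp h; apply: (pairing_eq0 hp) => w sw; apply/eqP; apply/negP => /negP /hL.
by rewrite !size_cat sw addnA.
Qed.

(* [p] meets at most three consecutive blocks; the two-block windows are only
   needed for neighbours that actually occur. *)
Lemma kills_tprod (T : eqType) (adj : rel T) (Y k : nat) (g : T -> word -> K) p :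
  (0 < Y)%N -> (Y < k <= 2 * Y)%N -> homogeneous k p ->
  (forall i, supported Y (g i)) ->
  (forall a b, adj a b -> kills (tprod Y [:: g a; g b]) p) ->
  (forall a b c u v, adj a b -> adj b c -> (size u < Y)%N -> (size v < Y)%N ->
     pairing (fun w => tprod Y [:: g a; g b; g c] (u ++ w ++ v)) p = 0) ->
  forall s, sorted adj s -> kills (tprod Y (map g s)) p.
Proof.
move=> Y0 /andP[Yk k2Y] hp hg W2 W3; elim=> [|a s IH] hs u v.
  apply: (@kills_supp (0 * Y)) hp _; first exact: (@tprod_supp _ [::]).
  lia.
have [E|E] := eqVneq (size u + k + size v)%N (size (map g (a :: s)) * Y)%N; last first.
  apply: (kills_supp _ hp (Y := (size (map g (a :: s)) * Y)%N)); last exact/eqP.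
  exact/tprod_supp/allsupp_map.
rewrite size_map in E.
have hs' : sorted adj s by apply: path_sorted hs.
have [Yu|uY] := leqP Y (size u).
  have -> : (fun w => tprod Y (map g (a :: s)) (u ++ w ++ v)) =
    fun w => g a (take Y u) * tprod Y (map g s) (drop Y u ++ w ++ v).
    apply/funext => w; rewrite -{1}(cat_take_drop Y u) -catA /=.
    by rewrite take_size_cat ?drop_size_cat ?size_takel.
  by rewrite pairingZL IH // mulr0.
case: s E hs hs' IH => [|b s] /= E hs hs' IH; first by lia.
have [h2|h2] := leqP (size u + k)%N (2 * Y)%N.
  set x := (2 * Y - (size u + k))%N.
  have -> : pairing (fun w => tprod Y (map g (a :: b :: s)) (u ++ w ++ v)) p =
    pairing (fun w => tprod Y [:: g a; g b] (u ++ w ++ take x v) * tprod Y (map g s) (drop x v)) p.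
    apply: (eq_pairing hp) => w sw.
    rewrite -(tprod_cat (gs1 := [:: g a; g b])); last first.
      rewrite !size_cat size_takel /= /x ?sw; lia.
    by rewrite -!catA cat_take_drop.
  case/andP: hs => hab _.
  by rewrite pairingZR W2 ?mul0r.
case: s E hs hs' IH => [|c s] /= E hs hs' IH; first by lia.
set x := (3 * Y - (size u + k))%N.
have -> : pairing (fun w => tprod Y (map g (a :: b :: c :: s)) (u ++ w ++ v)) p =
    pairing (fun w => tprod Y [:: g a; g b; g c] (u ++ w ++ take x v) * tprod Y (map g s) (drop x v)) p.
  apply: (eq_pairing hp) => w sw.
  rewrite -(tprod_cat (gs1 := [:: g a; g b; g c])); last first.
    rewrite !size_cat size_takel /= /x ?sw; lia.
  by rewrite -!catA cat_take_drop.
case/and3P: hs => hab hbc _.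
rewrite pairingZR W3 ?mul0r // size_takel /x; lia.
Qed.

End Pairing.

(** * Isotropic vectors by counting equations *)

Lemma common_zero (K : fieldType) (S J : finType) (l : S -> J -> K) :
  (#|S| < #|J|)%N ->
  exists2 x : J -> K, (exists j, x j = 1) & forall s, \sum_j x j * l s j = 0.
Proof.
move=> hSJ.
pose M := \matrix_(j < #|J|, s < #|S|) l (enum_val s) (enum_val j).
have : kermx M != 0.
  rewrite -mxrank_eq0 mxrank_ker subn_eq0 -ltnNge.
  exact: leq_ltn_trans (rank_leq_col _) hSJ.
case/rowV0Pn => v /sub_kermxP vM /rV0Pn[j0 vj0].
exists (fun j => (v 0 j0)^-1 * v 0 (enum_rank j)) => [|s].
  by exists (enum_val j0); rewrite enum_valK mulVf.
under eq_bigr do rewrite -mulrA; rewrite -mulr_sumr.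
have /matrixP/(_ 0 (enum_rank s)) := vM; rewrite !mxE => h.
rewrite (reindex _ (onW_bij _ (@enum_val_bij J))) /=.
rewrite (_ : \sum_j _ = 0) ?mulr0 // -[RHS]h; apply: eq_bigr => j _.
by rewrite !mxE enum_rankK enum_valK.
Qed.

(** Once [x] is fixed, the bilinear conditions become linear in [y]. The extra equation
    [y 1 (b 0) = 0] accounts for the [+ 1]; subtracting a multiple of [y 1] from [y 0] then makes
    the coordinates at [b 0], [b 1] dual, which later supplies the dual words. *)
Lemma isotropic_pair (K : fieldType) (S1 S2 J : finType) (l : S1 -> J -> K)
    (B : S2 -> J -> J -> K) : (#|S1| + 2 * #|S2| + 1 < #|J|)%N ->
  exists (x : J -> K) (y : 'I_2 -> J -> K) (a : J) (b : 'I_2 -> J),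
  [/\ x a = 1, forall i k, y i (b k) = (i == k)%:R,
      forall s, \sum_j x j * l s j = 0, forall i s, \sum_j y i j * l s j = 0
    & forall i s, \sum_j \sum_k x j * y i k * B s j k = 0 /\
                  \sum_j \sum_k y i j * x k * B s j k = 0].
Proof.
move=> hJ.
have [|x [a xa] hx] := common_zero l; first by lia.
pose l1 (s : S1 + (S2 + S2)) j := match s with
  | inl s => l s j
  | inr (inl s) => \sum_k x k * B s k j
  | inr (inr s) => \sum_k x k * B s j k end.
have [|y0 [b0 yb0] hy0] := common_zero l1.
  by rewrite !card_sum; lia.
have [|y1 [b1 yb1] hy1] := common_zero (fun s => if s is Some s then l1 s else fun j => (j == b0)%:R).
  by rewrite card_option !card_sum; lia.
have y1b0 : y1 b0 = 0.
  rewrite -(hy1 None) (bigD1 b0) //= eqxx mulr1 big1 ?addr0 //.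
  by move=> j /negPf ->; rewrite mulr0.
pose z j := y0 j - y0 b1 * y1 j.
have hz s : \sum_j z j * l1 s j = 0.
  under eq_bigr do rewrite /z mulrBl -mulrA.
  by rewrite sumrB hy0 -mulr_sumr (hy1 (Some s)) mulr0 subr0.
pose y (i : 'I_2) := if i == 0 then z else y1.
have hy i s : \sum_j y i j * l1 s j = 0.
  by rewrite /y; case: ifP => _; [exact: hz | exact: (hy1 (Some s))].
exists x, y, a, (fun k : 'I_2 => if k == 0 then b0 else b1); split=> //.
- move=> i k; rewrite /y /z.
  case: i => [[|[|//]] ?]; case: k => [[|[|//]] ?] /=; rewrite ?yb0 ?y1b0 ?yb1.
  - by rewrite mulr0 subr0.
  - by rewrite mulr1 subrr.
  - by [].
  - by [].
- by move=> i s; exact: (hy i (inl s)).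
- move=> i s; split.
    rewrite -[RHS](hy i (inr (inl s))) exchange_big /=; apply: eq_bigr => j _.
    by rewrite mulr_sumr; apply: eq_bigr => k _; rewrite -mulrA mulrCA.
  rewrite -[RHS](hy i (inr (inr s))) /=; apply: eq_bigr => j _.
  by rewrite mulr_sumr; apply: eq_bigr => k _; rewrite -mulrA.
Qed.

(** * Factorisation of functionals at a cut *)

Section Factor.
Variable K : fieldType.
Local Notation word := (seq 'I_2).
Local Notation A := (freealg K 2).

(* Across the cut after [c] letters, the functionals [L i] only see a right
   ([rfac]), resp. left ([lfac]), space of dimension at most [D] independent of
   [i]. *)
Definition rfac (I : Type) (L : I -> word -> K) (c D : nat) :=
  exists2 T : finType, (#|T| <= D)%N & exists (a : I -> word -> T -> K) (g : T -> word -> K),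
    forall i u v, size u = c -> L i (u ++ v) = \sum_t a i u t * g t v.

Definition lfac (I : Type) (L : I -> word -> K) (c D : nat) :=
  exists2 T : finType, (#|T| <= D)%N & exists (h : T -> word -> K) (a : I -> word -> T -> K),
    forall i u v, size u = c -> L i (u ++ v) = \sum_t h t u * a i v t.

Lemma leq_rfac I (L : I -> word -> K) c D D' : (D <= D')%N -> rfac L c D -> rfac L c D'.
Proof. by move=> h [T TD X]; exists T => //; apply: leq_trans h. Qed.

Lemma leq_lfac I (L : I -> word -> K) c D D' : (D <= D')%N -> lfac L c D -> lfac L c D'.
Proof. by move=> h [T TD X]; exists T => //; apply: leq_trans h. Qed.

Definition combo (J : finType) (L : J -> word -> K) (x : J -> K) (w : word) : K :=
  \sum_j x j * L j w.

Lemma lfac_combo (J : finType) (L : J -> word -> K) c D : lfac L c D -> lfac (combo L) c D.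
Proof.
case=> T TD [h [a E]]; exists T => //; exists h, (fun x v t => \sum_j x j * a j v t).
move=> x u v su; rewrite /combo.
under eq_bigr do rewrite E // mulr_sumr.
rewrite exchange_big /=; apply: eq_bigr => t _; rewrite mulr_sumr.
by apply: eq_bigr => j _; rewrite mulrCA.
Qed.

Lemma rfac_combo (J : finType) (L : J -> word -> K) c D : rfac L c D -> rfac (combo L) c D.
Proof.
case=> T TD [a [g E]]; exists T => //; exists (fun x u t => \sum_j x j * a j u t), g.
move=> x u v su; rewrite /combo.
under eq_bigr do rewrite E // mulr_sumr.
rewrite exchange_big /=; apply: eq_bigr => t _; rewrite mulr_suml.
by apply: eq_bigr => j _; rewrite mulrA.
Qed.

Lemma supported_combo (J : finType) (L : J -> word -> K) Y x :
  (forall j, supported Y (L j)) -> supported Y (combo L x).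
Proof.
move=> h w; apply: contraNeq => sw; apply/eqP; apply: big1 => j _.
suff /eqP -> : L j w == 0 by rewrite mulr0.
by apply: contraNT sw => /h ->.
Qed.

Definition block_fac N D (phi : 'I_2 -> word -> K) :=
  forall c, (c < N)%N -> lfac phi c D /\ rfac phi c D.

Definition blocks N (phi : 'I_2 -> word -> K) (s : seq 'I_2) := tprod N (map phi s).

Section Cut.
Variables (N D : nat) (phi : 'I_2 -> word -> K).
Hypotheses (N0 : (0 < N)%N) (hfac : block_fac N D phi).

Lemma blocks_cut s c u v : (c < size s * N)%N -> size u = c ->
  blocks N phi s (u ++ v) =
  blocks N phi (take (c %/ N) s) (take (c %/ N * N) u) *
  (phi (nth 0 s (c %/ N)) (drop (c %/ N * N) u ++ take (N - c %% N) v) *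
   blocks N phi (drop (c %/ N).+1 s) (drop (N - c %% N) v)).
Proof.
move=> hc su; set a := (c %/ N)%N.
have ha : (a < size s)%N by rewrite ltn_divLR.
have ac : (a * N <= c)%N := leq_trunc_div _ _.
have cm : (c = a * N + c %% N)%N := divn_eq c N.
have hm : (c %% N < N)%N by rewrite ltn_mod.
rewrite -{1}(cat_take_drop a s) (drop_nth 0) // -{1}(cat_take_drop (a * N) u) -catA.
rewrite /blocks map_cat tprod_cat ?size_map ?size_takel ?su //; last by lia.
have sd : size (drop (a * N) u) = (c %% N)%N by rewrite size_drop su; lia.
rewrite /= take_cat drop_cat sd.
by case: ltnP => //; lia.
Qed.

(** The left part of a cut consists of complete blocks, whose indices are recorded by [T], and of a
    piece of the cut block, which ranges over a space of dimension at most [D]. *)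
Lemma lfac_blocks (I : Type) (s : I -> seq 'I_2) Q c (T : finType) (p : I -> T) (q : T -> seq 'I_2) :
  (c < Q * N)%N -> (forall i, size (s i) = Q) ->
  (forall i, take (c %/ N) (s i) = q (p i)) ->
  lfac (fun i => blocks N phi (s i)) c (#|T| * D).
Proof.
move=> hc hs hq; have [[T0 T0D [h [a E]]] _] := hfac (ltn_pmod c N0).
exists (T * T0 : finType)%type; first by rewrite card_prod leq_mul2l T0D orbT.
exists (fun t u => blocks N phi (q t.1) (take (c %/ N * N) u) * h t.2 (drop (c %/ N * N) u)).
exists (fun i v t => (t.1 == p i)%:R * (a (nth 0 (s i) (c %/ N)) (take (N - c %% N) v) t.2 *
   blocks N phi (drop (c %/ N).+1 (s i)) (drop (N - c %% N) v))).
move=> i u v su; rewrite (blocks_cut _ (c := c)) ?hs // hq.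
rewrite E; last by rewrite size_drop su; have := divn_eq c N; lia.
rewrite mulr_suml mulr_sumr.
rewrite [RHS](eq_bigr (fun t : T * T0 => (blocks N phi (q t.1) (take (c %/ N * N) u) * h t.2 (drop (c %/ N * N) u) *
   ((t.1 == p i)%:R * (a (nth 0 (s i) (c %/ N)) (take (N - c %% N) v) t.2 *
   blocks N phi (drop (c %/ N).+1 (s i)) (drop (N - c %% N) v)))))) //.
rewrite -(pair_bigA _ (fun t1 t2 => (blocks N phi (q t1) (take (c %/ N * N) u) * h t2 (drop (c %/ N * N) u) *
   ((t1 == p i)%:R * (a (nth 0 (s i) (c %/ N)) (take (N - c %% N) v) t2 *
   blocks N phi (drop (c %/ N).+1 (s i)) (drop (N - c %% N) v)))))) /=.
rewrite (bigD1 (p i)) //= [X in _ + X]big1 ?addr0; last first.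
  by move=> t /negPf ht; apply: big1 => t0 _; rewrite ht mul0r mulr0.
by apply: eq_bigr => t _; rewrite eqxx mul1r !mulrA.
Qed.

Lemma rfac_blocks (I : Type) (s : I -> seq 'I_2) Q c (T : finType) (p : I -> T) (q : T -> seq 'I_2) :
  (c < Q * N)%N -> (forall i, size (s i) = Q) ->
  (forall i, drop (c %/ N).+1 (s i) = q (p i)) ->
  rfac (fun i => blocks N phi (s i)) c (#|T| * D).
Proof.
move=> hc hs hq; have [_ [T0 T0D [a [g E]]]] := hfac (ltn_pmod c N0).
exists (T * T0 : finType)%type; first by rewrite card_prod leq_mul2l T0D orbT.
pose F1 i u t2 := blocks N phi (take (c %/ N) (s i)) (take (c %/ N * N) u) *
   a (nth 0 (s i) (c %/ N)) (drop (c %/ N * N) u) t2.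
pose F2 t1 t2 v := g t2 (take (N - c %% N) v) * blocks N phi (q t1) (drop (N - c %% N) v).
exists (fun i u t => (t.1 == p i)%:R * F1 i u t.2).
exists (fun t v => F2 t.1 t.2 v).
move=> i u v su; rewrite (blocks_cut _ (c := c)) ?hs // hq.
rewrite E; last by rewrite size_drop su; have := divn_eq c N; lia.
rewrite mulr_suml mulr_sumr.
rewrite -(pair_bigA _ (fun t1 t2 => (t1 == p i)%:R * F1 i u t2 * F2 t1 t2 v)) /=.
rewrite (bigD1 (p i)) //= [X in _ + X]big1 ?addr0; last first.
  by move=> t /negPf ht; apply: big1 => t0 _; rewrite ht !mul0r.
by apply: eq_bigr => t _; rewrite eqxx mul1r /F1 /F2 !mulrA.
Qed.

Lemma lfac_words Q c : (c < Q * N)%N ->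
  lfac (fun J : Q.-tuple 'I_2 => blocks N phi J) c (2 ^ (c %/ N) * D).
Proof.
move=> hc; have cQ : (c %/ N <= Q)%N by rewrite ltnW // ltn_divLR.
have sz (J : Q.-tuple 'I_2) : size (take (c %/ N) J) == (c %/ N)%N.
  by rewrite size_takel // size_tuple.
have := @lfac_blocks _ (fun J : Q.-tuple 'I_2 => J) Q c _ (fun J => Tuple (sz J)) (fun J => J).
by rewrite card_tuple card_ord; apply => // J; rewrite size_tuple.
Qed.

Lemma rfac_words Q c : (c < Q * N)%N ->
  rfac (fun J : Q.-tuple 'I_2 => blocks N phi J) c (2 ^ (Q.-1 - c %/ N) * D).
Proof.
move=> hc; have cQ : (c %/ N < Q)%N by rewrite ltn_divLR.
have sz (J : Q.-tuple 'I_2) : size (drop (c %/ N).+1 J) == (Q.-1 - c %/ N)%N.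
  by rewrite size_drop size_tuple; case: (Q) cQ => [|Q1] _; rewrite ?subSS ?sub0n.
have := @rfac_blocks _ (fun J : Q.-tuple 'I_2 => J) Q c _ (fun J => Tuple (sz J)) (fun J => J).
by rewrite card_tuple card_ord; apply => // J; rewrite size_tuple.
Qed.

Lemma blocks_supp s : (forall i, supported N (phi i)) -> supported (size s * N) (blocks N phi s).
Proof. by move=> h; rewrite -(size_map phi); apply/tprod_supp/allsupp_map. Qed.

Lemma blocks_dual (e : 'I_2 -> word) s s' :
  (forall i j, phi i (e j) = (i == j)%:R) -> (forall i, size (e i) = N) -> size s = size s' ->
  blocks N phi s (flatten (map e s')) = (s == s')%:R.
Proof.
move=> he se; elim: s s' => [|i s IH] [|j s'] //= [ss].
rewrite /blocks /= take_size_cat ?drop_size_cat // he -/(blocks N phi s _) IH //.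
by rewrite eqseq_cons -mulnb natrM.
Qed.
End Cut.
End Factor.

(** Families of forms arise with index types that depend on the relation and the offset; padding
    them with [x0] to a common ordinal lets all the equations be counted together. *)
Lemma pad_ord (T : finType) (X : Type) (x0 : X) D (F : T -> X) : (#|T| <= D)%N ->
  exists G : 'I_D -> X, forall t, exists k, G k = F t.
Proof.
move=> TD; exists (fun k => if insub (k : nat) : option 'I_#|T| is Some k' then F (enum_val k') else x0).
move=> t; exists (widen_ord TD (enum_rank t)).
by rewrite /= valK enum_rankK.
Qed.

Lemma leq_divD2 d m n : (m %/ d + n %/ d <= (m + n) %/ d)%N.
Proof.
case: d => [|d]; first by rewrite !divn0.
by rewrite leq_divRL // mulnDl leq_add // leq_trunc_div.
Qed.

(** * Block systems *)

Section Stage.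
Variable K : fieldType.
Local Notation word := (seq 'I_2).
Local Notation A := (freealg K 2).

(* All concatenations of the length-[N] functionals [phi 0], [phi 1] vanish on
   [T], at every offset; [e 0], [e 1] are words dual to [phi 0], [phi 1].  The
   number [D] controls the equations that the next stage has to solve. *)
Record system N D (T : set A) (phi : 'I_2 -> word -> K) (e : 'I_2 -> word) : Prop := System {
  sys_pos : (0 < N)%N;
  sys_supp : forall i, supported N (phi i);
  sys_size : forall i, size (e i) = N;
  sys_dual : forall i j, phi i (e j) = (i == j)%:R;
  sys_kill : forall p, T p -> forall s, kills (blocks N phi s) p;
  sys_fac : block_fac N D phi }.

(** Valid for words of any length: on words shorter than the first group, both sides vanish by the
    supports. *)
Lemma tprod_cat_take Y (gs1 gs2 : seq (word -> K)) w : allsupp Y gs1 -> allsupp Y gs2 ->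
  tprod Y (gs1 ++ gs2) w =
  tprod Y gs1 (take (size gs1 * Y) w) * tprod Y gs2 (drop (size gs1 * Y) w).
Proof.
move=> h1 h2; have [hw|hw] := leqP (size gs1 * Y)%N (size w).
  by rewrite -{1}(cat_take_drop (size gs1 * Y) w) tprod_cat // size_takel.
have h0 : tprod Y gs1 (take (size gs1 * Y) w) = 0.
  apply/eqP; apply: contraTT hw => /(tprod_supp h1); rewrite -leqNgt.
  by case: (leqP (size w) (size gs1 * Y)) => [h|h _]; [rewrite take_oversize // => -> | exact: ltnW].
have h12 : allsupp Y (gs1 ++ gs2).
  move=> i; rewrite size_cat nth_cat; case: (ltnP i (size gs1)) => [hi _|hi hi']; first exact: h1.
  by apply: h2; rewrite ltn_subLR.
rewrite h0 mul0r; apply/eqP; apply: contraTT hw => /(tprod_supp h12).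
by rewrite size_cat mulnDl -leqNgt => ->; rewrite leq_addr.
Qed.

Lemma tprod_blocks Q Y (gs : 'I_2 -> seq (word -> K)) s w :
  (forall i, size (gs i) = Q) -> (forall i, allsupp Y (gs i)) ->
  tprod (Q * Y) [seq tprod Y (gs i) | i <- s] w = tprod Y (flatten (map gs s)) w.
Proof.
move=> hs hg; elim: s w => [|i s IH] w //=.
rewrite IH tprod_cat_take ?hs //.
elim: s {IH} => [|j s IH] //= m hm; have := hm; rewrite size_cat nth_cat; case: (ltnP m (size (gs j))) => [h _|h h'].
  exact: hg.
by apply: IH; rewrite ltn_subLR.
Qed.

(* Only one block in [j.+1] is left free.  This keeps the dimension of the space
   of pieces, hence later [D], polynomial in the number of relations. *)
Lemma thin_system N D T phi e j : system N D T phi e -> (0 < D)%N ->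
  exists phi' e', system (j.+1 * N) (2 * D) T phi' e'.
Proof.
move=> [N0 hs se he hk hf] D0.
pose F (i : 'I_2) := i :: nseq j 0.
have sF i : size (F i) = j.+1 by rewrite /= size_nseq.
exists (fun i => blocks N phi (F i)), (fun i => flatten (map e (F i))); split.
- by rewrite muln_gt0.
- by move=> i; rewrite -(sF i); apply: blocks_supp.
- move=> i; rewrite -(sF i); elim: (F i) => [|x s IH] //=.
  by rewrite size_cat se IH mulSn.
- move=> i k; rewrite blocks_dual ?sF //; congr (_%:R).
  by rewrite /F eqseq_cons eqxx andbT.
- move=> p Tp s u v.
  rewrite -[RHS](hk p Tp (flatten (map F s)) u v); congr (pairing _ p); apply/funext => w.
  rewrite /blocks (tprod_blocks (gs := fun i => map phi (F i))).
  + congr (tprod _ _ _); elim: s => //= i s ->.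
    by rewrite map_cat.
  + by move=> i; rewrite size_map.
  + by move=> i; apply: allsupp_map.
(* Only the left side of a cut beyond the first block contains the free index among its complete
   blocks, hence the factor 2. On every other side the complete blocks are fixed. *)
move=> c hc; have [c0|c1] := eqVneq (c %/ N)%N 0%N.
  split.
    apply: (@leq_lfac _ _ _ _ (#|{: unit}| * D)); first by rewrite card_unit mul1n leq_pmull.
    by apply: (@lfac_blocks _ _ _ _ N0 hf _ F j.+1 c unit (fun=> tt) (fun=> [::])) => // i; rewrite c0.
  apply: (@leq_rfac _ _ _ _ (#|{: unit}| * D)); first by rewrite card_unit mul1n leq_pmull.
  by apply: (@rfac_blocks _ _ _ _ N0 hf _ F j.+1 c unit (fun=> tt) (fun=> nseq j 0)) => // i; rewrite c0 /= drop0.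
have [d cd] : exists d, (c %/ N)%N = d.+1 by exists (c %/ N).-1; rewrite prednK // lt0n.
split.
  have -> : (2 * D = #|'I_2| * D)%N by rewrite card_ord.
  apply: (@lfac_blocks _ _ _ _ N0 hf _ F j.+1 c 'I_2 id (fun i => i :: take d (nseq j 0))) => // i.
  by rewrite cd.
apply: (@leq_rfac _ _ _ _ (#|{: unit}| * D)); first by rewrite card_unit mul1n leq_pmull.
by apply: (@rfac_blocks _ _ _ _ N0 hf _ F j.+1 c unit (fun=> tt) (fun=> drop d.+1 (nseq j 0))) => // i; rewrite cd.
Qed.

Section Forms.
Variables (N D Q : nat) (phi : 'I_2 -> word -> K).
Hypotheses (N0 : (0 < N)%N) (D0 : (0 < D)%N) (hs : forall i, supported N (phi i)).
Hypothesis hf : block_fac N D phi.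
Let Y := (Q * N)%N.
Local Notation J := (Q.-tuple 'I_2).
Local Notation W := (fun s : J => blocks N phi s).
Local Notation C := (combo W).

Lemma words_supp s : supported Y (W s).
Proof. by have := blocks_supp (s := s) hs; rewrite size_tuple. Qed.

Lemma combo_words_supp x : supported Y (C x).
Proof. by apply: supported_combo => s; exact: words_supp. Qed.

Lemma words_lfac c : (c < Y)%N -> lfac W c (2 ^ (c %/ N) * D).
Proof. by move=> hc; apply: lfac_words. Qed.

(** The end point [c = Y] occurs when a relation ends exactly where the second piece ends; the right
    part is then empty. *)
Lemma words_rfac c : (c <= Y)%N -> rfac W c (2 ^ ((Y - c) %/ N) * D).
Proof.
rewrite leq_eqVlt => /orP[/eqP->|hc].
  rewrite subnn div0n mul1n.
  exists unit; first by rewrite card_unit.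
  exists (fun s u _ => W s u), (fun _ v => (v == [::])%:R) => s u v su.
  rewrite big_const card_unit /= addr0; case: eqP => [->|hv]; first by rewrite cats0 mulr1.
  rewrite mulr0; apply/eqP; apply/negP => /negP /words_supp; rewrite size_cat su.
  by move/eqP; rewrite -[X in _ == X]addn0 eqn_add2l => /nilP.
apply: leq_rfac (rfac_words N0 hf hc).
rewrite leq_mul2r; apply/orP; right; rewrite leq_exp2l // leq_divRL //.
have := divn_eq c N; have := ltn_pmod c N0; have : (c %/ N < Q)%N by rewrite ltn_divLR.
by rewrite /Y; nia.
Qed.

Lemma tprod2E g1 g2 z : supported Y g2 ->
  tprod Y [:: g1; g2] z = g1 (take Y z) * g2 (drop Y z) :> K.
Proof. by move=> h; rewrite -(tprod1 _ h). Qed.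

Lemma tprod3E g1 g2 g3 z : supported Y g3 ->
  tprod Y [:: g1; g2; g3] z = g1 (take Y z) * (g2 (take Y (drop Y z)) * g3 (drop Y (drop Y z))) :> K.
Proof. by move=> h; rewrite -(tprod1 _ h). Qed.

(** Separates the outer factors [h], [g], which see only the context of a relation, from a bilinear
    form in [x], [y] whose coefficients see only the relation. *)
Lemma mul_combo (T1 T2 S : finType) (x y : S -> K) (h : T1 -> K) (g : T2 -> K)
    (a1 : S -> T1 -> K) (a2 : S -> T2 -> K) :
  (\sum_s x s * \sum_t h t * a1 s t) * (\sum_s y s * \sum_t a2 s t * g t) =
  \sum_(t : T1 * T2) h t.1 * g t.2 * \sum_s \sum_s' x s * y s' * (a1 s t.1 * a2 s' t.2).
Proof.
have E1 : \sum_s x s * \sum_t h t * a1 s t = \sum_t h t * \sum_s x s * a1 s t.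
  under eq_bigr do rewrite mulr_sumr.
  rewrite exchange_big /=; apply: eq_bigr => t _; rewrite mulr_sumr.
  by apply: eq_bigr => s _; rewrite mulrCA.
have E2 : \sum_s y s * \sum_t a2 s t * g t = \sum_t g t * \sum_s y s * a2 s t.
  under eq_bigr do rewrite mulr_sumr.
  rewrite exchange_big /=; apply: eq_bigr => t _; rewrite mulr_sumr.
  by apply: eq_bigr => s _; ring.
rewrite E1 E2 mulr_suml.
rewrite -(pair_bigA _ (fun t1 t2 => h t1 * g t2 * \sum_s \sum_s' x s * y s' * (a1 s t1 * a2 s' t2))) /=.
apply: eq_bigr => t _; rewrite mulr_sumr; apply: eq_bigr => t' _.
rewrite mulrACA; congr (_ * _); rewrite mulr_suml; apply: eq_bigr => s _.
by rewrite mulr_sumr; apply: eq_bigr => s' _; ring.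
Qed.

Lemma form_bound (T1 T2 : finType) a b E : (#|T1| <= 2 ^ a * D)%N -> (#|T2| <= 2 ^ b * D)%N ->
  (a + b <= E)%N -> (#|{: T1 * T2}| <= D * D * 2 ^ E)%N.
Proof.
move=> h1 h2 h; rewrite card_prod.
apply: leq_trans (leq_mul h1 h2) _.
rewrite mulnACA -expnD mulnC leq_mul2l; apply/orP; right.
by rewrite leq_exp2l.
Qed.

(* A relation of degree [k] in [Y, 2Y] meets two or three consecutive pieces of
   length [Y].  Meeting three, it covers the middle one: expanding the outer
   overlaps on bases leaves linear conditions on the middle piece alone.
   Meeting two, it misses at most [2Y - k] letters, and expanding these leaves
   bilinear conditions on the pair. *)
Lemma bilinear_forms p k f E : homogeneous k f -> (Y < k <= 2 * Y)%N -> ((2 * Y - k) %/ N <= E)%N ->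
  exists B : 'I_(D * D * 2 ^ E) -> J -> J -> K, forall x y,
    (forall t, \sum_s \sum_s' x s * y s' * B t s s' = 0) ->
    forall u v, size u = p -> pairing (fun w => tprod Y [:: C x; C y] (u ++ w ++ v)) f = 0.
Proof.
move=> hfk /andP[Yk k2] hE.
have supp2 x y : supported (2 * Y) (tprod Y [:: C x; C y]).
  by apply: (@tprod_supp _ _ [:: C x; C y]) => [[|[|i]]] // _; exact: combo_words_supp.
have [pk|pk] := leqP (p + k)%N (2 * Y)%N; last first.
  exists (fun _ _ _ => 0) => x y _ u v su.
  by apply: (kills_supp (supp2 x y) hfk); lia.
have pY : (p < Y)%N by lia.
have cY : (p + k - Y <= Y)%N by lia.
have [T1 T1c [h [a1 E1]]] := words_lfac pY.
have [T2 T2c [a2 [g E2]]] := words_rfac cY.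
pose G (t : T1 * T2) (s s' : J) w := a1 s (take (Y - p) w) t.1 * a2 s' (drop (Y - p) w) t.2.
have [|B hB] := @pad_ord (T1 * T2)%type _ (fun _ _ => 0) (D * D * 2 ^ E)%N (fun t s s' => pairing (G t s s') f).
  (* The letters missed on the left and on the right number [p] and [2 * Y - (p + k)], altogether
     [2 * Y - k]. *)
  apply: form_bound T1c T2c _; apply: leq_trans hE.
  by apply: leq_trans (leq_divD2 _ _ _) _; apply: leq_div2r; lia.
exists B => x y hxy u v su.
have [sv|sv] := eqVneq (size v) (2 * Y - (p + k))%N; last first.
  by apply: (kills_supp (supp2 x y) hfk); lia.
transitivity (pairing (fun w => \sum_t h t.1 u * g t.2 v *
   \sum_s \sum_s' x s * y s' * G t s s' w) f).
  apply: (eq_pairing hfk) => w sw.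
  rewrite (tprod2E _ _ (@combo_words_supp y)).
  have -> : u ++ w ++ v = (u ++ take (Y - p) w) ++ drop (Y - p) w ++ v.
    by rewrite -catA [take (Y - p) w ++ _]catA cat_take_drop.
  have s1 : size (u ++ take (Y - p) w) = Y by rewrite size_cat size_takel ?su ?sw; lia.
  rewrite take_size_cat // drop_size_cat //.
  rewrite -(mul_combo x y (h^~ u) (g^~ v) (fun s => a1 s (take (Y - p) w)) (fun s => a2 s (drop (Y - p) w))).
  rewrite /combo; congr (_ * _); apply: eq_bigr => s _; congr (_ * _).
    by rewrite E1.
  by rewrite E2 // size_drop sw; lia.
rewrite pairing_sumL big1 // => t _.
rewrite (_ : pairing _ f = 0) ?mulr0 //.
have [m hm] := hB t; rewrite -[RHS](hxy m) hm.
under [in LHS]eq_fun do rewrite pair_bigA /=.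
rewrite pairing_sumL pair_bigA.
by [].
Qed.

Lemma linear_forms p k f E : homogeneous k f -> (Y < k <= 2 * Y)%N -> ((k - Y) %/ N <= E)%N ->
  (p < Y)%N ->
  exists l : 'I_(D * D * 2 ^ E) -> J -> K, forall y,
    (forall t, \sum_s y s * l t s = 0) ->
    forall x z u v, size u = p -> (size v < Y)%N ->
    pairing (fun w => tprod Y [:: C x; C y; C z] (u ++ w ++ v)) f = 0.
Proof.
move=> hfk /andP[Yk k2] hE pY.
have supp3 x y z : supported (3 * Y) (tprod Y [:: C x; C y; C z]).
  by apply: (@tprod_supp _ _ [:: C x; C y; C z]) => [[|[|[|i]]]] // _; exact: combo_words_supp.
have [pk|pk] := leqP (p + k)%N (2 * Y)%N.
  exists (fun _ _ => 0) => y _ x z u v su sv.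
  by apply: (kills_supp (supp3 x y z) hfk); lia.
have cY : (p + k - 2 * Y < Y)%N by lia.
have [T1 T1c [a1 [g E1]]] := rfac_combo (words_rfac (ltnW pY)).
have [T2 T2c [h [a2 E2]]] := lfac_combo (words_lfac cY).
pose G (t : T1 * T2) (s : J) w := 
  g t.1 (take (Y - p) w) * (W s (take Y (drop (Y - p) w)) * h t.2 (drop (2 * Y - p) w)).
have [|l hl] := @pad_ord (T1 * T2)%type _ (fun _ => 0) (D * D * 2 ^ E)%N (fun t s => pairing (G t s) f).
  (* The relation protrudes from the middle piece by [Y - p] letters on the left and [p + k - 2 * Y]
     on the right, altogether [k - Y]. *)
  apply: form_bound T1c T2c _; apply: leq_trans hE.
  by apply: leq_trans (leq_divD2 _ _ _) _; apply: leq_div2r; lia.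
exists l => y hy x z u v su sv0.
have [sv|sv] := eqVneq (size v) (3 * Y - (p + k))%N; last first.
  by apply: (kills_supp (supp3 x y z) hfk); lia.
transitivity (pairing (fun w => \sum_t a1 x u t.1 * a2 z v t.2 * \sum_s y s * G t s w) f).
  apply: (eq_pairing hfk) => w sw.
  rewrite (tprod3E _ _ _ (@combo_words_supp z)).
  have -> : u ++ w ++ v = u ++ take (Y - p) w ++ take Y (drop (Y - p) w) ++ drop (2 * Y - p) w ++ v.
    rewrite (_ : (2 * Y - p = Y + (Y - p))%N); last by lia.
    by rewrite -drop_drop [take Y _ ++ _]catA cat_take_drop [take (Y - p) _ ++ _]catA cat_take_drop.
  have s1 : size (u ++ take (Y - p) w) = Y by rewrite size_cat size_takel ?su ?sw; lia.
  rewrite [u ++ _]catA take_size_cat // drop_size_cat //.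
  have s2 : size (take Y (drop (Y - p) w)) = Y by rewrite size_takel ?size_drop ?sw; lia.
  rewrite take_size_cat // drop_size_cat //.
  rewrite E1 // E2; last by rewrite size_drop sw; lia.
  rewrite /G [C y _]/combo mulr_suml.
  rewrite -(pair_bigA _ (fun t1 t2 => a1 x u t1 * a2 z v t2 * \sum_s y s * (g t1 (take (Y - p) w) *
      (W s (take Y (drop (Y - p) w)) * h t2 (drop (2 * Y - p) w))))) /=.
  apply: eq_bigr => t _; rewrite !mulr_sumr; apply: eq_bigr => t' _.
  rewrite mulr_suml !mulr_sumr; apply: eq_bigr => s _.
  by ring.
rewrite pairing_sumL big1 // => t _.
rewrite pairing_sumL.
have [m hm] := hl t; have := hy m; rewrite hm => ->.
by rewrite mulr0.
Qed.
(** The [Q.-1] blocks other than the cut one lie on two sides, so one side has at most half of them;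
    expanding on that side gives the bound. *)
Lemma combo_words_rank c : (c < Y)%N -> exists2 T : finType, (#|T| <= 2 ^ (Q.-1)./2 * D)%N &
  exists (a b : (J -> K) -> T -> word -> K),
    forall x u v, size u = c -> C x (u ++ v) = \sum_t a x t u * b x t v.
Proof.
move=> hc; have [le|ge] := leqP (c %/ N)%N (Q.-1)./2.
  have [T Tc [h [a E]]] := lfac_combo (words_lfac hc).
  exists T; last by exists (fun _ => h), (fun x t v => a x v t).
  by apply: leq_trans Tc _; rewrite leq_mul2r leq_exp2l // le orbT.
have [T Tc [a [g E]]] := rfac_combo (rfac_words N0 hf hc).
exists T; last by exists (fun x t u => a x u t), (fun _ => g).
apply: leq_trans Tc _; rewrite leq_mul2r leq_exp2l //; apply/orP; right.
rewrite leq_subLR; have := odd_double_half Q.-1; lia.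
Qed.

Lemma sum_pick (T : finType) (i : 'I_2) (F : 'I_2 -> T -> K) :
  \sum_(t : 'I_2 * T) (t.1 == i)%:R * F t.1 t.2 = \sum_t F i t.
Proof.
rewrite -(pair_bigA _ (fun j t => (j == i)%:R * F j t)) /= (bigD1 i) //= [X in _ + X]big1 ?addr0.
  by apply: eq_bigr => t _; rewrite eqxx mul1r.
by move=> j /negPf ->; apply: big1 => t _; rewrite mul0r.
Qed.

(** The factors from [combo_words_rank] depend on the combination. Only [y i] varies, over two
    values, so adding [i] to the summation index makes them uniform at the cost of a factor 2. *)
Lemma pair_fac x (y : 'I_2 -> J -> K) :
  block_fac (2 * Y) (2 * (2 ^ (Q.-1)./2 * D)) (fun i => tprod Y [:: C x; C (y i)]).
Proof.
move=> c hc; set m := (2 ^ _ * D)%N.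
have E i z : tprod Y [:: C x; C (y i)] z = C x (take Y z) * C (y i) (drop Y z).
  by apply: tprod2E; exact: combo_words_supp.
have [cY|cY] := ltnP c Y.
  have [T Tc [a [b ab]]] := combo_words_rank cY.
  have E2 i u v : size u = c -> tprod Y [:: C x; C (y i)] (u ++ v) =
      (\sum_t a x t u * b x t (take (Y - c) v)) * C (y i) (drop (Y - c) v).
    by move=> su; rewrite E take_cat drop_cat su ltnNge (ltnW cY) /= ab.
  split.
    apply: (@leq_lfac _ _ _ _ m); first by rewrite leq_pmull.
    exists T => //.
    exists (fun t u => a x t u), (fun i v t => b x t (take (Y - c) v) * C (y i) (drop (Y - c) v)).
    by move=> i u v su; rewrite E2 // mulr_suml; apply: eq_bigr => t _; rewrite mulrA.
  exists ('I_2 * T : finType)%type; first by rewrite card_prod card_ord leq_mul2l.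
  exists (fun i u t => (t.1 == i)%:R * a x t.2 u),
    (fun t v => b x t.2 (take (Y - c) v) * C (y t.1) (drop (Y - c) v)).
  move=> i u v su; rewrite E2 //.
  under [RHS]eq_bigr do rewrite -mulrA.
  rewrite (sum_pick i (fun j t => a x t u * (b x t (take (Y - c) v) * C (y j) (drop (Y - c) v)))).
  by rewrite mulr_suml; apply: eq_bigr => t _; rewrite mulrA.
have cY' : (c - Y < Y)%N by lia.
have [T Tc [a [b ab]]] := combo_words_rank cY'.
have E2 i u v : size u = c -> tprod Y [:: C x; C (y i)] (u ++ v) =
    C x (take Y u) * \sum_t a (y i) t (drop Y u) * b (y i) t v.
  move=> su; rewrite E takel_cat ?su // drop_cat su.
  case: ltnP => [h|h]; first by rewrite ab // size_drop su.
  have -> : drop (Y - c) v = v by rewrite (_ : (Y - c = 0)%N) ?drop0 //; lia.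
  have d0 : drop Y u = [::] by rewrite drop_oversize ?su.
  by rewrite d0 -ab ?cat0s //=; lia.
split.
  exists ('I_2 * T : finType)%type; first by rewrite card_prod card_ord leq_mul2l.
  exists (fun t u => C x (take Y u) * a (y t.1) t.2 (drop Y u)),
    (fun i v t => (t.1 == i)%:R * b (y t.1) t.2 v).
  move=> i u v su; rewrite E2 //.
  under [RHS]eq_bigr do rewrite mulrCA.
  rewrite (sum_pick i (fun j t => C x (take Y u) * a (y j) t (drop Y u) * b (y j) t v)).
  by rewrite mulr_sumr; apply: eq_bigr => t _; rewrite mulrA.
exists ('I_2 * T : finType)%type; first by rewrite card_prod card_ord leq_mul2l.
exists (fun i u t => (t.1 == i)%:R * (C x (take Y u) * a (y t.1) t.2 (drop Y u))),
  (fun t v => b (y t.1) t.2 v).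
move=> i u v su; rewrite E2 //.
under [RHS]eq_bigr do rewrite -mulrA.
rewrite (sum_pick i (fun j t => C x (take Y u) * a (y j) t (drop Y u) * b (y j) t v)).
by rewrite mulr_sumr; apply: eq_bigr => t _; rewrite mulrA.
Qed.

Lemma tprod_combo_span (xs : seq (J -> K)) : exists r : seq (K * seq 'I_2),
  forall w, tprod Y (map C xs) w = \sum_(c <- r) c.1 * blocks N phi c.2 w.
Proof.
elim: xs => [|x xs [r IH]].
  by exists [:: (1, [::])] => w; rewrite big_seq1 mul1r.
exists [seq (x s * c.1, (s : seq 'I_2) ++ c.2) | s <- index_enum {: J}, c <- r] => w.
rewrite big_allpairs_dep /= IH /combo mulr_suml; apply: eq_bigr => s _.
rewrite mulr_sumr; apply: eq_bigr => c _ /=.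
rewrite /blocks map_cat tprod_cat_take; try exact: allsupp_map.
by rewrite size_map size_tuple -/Y mulrACA.
Qed.

Lemma kills_combo p (xs : seq (J -> K)) : (forall s, kills (blocks N phi s) p) ->
  kills (tprod Y (map C xs)) p.
Proof.
move=> h u v; have [r hr] := tprod_combo_span xs.
under eq_fun do rewrite hr.
by rewrite pairing_sumL big1 // => c _; rewrite h mulr0.
Qed.
End Forms.

(* Quadratic conditions are avoided by alternating a fixed piece [x] with the
   variable pieces [y 0], [y 1]: only the pairs [x, y i] and [y i, x] occur, and
   their conditions are linear once [x] is known.  The new blocks are
   [x (x) y i]. *)
Lemma next_system N D T phi e Q r (f : 'I_r -> A) (k : 'I_r -> nat) E :
  let Y := (Q * N)%N in
  system N D T phi e -> (0 < D)%N -> (0 < Q)%N ->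
  (forall j, homogeneous (k j) (f j)) -> (forall j, Y < k j <= 2 * Y)%N ->
  (forall j, (2 * Y - k j) %/ N <= E)%N -> (forall j, (k j - Y) %/ N <= E)%N ->
  (3 * (r * Y * (D * D * 2 ^ E)) + 1 < 2 ^ Q)%N ->
  exists phi' e', system (2 * Y) (2 * (2 ^ (Q.-1)./2 * D)) (T `|` range f) phi' e'.
Proof.
move=> Y [N0 hs se he hk hf] D0 Q0 fh kY E1 E2 count.
have Y0 : (0 < Y)%N by rewrite muln_gt0 Q0.
have hl (jp : 'I_r * 'I_Y) := linear_forms N0 D0 hs hf (fh jp.1) (kY jp.1) (E2 jp.1) (ltn_ord jp.2).
have hb (jp : 'I_r * 'I_Y) := bilinear_forms N0 D0 hs hf jp.2 (fh jp.1) (kY jp.1) (E1 jp.1).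
have {hl}[l hl] := choice hl; have {hb}[B hb] := choice hb.
(* Each relation and each of the [Y] offsets gives [D * D * 2 ^ E] linear conditions, and as many
   bilinear ones for each of the two orders of [x] and [y i]; this is the factor 3 in [count]. *)
have [|x [y [a [b [xa yb lx ly Bxy]]]]] := isotropic_pair
    (fun s : ('I_r * 'I_Y) * 'I_(D * D * 2 ^ E) => l s.1 s.2)
    (fun s : ('I_r * 'I_Y) * 'I_(D * D * 2 ^ E) => B s.1 s.2).
  by rewrite !card_prod !card_ord card_tuple card_ord; lia.
pose W (s : Q.-tuple 'I_2) := blocks N phi s.
pose C := combo W.
have Cs z : supported Y (C z) by exact: combo_words_supp.
(* [None] codes the fixed piece [x] and [Some i] the piece [y i]; [adj] expresses that the two kinds
   alternate. *)
pose vec (o : option 'I_2) := if o is Some i then y i else x.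
have hvec o jp t : \sum_j vec o j * l jp t j = 0.
  by case: o => [i|]; [exact: (ly i (jp, t)) | exact: (lx (jp, t))].
pose adj : rel (option 'I_2) := fun o o' => (o == None) != (o' == None).
have kil s j : sorted adj s -> kills (tprod Y (map (fun o => C (vec o)) s)) (f j).
  apply: (kills_tprod Y0 (kY j) (fh j)) => //.
    move=> o o' hoo' u v; have [pY|pY] := ltnP (size u) Y; last first.
      have : supported (2 * Y) (tprod Y [:: C (vec o); C (vec o')]).
        by apply: (@tprod_supp _ _ [:: C (vec o); C (vec o')]) => [[|[|m]]] // _; exact: Cs.
      by move=> h; apply: (kills_supp h (fh j)); have := kY j; lia.
    apply: (hb (j, Ordinal pY)) => //= t.
    case: o o' hoo' => [i|] [i'|] // _.
      by have [] := Bxy i ((j, Ordinal pY), t).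
    by have [] := Bxy i' ((j, Ordinal pY), t).
  move=> o o' o'' u v _ _ su sv.
  by apply: (hl (j, Ordinal su)) => //= t; exact: hvec.
pose phi' (i : 'I_2) := tprod Y [:: C x; C (y i)].
pose gs (i : 'I_2) := [:: C x; C (y i)].
have gsupp i : allsupp Y (gs i) by case=> [|[|m]] // _; exact: Cs.
have phiE s w : blocks (2 * Y) phi' s w = tprod Y (flatten (map gs s)) w.
  by rewrite /blocks (tprod_blocks (gs := gs)).
have C1 z (s : Q.-tuple 'I_2) : C z (flatten (map e s)) = z s.
  rewrite /C /combo /W (bigD1 s) //= (blocks_dual he) // eqxx mulr1 big1 ?addr0 //.
  move=> s' /negPf ns.
  by rewrite (blocks_dual he) ?size_tuple // -[tval s' == _]/(s' == s) ns mulr0.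
have sfl (s : Q.-tuple 'I_2) : size (flatten (map e s)) = Y.
  have -> : Y = (size s * N)%N by rewrite size_tuple.
  by elim: (tval s) => //= i s' IH; rewrite size_cat se IH.
exists phi', (fun i => flatten (map e a) ++ flatten (map e (b i))); split.
- by rewrite muln_gt0.
- by move=> i; exact: (tprod_supp (gsupp i)).
- by move=> i; rewrite size_cat !sfl mul2n addnn.
- move=> i j; rewrite /phi' tprod2E // take_size_cat ?drop_size_cat // !C1.
  by rewrite xa yb mul1r.
- move=> p Tp s u v; under eq_fun do rewrite phiE.
  case: Tp => [Tp|[j _ <-]].
    have -> : flatten (map gs s) = map C (flatten [seq [:: x; y i] | i <- s]).
      by elim: s => //= i s ->.
    by apply: (kills_combo hs); exact: hk.
  have -> : flatten (map gs s) = map (fun o => C (vec o)) (flatten [seq [:: None; Some i] | i <- s]).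
    by elim: s => //= i s ->.
  apply: kil; case: s => //= i s; elim: s i => //= i' s IH i; exact: IH.
exact: pair_fac.
Qed.
End Stage.

(** * Iteration over the relations *)

Lemma in_gapE n k : in_gap n.+2 k = (7 * 2 ^ n < k < 12 * 2 ^ n)%N.
Proof.
rewrite /in_gap.
have e2 m : (2 : rat) ^ (m%:Z) = (2 ^ m)%:R by rewrite -exprnP natrX.
have -> : n.+2%:Z - 1 = n.+1%:Z by lia.
have -> : n.+2%:Z - 2 = n%:Z by lia.
have -> : n.+2%:Z + 1 = n.+3%:Z by lia.
rewrite !e2 -!natrD !ltr_nat !expnS.
by congr (_ && _); congr (_ < _)%N; lia.
Qed.

(** In units of [2 ^ (n - 4)] the degree lies in []16, 32]]; the gap at [n - 1] removes []14, 24[]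
    and the gap at [n] removes []28, 48[]. For [n = 3] the unit would be a fraction. *)
Lemma gap_degree n k : (3 <= n)%N -> (2 ^ n < k <= 2 ^ n.+1)%N -> (forall m, ~~ in_gap m k) ->
  (24 * 2 ^ (n - 4) <= k <= 28 * 2 ^ (n - 4))%N \/ (n = 3)%N.
Proof.
case: n => [|[|[|[|n]]]] // _; first by right.
move=> hk hg; left; have := hg n.+4; have := hg n.+3.
rewrite !in_gapE (_ : (n.+4 - 4 = n)%N); last by lia.
move: hk; rewrite !expnS; lia.
Qed.

(** Excludes relations of degree 2, the only degree counted by [r 0]. *)
Lemma in_gap02 : in_gap 0 2.
Proof. by []. Qed.

Lemma exp2D a b c : (a + b = c)%N -> (2 ^ a * 2 ^ b = 2 ^ c)%N.
Proof. by move<-; rewrite expnD. Qed.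

Lemma exp2_16 a c : (4 <= c)%N -> (a = c - 4)%N -> (16 * 2 ^ a = 2 ^ c)%N.
Proof. by move=> h ->; rewrite -[in RHS](subnKC h) expnD. Qed.

(** For pieces of [16 * b] blocks, the share [11/17] amounts to [176 * b / 17] blocks, slightly less
    than [32 * b / 3]; the latter bound suits the cubing in [count_next]. *)
Lemma ratio_bound b : exists E, (176 * b %/ 17 <= E)%N /\ (3 * E <= 32 * b)%N.
Proof.
exists (176 * b %/ 17)%N; split; first exact: leqnn.
move: (leq_trunc_div (176 * b) 17); move: (176 * b %/ 17)%N => E; lia.
Qed.

Lemma first_exponents n i : (8 <= n)%N -> (5 <= i)%N -> (i <= n - 3)%N ->
  (i - 2 + (n - 2 - i) = n - 4)%N.
Proof. lia. Qed.

Lemma next_exponents n m i : (8 <= m)%N -> (m < n)%N -> (5 <= i)%N -> (i <= n - m - 3)%N ->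
  [/\ (n - m - 3 - i + (m - 3) = n - 6 - i)%N, (i - 2 + (n - 6 - i) = n - 8)%N,
      (n - 8 = n - 4 - 4)%N & (4 <= n - 4)%N].
Proof. by move=> *; split; lia. Qed.

Section Iterate.
Variable K : fieldType.
Local Notation word := (seq 'I_2).
Local Notation A := (freealg K 2).

Lemma system_weaken N D D' (T T' : set A) phi e : system N D T phi e -> (D <= D')%N -> T' `<=` T ->
  system N D' T' phi e.
Proof.
case=> N0 hs se he hk hf DD TT; split => //.
- by move=> p /TT; exact: hk.
- by move=> c /hf [h1 h2]; split; [exact: leq_lfac h1 | exact: leq_rfac h2].
Qed.

Lemma letter_system : exists phi e, system (K := K) 1 2 set0 phi e.
Proof.
exists (fun i w => (w == [:: i])%:R), (fun i => [:: i]); split => //.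
- by move=> i w; case: (w =P [:: i]) => [->|_] //; rewrite eqxx.
- by move=> i j; rewrite eqseq_cons eqxx andbT eq_sym.
- case=> // _; split.
    exists unit; first by rewrite card_unit.
    exists (fun _ _ => 1), (fun i v _ => (v == [:: i])%:R) => i u v /size0nil ->.
    by rewrite big_const card_unit /= addr0 mul1r.
  exists 'I_2; first by rewrite card_ord.
  exists (fun i u t => (t == i)%:R), (fun t v => (v == [:: t])%:R) => i u v /size0nil ->.
  rewrite (bigD1 i) //= eqxx mul1r big1 ?addr0 // => j /negPf ->.
  by rewrite mul0r.
Qed.

Variables (xi : nat) (f : 'I_xi -> A) (d : 'I_xi -> nat).
Hypothesis f_homog : forall j, homogeneous (d j) (f j).
Hypothesis d_gt1 : forall j, (1 < d j)%N.
Variable r : nat -> nat.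
Hypothesis r_count : forall i, r i = #|[set j | (2 ^ i < d j <= 2 ^ i.+1)%N]%SET|.
Hypothesis d_gap : forall j n, ~~ in_gap n (d j).
Hypothesis r_sparse : sparse_counts r.

Definition relations_upto n : set A := [set p | exists j, (d j <= 2 ^ n)%N /\ p = f j].
Definition prod_counts n := (\prod_(i < n | r i != 0) r i)%N.

Lemma prod_counts_gt0 n : (0 < prod_counts n)%N.
Proof. by apply: prodn_cond_gt0 => i; rewrite lt0n. Qed.

Lemma prod_countsS n : prod_counts n.+1 = (prod_counts n * (if r n != 0 then r n else 1))%N.
Proof.
by rewrite /prod_counts (big_mkcond (fun i : 'I_n.+1 => _)) big_ord_recr -big_mkcond.
Qed.

Lemma sparseE n m : r n <> 0%N -> (m = 0%N \/ r m <> 0%N) -> (m < n)%N ->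
  (2 ^ (3 * n + 4) * prod_counts n ^ 32 < r n < 2 ^ (2 ^ (n - m - 3)))%N.
Proof.
move=> rn rm mn; have := r_sparse rn rm mn.
by rewrite /prod_counts (big_morph (expn^~ 32) (fun a b => expnMn a b 32) (exp1n 32)).
Qed.

(** With [m = 0] the two sparsity bounds give [3 * n + 4 < 2 ^ (n - 3)], which fails for [n] from 1
    to 7; [n = 0] is excluded by the gap at 0. *)
Lemma r_ge8 n : r n <> 0%N -> (8 <= n)%N.
Proof.
move=> rn; have n0 : n != 0%N.
  apply/eqP => n0; subst n; have : (0 < r 0)%N by lia.
  rewrite r_count => /card_gt0P[j]; rewrite inE => dj.
  by have := d_gap j 0; rewrite (_ : d j = 2%N) ?in_gap02 //; lia.
have := sparseE rn (or_introl erefl); rewrite lt0n n0 subn0 => /(_ isT) /andP[h1 h2].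
have h : (2 ^ (3 * n + 4) < 2 ^ (2 ^ (n - 3)))%N.
  apply: leq_ltn_trans (ltn_trans h1 h2); rewrite leq_pmulr // expn_gt0.
  by rewrite prod_counts_gt0.
rewrite ltn_exp2l // in h.
have [//|n8] := leqP 8 n.
by move: h n8; clear; do 8 (case: n => [|n] //).
Qed.

(* With U = 2^(n-2) the relations of this stage have degree in [6U, 7U], and
   the pieces have length [Q * M = 17U/4], so that both [2QM - k] and [k - QM]
   are at most [11U/4 = 11 * 2^(n-4)]. *)
Lemma stage n N D phi e j Q E : system N D (relations_upto n) phi e -> (0 < D)%N -> (0 < Q)%N ->
  r n <> 0%N -> let M := (j.+1 * N)%N in (Q * M = 17 * 2 ^ (n - 4))%N ->
  ((11 * 2 ^ (n - 4)) %/ M <= E)%N ->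
  (3 * (r n * (17 * 2 ^ (n - 4)) * (2 * D * (2 * D) * 2 ^ E)) + 1 < 2 ^ Q)%N ->
  exists phi' e', system (17 * 2 ^ (n - 3)) (2 * (2 ^ (Q.-1)./2 * (2 * D))) (relations_upto n.+1) phi' e'.
Proof.
move=> hsys D0 Q0 rn M QM hE count; have n8 := r_ge8 rn.
have [phi1 [e1 hsys1]] := thin_system j hsys D0.
pose idx (k : 'I_(r n)) := enum_val (cast_ord (r_count n) k).
have hidx k : (24 * 2 ^ (n - 4) <= d (idx k) <= 28 * 2 ^ (n - 4))%N.
  have := enum_valP (cast_ord (r_count n) k); rewrite inE => h.
  have n3 : (3 <= n)%N by apply: leq_trans n8.
  case: (gap_degree n3 h (d_gap (idx k))) => // n3'.
  by move: n8; rewrite n3'.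
have p0 : (0 < 2 ^ (n - 4))%N by rewrite expn_gt0.
have D20 : (0 < 2 * D)%N by lia.
have [||||phi2 [e2 h2]] := @next_system K (j.+1 * N)%N (2 * D)%N (relations_upto n) phi1 e1 Q (r n)
    (fun k => f (idx k)) (fun k => d (idx k)) E hsys1 D20 Q0 (fun k => @f_homog (idx k)).
- by move=> k; rewrite -/M QM; have := hidx k; lia.
- move=> k; rewrite -/M QM; apply: leq_trans hE; apply: leq_div2r.
  by have := hidx k; lia.
- move=> k; rewrite -/M QM; apply: leq_trans hE; apply: leq_div2r.
  by have := hidx k; lia.
- by rewrite -/M QM.
exists phi2, e2; rewrite (_ : (17 * 2 ^ (n - 3) = 2 * (Q * M))%N); last first.
  by rewrite QM (_ : (n - 3 = (n - 4).+1)%N) ?expnS; lia.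
apply: system_weaken h2 (leqnn _) _ => p [i [di ->]].
have [le|gt] := leqP (d i) (2 ^ n); first by left; exists i.
right; have hi : i \in [set i | (2 ^ n < d i <= 2 ^ n.+1)%N]%SET by rewrite inE gt.
exists (cast_ord (esym (r_count n)) (enum_rank_in hi i)) => //.
by rewrite /idx cast_ordKV enum_rankK_in.
Qed.

(* [4 * b = 2 ^ i] is the least power of two exceeding [log2 (r n)]. *)
Lemma r_scale n : r n <> 0%N -> exists i b, [/\ (5 <= i)%N, b = (2 ^ (i - 2))%N,
  (2 ^ (2 * b) <= r n < 2 ^ (4 * b))%N & forall B, (r n < 2 ^ (2 ^ B))%N -> (i <= B)%N].
Proof.
move=> rn; have n8 := r_ge8 rn.
have n0 : (0 < n)%N by lia.
have /andP[lo hi] := sparseE rn (or_introl erefl) n0.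
have hex : exists i, (r n < 2 ^ (2 ^ i))%N by exists (n - 0 - 3)%N.
case: (ex_minnP hex) => i hri imin.
have i5 : (5 <= i)%N.
  have h : (2 ^ (3 * n + 4) < 2 ^ (2 ^ i))%N.
    by apply: leq_ltn_trans (ltn_trans lo hri); rewrite leq_pmulr // expn_gt0 prod_counts_gt0.
  rewrite ltn_exp2l // in h; rewrite leqNgt; apply/negP => i4.
  have : (2 ^ i <= 2 ^ 4)%N by rewrite leq_exp2l.
  by move: h n8; clear; lia.
exists i, (2 ^ (i - 2))%N; split=> //.
have e1 : (2 * 2 ^ (i - 2) = 2 ^ i.-1)%N by rewrite -expnS; congr (2 ^ _)%N; lia.
have e2 : (4 * 2 ^ (i - 2) = 2 ^ i)%N.
  by rewrite (_ : 4 = 2 ^ 2)%N // -expnD; congr (2 ^ _)%N; lia.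
rewrite e1 e2 hri andbT leqNgt; apply/negP => /imin; lia.
Qed.

(** The exponent [17 * b] splits into [4 * b] for [r n], [11 * b] for the forms, and [2 * b], which
    absorbs [51 * 2 ^ n] because [3 * n + 4 < 4 * b] and [n >= 8]. *)
Lemma count_first n b : (8 <= n)%N -> (2 ^ (3 * n + 4) < r n)%N -> (r n < 2 ^ (4 * b))%N ->
  (3 * (r n * (17 * 2 ^ (n - 4)) * (2 * 2 * (2 * 2) * 2 ^ (11 * b))) + 1 < 2 ^ (17 * b))%N.
Proof.
move=> n8 lo hi; have h : (2 ^ (3 * n + 4) < 2 ^ (4 * b))%N by apply: ltn_trans hi.
rewrite ltn_exp2l // in h.
have h51 : (51 * (16 * 2 ^ (n - 4)) <= 2 ^ (2 * b))%N.
  have -> : (16 * 2 ^ (n - 4) = 2 ^ n)%N.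
    by rewrite (_ : 16 = 2 ^ 4)%N // -expnD; congr (2 ^ _)%N; lia.
  apply: (@leq_trans (2 ^ 6 * 2 ^ n)); first by rewrite leq_mul2r orbT.
  by rewrite -expnD leq_exp2l //; lia.
have -> : (2 ^ (17 * b) = 2 ^ (4 * b) * 2 ^ (2 * b) * 2 ^ (11 * b))%N.
  by rewrite -!expnD; congr (2 ^ _)%N; lia.
set X := (2 ^ (4 * b))%N in hi *; set Z := (2 ^ (2 * b))%N in h51 *.
set W := (2 ^ (11 * b))%N; set P := (2 ^ (n - 4))%N in h51 *.
have W0 : (0 < W)%N by rewrite expn_gt0.
have Z1 : (1 < Z)%N by rewrite (@ltn_exp2l 2 0) //; lia.
have X1 : (r n * (51 * (16 * P)) <= (X - 1) * Z)%N by apply: leq_mul => //; lia.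
have : (r n * (51 * (16 * P)) * W <= (X - 1) * Z * W)%N by rewrite leq_mul2r X1 orbT.
have : (1 < Z * W)%N by apply: leq_trans Z1 _; rewrite leq_pmulr.
have : (X * Z * W = (X - 1) * Z * W + Z * W)%N.
  by rewrite -!mulnA -{3}[(Z * W)%N]mul1n -mulnDl subnK //; lia.
have -> : (3 * (r n * (17 * P) * (2 * 2 * (2 * 2) * W)) = r n * (51 * (16 * P)) * W)%N by ring.
lia.
Qed.

(** After [4 * b] is spent on [r n], the rest is compared with [2 ^ (12 * b)] by cubing. The cube of
    [51 * 2 ^ n * p ^ 10] is at most [2 ^ (3 * n + 4) * p ^ 32], the surplus [2 ^ 4 * p ^ 2]
    covering [51 ^ 3]; this is how the constants of the sparsity condition enter. *)
Lemma count_next n b p E : (8 <= n)%N -> (2 ^ (3 * n + 4) * p ^ 32 < r n)%N -> (r n < 2 ^ (4 * b))%N ->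
  (2 ^ 7 <= p)%N -> (3 * E <= 32 * b)%N ->
  (3 * (r n * (17 * 2 ^ (n - 4)) * (2 * (2 * p ^ 5) * (2 * (2 * p ^ 5)) * 2 ^ E)) + 1 < 2 ^ (16 * b))%N.
Proof.
move=> n8 lo hi hp hE; have h : (2 ^ (3 * n + 4) * p ^ 32 < 2 ^ (4 * b))%N by apply: ltn_trans hi.
have b0 : (0 < b)%N.
  rewrite lt0n; apply/eqP => b0; move: h; rewrite b0 muln0 ltnS leqn0 muln_eq0 !expn_eq0 /=.
  by rewrite andbT => /eqP p0; move: hp; rewrite p0 leqn0 expn_eq0.
have hc : (51 * (2 ^ n * p ^ 10 * 2 ^ E) <= 2 ^ (12 * b))%N.
  have h51 : (51 ^ 3 <= 2 ^ 4 * p ^ 2)%N.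
    apply: (@leq_trans ((2 ^ 6) ^ 3)); first by rewrite leq_exp2r.
    have -> : ((2 ^ 6) ^ 3 = 2 ^ 4 * (2 ^ 7) ^ 2)%N by rewrite -!expnM -expnD.
    by rewrite leq_mul2l leq_exp2r.
  rewrite -(leq_exp2r _ _ (isT : 0 < 3)%N) 3!expnMn -!expnM.
  apply: (@leq_trans (2 ^ (4 * b) * 2 ^ (32 * b))); last by rewrite -expnD leq_exp2l //; lia.
  rewrite mulnA; apply: leq_mul; last by rewrite leq_exp2l //; lia.
  apply: leq_trans (ltnW h).
  have -> : (2 ^ (3 * n + 4) * p ^ 32 = 2 ^ 4 * p ^ 2 * (2 ^ (n * 3) * p ^ (10 * 3)))%N.
    by rewrite mulnACA -!expnD; congr (2 ^ _ * _)%N; lia.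
  by rewrite leq_mul2r h51 orbT.
have e1 : (16 * 2 ^ (n - 4) = 2 ^ n)%N.
  by rewrite (_ : 16 = 2 ^ 4)%N // -expnD; congr (2 ^ _)%N; lia.
have e2 : (2 * p ^ 5 * (2 * p ^ 5) = 4 * p ^ 10)%N by rewrite mulnACA -expnD.
have -> : (3 * (r n * (17 * 2 ^ (n - 4)) * (2 * (2 * p ^ 5) * (2 * (2 * p ^ 5)) * 2 ^ E)) =
   r n * (51 * (2 ^ n * p ^ 10 * 2 ^ E)))%N.
  rewrite -e1 [(2 * (2 * p ^ 5) * _)%N]mulnACA e2; ring.
have -> : (2 ^ (16 * b) = 2 ^ (4 * b) * 2 ^ (12 * b))%N.
  by rewrite -expnD; congr (2 ^ _)%N; lia.
set X := (2 ^ (4 * b))%N in hi *; set Z := (2 ^ (12 * b))%N in hc *.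
have Z1 : (1 < Z)%N by rewrite (@ltn_exp2l 2 0) //; lia.
have : (r n * (51 * (2 ^ n * p ^ 10 * 2 ^ E)) <= (X - 1) * Z)%N by apply: leq_mul => //; lia.
have : (X * Z = (X - 1) * Z + Z)%N by rewrite -{3}[Z]mul1n -mulnDl subnK //; lia.
lia.
Qed.

(** The origin of the exponent 5: the left side has exponent [2 + (Q.-1)./2], at most [10 * b] when
    [Q <= 17 * b], with equality possible at [b = 1]. *)
Lemma half_bound b R Q : (2 ^ (2 * b) <= R)%N -> (0 < b)%N -> (Q <= 17 * b)%N ->
  (2 * (2 * 2 ^ (Q.-1)./2) <= R ^ 5)%N.
Proof.
move=> hR b0 hQ; apply: (@leq_trans ((2 ^ (2 * b)) ^ 5)); last by rewrite leq_exp2r.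
rewrite -!expnS -expnM leq_exp2l //.
by have := odd_double_half Q.-1; lia.
Qed.

(** The last exponent [m] in the support of [r] is remembered because it determines the block length
    and is the one at which the upper bound on [r n] is applied. *)
Lemma iterate n : exists N phi e, system N (2 * prod_counts n ^ 5) (relations_upto n) phi e /\ (N = 1%N /\ (forall i, (i < n)%N -> r i = 0%N) \/
   exists m, [/\ (m < n)%N, r m <> 0%N, (forall i, (m < i < n)%N -> r i = 0%N) & N = (17 * 2 ^ (m - 3))%N]).
Proof.
elim: n => [|n [N [phi [e [hsys hN]]]]].
  have [phi [e h]] := letter_system; exists 1%N, phi, e; split; last by left.
  apply: system_weaken h _ _; first by rewrite /prod_counts big_ord0 exp1n.
  by move=> p [j [dj _]]; have := d_gt1 j; lia.
have [rn0|/eqP rn] := eqVneq (r n) 0%N.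
  exists N, phi, e; split.
    apply: system_weaken hsys _ _; first by rewrite prod_countsS rn0 muln1.
    move=> p [j [dj ->]]; exists j; split=> //; rewrite leqNgt; apply/negP => dj'.
    have : (0 < r n)%N by rewrite r_count; apply/card_gt0P; exists j; rewrite inE dj'.
    by rewrite rn0.
  case: hN => [[-> h]|[m [mn rm h ->]]].
    by left; split=> // i; rewrite ltnS leq_eqVlt => /orP[/eqP->|] //; exact: h.
  right; exists m; split=> //; first exact: ltnW.
  move=> i /andP[mi]; rewrite ltnS leq_eqVlt => /orP[/eqP->|lin] //.
  by apply: h; rewrite mi.
have n8 := r_ge8 rn.
have [i [b [i5 bE /andP[rlo rhi] imin]]] := r_scale rn.
have b0 : (0 < b)%N by rewrite bE expn_gt0.
have D0 : (0 < 2 * prod_counts n ^ 5)%N by rewrite muln_gt0 expn_gt0 prod_counts_gt0.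
suff [j [Q [E [QM hE Q0 hQ count]]]] : exists j Q E, let M := (j.+1 * N)%N in
    [/\ (Q * M = 17 * 2 ^ (n - 4))%N, ((11 * 2 ^ (n - 4)) %/ M <= E)%N, (0 < Q)%N, (Q <= 17 * b)%N &
    (3 * (r n * (17 * 2 ^ (n - 4)) * (2 * (2 * prod_counts n ^ 5) * (2 * (2 * prod_counts n ^ 5)) * 2 ^ E)) + 1 < 2 ^ Q)%N].
  have [phi' [e' h']] := stage hsys D0 Q0 rn QM hE count.
  exists (17 * 2 ^ (n - 3))%N, phi', e'; split.
    apply: system_weaken h' _ (@subset_refl _ _).
    rewrite prod_countsS (introN eqP rn) expnMn.
    have := half_bound rlo b0 hQ; move: (prod_counts n ^ 5)%N (r n ^ 5)%N (2 ^ _)%N => x y z hz.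
    have -> : (2 * (z * (2 * (2 * x))) = 2 * (2 * (2 * z) * x))%N by ring.
    by rewrite leq_mul2l mulnC leq_mul2l hz !orbT.
  by right; exists n; split=> // k /andP[nk]; rewrite ltnS leqNgt nk.
have n0 : (0 < n)%N by apply: leq_trans n8.
case: hN => [[-> h]|[m [mn rm h ->]]].
  have /andP[lo hi] := sparseE rn (or_introl erefl) n0.
  have ile : (i <= n - 3)%N by have := imin _ hi; rewrite subn0.
  have p1 : prod_counts n = 1%N.
    by rewrite /prod_counts big1 // => k; rewrite h.
  (* The blocks are single letters here. Since [b = 2 ^ (i - 2)], padding them to length
     [2 ^ (n - 2 - i)] makes [17 * b] of them fill [17 * 2 ^ (n - 4)] letters. *)
  exists (2 ^ (n - 2 - i)).-1, (17 * b)%N, (11 * b)%N.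
  rewrite /= prednK ?expn_gt0 // muln1.
  have bM : (b * 2 ^ (n - 2 - i) = 2 ^ (n - 4))%N.
    by rewrite bE; apply: exp2D; exact: first_exponents.
  split; [by rewrite -mulnA bM | | by rewrite muln_gt0 b0 | exact: leqnn |].
    by rewrite -bM mulnA mulnK ?expn_gt0 // leqnn.
  rewrite p1 exp1n !muln1; apply: count_first => //.
  by move: lo; rewrite p1 exp1n muln1.
have /andP[lo _] := sparseE rn (or_introl erefl) n0.
have /andP[_ hi] := sparseE rn (or_intror rm) mn.
have m8 := r_ge8 rm.
have ile := imin _ hi.
have p7 : (2 ^ 7 <= prod_counts n)%N.
  have /andP[lom _] := sparseE rm (or_introl erefl) (ltn_trans (isT : 0 < 7)%N m8).
  apply: (@leq_trans (r m)).
    apply: leq_trans (ltnW lom).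
    apply: (@leq_trans (2 ^ (3 * m + 4))); first by rewrite leq_exp2l //; move: m8; clear; lia.
    by rewrite leq_pmulr // expn_gt0 prod_counts_gt0.
  rewrite /prod_counts (bigD1 (Ordinal mn)) /=; last exact/eqP.
  by rewrite leq_pmulr // prodn_cond_gt0 // => k /andP[hk _]; rewrite lt0n.
have [E [E1 E2]] := ratio_bound b.
(* The old length already contains the factor 17, so the number of blocks is now a power of two. The
   upper bound on [r n] gives [i <= n - m - 3], so the subtraction in the padding exponent is not
   truncated. *)
exists (2 ^ (n - m - 3 - i)).-1, (16 * b)%N, E.
rewrite /= prednK ?expn_gt0 //.
have [x1 x2 x3 x4] := next_exponents m8 mn i5 ile.
have [X XE] : exists X, X = (2 ^ (n - 6 - i))%N by eexists.
have X0 : (0 < X)%N by rewrite XE expn_gt0.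
have ME : (2 ^ (n - m - 3 - i) * (17 * 2 ^ (m - 3)) = 17 * X)%N.
  by rewrite mulnCA XE (exp2D x1).
have bX : (16 * (b * X) = 2 ^ (n - 4))%N.
  have hb : (b * X = 2 ^ (n - 8))%N by rewrite bE XE; apply: exp2D.
  exact: etrans (congr1 (muln 16) hb) (exp2_16 x4 x3).
rewrite ME; split; [by rewrite -mulnA [(b * _)%N]mulnCA mulnCA bX | | by rewrite muln_gt0 b0 | by rewrite leq_mul2r orbT |].
  have -> : (11 * 2 ^ (n - 4) = 176 * b * X)%N by rewrite -bX; ring.
  by rewrite divnMr.
exact: count_next.
Qed.

Lemma final_system : exists N D phi e, system N D (range f) phi e.
Proof.
pose n := (\max_j d j)%N.
have [N [phi [e [h _]]]] := iterate n.
exists N, (2 * prod_counts n ^ 5)%N, phi, e; apply: system_weaken h (leqnn _) _ => _ [j _ <-].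
exists j; split=> //; apply: leq_trans (ltnW (ltn_expl n (isT : 1 < 2)%N)).
exact: leq_bigmax.
Qed.
End Iterate.

(** * The free subalgebra *)

Section Annihilator.
Variable K : fieldType.
Local Notation word := (seq 'I_2).
Local Notation A := (freealg K 2).
Implicit Types (p q : A) (L : word -> K).

Lemma pairing_monl L x p : pairing L (mon K x * p) = pairing (fun w => L (x ++ w)) p.
Proof.
rewrite {1}(monE p) mulr_sumr linear_sum; apply: eq_bigr => w _.
by rewrite -scalerAr linearZ -mon_cat /= pairing_mon.
Qed.

Lemma pairing_monr L x p : pairing L (p * mon K x) = pairing (fun w => L (w ++ x)) p.
Proof.
rewrite {1}(monE p) mulr_suml linear_sum; apply: eq_bigr => w _.
by rewrite -scalerAl linearZ -mon_cat /= pairing_mon.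
Qed.

Lemma pairingM L p q : pairing L (p * q) = pairing (fun w => pairing (fun w' => L (w ++ w')) q) p.
Proof.
rewrite {1}(monE p) mulr_suml linear_sum; apply: eq_bigr => w _.
by rewrite -scalerAl linearZ /= pairing_monl.
Qed.

Lemma pairing0 L : pairing L 0 = 0.
Proof. exact: linear0. Qed.

(** The largest two-sided ideal contained in the kernels of all functionals in [F]. *)
Definition annih (F : set (word -> K)) : set A := [set p | forall L, F L -> kills L p].

Lemma annih_ideal F : is_ideal (annih F).
Proof.
have S : is_subspace (annih F).
  split=> [L _ u v|k p q hp hq L FL u v]; first exact: pairing0.
  by rewrite linearP /= hp // hq // mulr0 addr0.
split; split=> // p q h L FL u v.
- rewrite pairingM /pairing big1 // => w _.
  have := h L FL (u ++ w) v; rewrite /pairing => hw.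
  rewrite (_ : \sum_(w' <- _) _ = 0) ?mulr0 // -[RHS]hw.
  by apply: eq_bigr => w' _; rewrite !catA.
- rewrite (monE q) mulr_sumr linear_sum big1 // => w _.
  rewrite -scalerAr linearZ /= pairing_monr (_ : pairing _ p = 0) ?mulr0 //.
  rewrite -[RHS](h L FL u (w ++ v)); apply: eq_bigr => w' _.
  by rewrite -!catA.
Qed.

Lemma annih_gen F (X : set A) : X `<=` annih F -> ideal_gen X `<=` annih F.
Proof. by move=> XF p; apply => //; exact: annih_ideal. Qed.

Lemma homog_subspace n k : is_subspace (@homogeneous K n k).
Proof.
split=> [w|a p q hp hq w]; first by rewrite mcoeff0 eqxx.
rewrite mcoeffD mcoeffZ; apply: contraNeq => sw.
have /eqP -> : p@_w == 0 by apply: contraNT sw => /hp ->.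
have /eqP -> : q@_w == 0 by apply: contraNT sw => /hq ->.
by rewrite mulr0 addr0.
Qed.
End Annihilator.

Lemma subspace_sum (K : fieldType) (B : algType K) (S : set B) (I : Type) (r : seq I) (P : pred I) (F : I -> B) :
  is_subspace S -> (forall i, P i -> S (F i)) -> S (\sum_(i <- r | P i) F i).
Proof.
case=> S0 SD h; elim/big_rec: _ => // i x Pi Sx.
by rewrite -[F i]scale1r; apply: SD => //; exact: h.
Qed.

Lemma subspaceZ (K : fieldType) (B : algType K) (S : set B) (k : K) b : is_subspace S -> S b -> S (k *: b).
Proof. by case=> S0 SD h; rewrite -[_ *: _]addr0; apply: SD. Qed.

Lemma graded_split (V : nmodType) (I : eqType) (r : seq I) (h : I -> nat) (t : I -> V) M :
  (forall i, i \in r -> (h i < M)%N) ->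
  \sum_(i <- r) t i = \sum_(n < M) \sum_(i <- r | h i == n) t i.
Proof.
move=> hM; under [RHS]eq_bigr do rewrite big_mkcond.
rewrite exchange_big /= big_seq [RHS]big_seq; apply: eq_bigr => i ir.
rewrite (bigD1 (Ordinal (hM i ir))) //= eqxx big1 ?addr0 // => n hn.
by case: eqP => // E; case/eqP: hn; apply: val_inj.
Qed.

Section FreeGenerators.
Variables (K : fieldType) (N D : nat) (T : set (freealg K 2)).
Variables (phi : 'I_2 -> seq 'I_2 -> K) (e : 'I_2 -> seq 'I_2).
Hypothesis hsys : system N D T phi e.
Variables (R : algType K) (pi : {lrmorphism freealg K 2 -> R}) (b : 'I_2 -> R).
Hypothesis hb : forall i, b i = pi (mon K (e i)).
Hypothesis hker : forall p, pi p = 0 -> annih (range (blocks N phi)) p.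
Local Notation E w := (flatten (map e w)).

Lemma size_E w : size (E w) = (size w * N)%N.
Proof. by elim: w => //= i w IH; rewrite size_cat (sys_size hsys) IH. Qed.

Lemma prod_b w : \prod_(i <- w) b i = pi (mon K (E w)).
Proof.
elim: w => [|i w IH]; first by rewrite big_nil mon_nil rmorph1.
by rewrite big_cons IH hb /= mon_cat rmorphM.
Qed.

Lemma fa_eval_sum (I : Type) (r : seq I) (P : pred I) (k : I -> K) (F : I -> seq 'I_2) :
  fa_eval b (\sum_(i <- r | P i) k i *: mon K (F i)) = \sum_(i <- r | P i) k i *: pi (mon K (E (F i))).
Proof.
rewrite -[LHS]/(lin_ext (fun w => \prod_(i <- w) b i) _) linear_sum.
by apply: eq_bigr => i _; rewrite linearZ /= lin_ext_mon prod_b.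
Qed.

Definition subst_e (p : freealg K 2) := \sum_(w <- msupp p) p@_w *: mon K (E w).

Lemma fa_eval_pi p : fa_eval b p = pi (subst_e p).
Proof. by rewrite {1}(monE p) fa_eval_sum linear_sum; apply: eq_bigr => w _; rewrite linearZ. Qed.

(** Duality of [phi] and [e] handles words of equal length, and the supports handle the others. So
    coefficients are recovered by functionals that vanish on the kernel of [pi], which is the reason
    for freeness. *)
Lemma pairing_subst p s : pairing (blocks N phi s) (subst_e p) = p@_(FMonom s).
Proof.
rewrite linear_sum /=; transitivity (pairing (fun w => (w == s)%:R) p).
  apply: eq_bigr => w _; rewrite linearZ /= pairing_mon; congr (_ * _).
  have [sw|sw] := eqVneq (size s) (size w).
    by rewrite (blocks_dual (sys_dual hsys) (sys_size hsys)) // eq_sym.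
  rewrite (_ : (w : seq _) == s = false); last by apply: contraNF sw => /eqP ->.
  apply/eqP; apply: contraNT sw => /(blocks_supp (sys_supp hsys)) /eqP.
  by rewrite size_E eqn_pmul2r ?(sys_pos hsys) // eq_sym.
rewrite [in LHS](monE p) linear_sum /= [in RHS](monE p) raddf_sum /=; apply: eq_bigr => w _.
by rewrite linearZ /= pairing_mon mcoeffZ mcoeff_mon.
Qed.

Lemma system_free : free_generators b.
Proof.
move=> p q; rewrite !fa_eval_pi => h.
have hz : pi (subst_e p - subst_e q) = 0 by apply/eqP; rewrite raddfB subr_eq0; apply/eqP.
apply/malgP => -[s]; rewrite -!pairing_subst; apply/eqP; rewrite -subr_eq0.
have := hker hz (imageT (blocks N phi) s) [::] [::].
under eq_fun do rewrite cats0.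
by rewrite linearB /= => ->.
Qed.

Lemma system_graded : graded_subset (fun n => pi @` homogeneous n) (subalg_gen b).
Proof.
move=> a [p ->]; pose t (w : {fmonom 'I_2}) := p@_w *: pi (mon K (E w)).
pose M := (\sum_(w <- msupp p) (size w * N).+1)%N.
exists M, (fun n => \sum_(w <- msupp p | (size w * N == n)%N) t w); split.
  move=> n; split.
    exists (\sum_(w <- msupp p | (size w * N == n)%N) p@_w *: mon K (E w)).
      apply: (subspace_sum (S := homogeneous n)) => [|w /eqP <-]; first exact: homog_subspace.
      apply: (subspaceZ (S := homogeneous _)); first exact: homog_subspace.
      by rewrite -size_E; exact: mon_homog.
    by rewrite linear_sum; apply: eq_bigr => w _; rewrite linearZ.
  by exists (\sum_(w <- msupp p | (size w * N == n)%N) p@_w *: mon K w); rewrite fa_eval_sum.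
rewrite {1}(monE p) fa_eval_sum -(graded_split (h := fun w : {fmonom _} => (size w * N)%N)) // => w hw.
by rewrite /M (big_rem w) //= leq_addr.
Qed.
End FreeGenerators.

(** * The Jacobson radical *)

Section Radical.
Variables (K : fieldType) (B : algType K) (S : set B) (e : B).
Hypotheses (S_sub : is_subspace S) (S_mul : forall a b, S a -> S b -> S (a * b)) (Se : S e).
Hypothesis e_notin : forall s, S s -> e <> s - s * e.

(* A maximal left ideal containing all [s - s * e] but not [e] is modular. *)
Lemma not_radical : ~ is_jacobson_radical S.
Proof.
have SB a b : S a -> S b -> S (a - b).
  by move=> Sa Sb; rewrite addrC -scaleN1r; apply: S_sub.2.
pose P (L : set B) := [/\ is_left_ideal_in S L, forall s, S s -> L (s - s * e) & ~ L e].
pose P' (L : set B) := L = set0 \/ P L.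
have [|L [PL Lmax]] := @Zorn_bigcup B P'.
  move=> F FP Ftot.
  have [[X FX [x Xx]]|none] := pselect (exists2 X, F X & exists x, X x); last first.
    left; apply/seteqP; split=> // x [X FX Xx].
    by case: none; exists X => //; exists x.
  have PX Y y : F Y -> Y y -> P Y.
    by move=> FY Yy; case: (FP _ FY) => // Y0; move: Yy; rewrite Y0.
  right; split.
  - split; [split|..].
    + by exists X => //; have [[[X0 _] _ _] _ _] := PX _ _ FX Xx.
    + move=> k a b [Y FY Ya] [Z FZ Zb].
      case: (Ftot _ _ FY FZ) => YZ.
        exists Z => //; have [[[_ h] _ _] _ _] := PX _ _ FZ Zb.
        by apply: h => //; exact: YZ.
      exists Y => //; have [[[_ h] _ _] _ _] := PX _ _ FY Ya.
      by apply: h => //; exact: YZ.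
    + by move=> a [Y FY Ya]; have [[_ h _] _ _] := PX _ _ FY Ya; exact: h.
    + move=> s a Ss [Y FY Ya]; exists Y => //.
      by have [[_ _ h] _ _] := PX _ _ FY Ya; exact: h.
  - by move=> s Ss; exists X => //; have [_ h _] := PX _ _ FX Xx; exact: h.
  - by case=> Y FY Ye; have [_ _ []] := PX _ _ FY Ye.
pose L0 := [set x | exists2 s, S s & x = s - s * e].
have PL0 : P L0.
  split.
  - split; [split|..].
    + by exists 0; rewrite ?mul0r ?subr0 //; exact: S_sub.1.
    + move=> k _ _ [s Ss ->] [t St ->]; exists (k *: s + t); first exact: S_sub.2.
      by rewrite mulrDl scalerBr -scalerAl opprD addrACA.
    + by move=> _ [s Ss ->]; apply: SB => //; exact: S_mul.
    + by move=> s _ Ss [t St ->]; exists (s * t); rewrite ?mulrBr ?mulrA //; exact: S_mul.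
  - by move=> s Ss; exists s.
  - by case=> s Ss; exact: e_notin.
have {}PL : P L.
  case: PL => // L_0; exfalso; apply: (Lmax L0); last by right.
  rewrite L_0; split=> [x []|h].
  have [[[z _] _ _] _ _] := PL0; exact: (h _ z).
have [Lid Lmod Le] := PL.
have mm : max_modular_left_ideal_in S L.
  split=> //; first by exists e.
    by move=> LS; apply: Le; rewrite LS.
  (* If [L'] contains [e], it contains every [s = (s - s * e) + s * e]; otherwise maximality of [L]
     applies. *)
  move=> L' L'id LL'; have [L'e|L'e] := pselect (L' e).
    right; apply/seteqP; split=> s; first by have [_ h _] := L'id; exact: h.
    move=> Ss; have [[_ h1] _ h2] := L'id.
    rewrite -[s](subrK (s * e)) -[s - s * e]scale1r; apply: h1; last exact: h2.
    exact/LL'/Lmod.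
  left; have [//|nLL] := pselect (L' = L); exfalso.
  apply: (Lmax L'); last by right; split=> // s Ss; exact/LL'/Lmod.
  by split=> // h; apply: nLL; apply/seteqP.
move=> h; move: Se; rewrite -h => -[_ /(_ _ mm)].
exact: Le.
Qed.
End Radical.

Section Periodic.
Variables (K : fieldType) (N : nat) (phi0 : seq 'I_2 -> K) (e0 : seq 'I_2).
Hypotheses (N0 : (0 < N)%N) (supp0 : supported N phi0) (phi_e0 : phi0 e0 = 1).
Local Notation A := (freealg K 2).

Definition Phi k := tprod N (nseq k phi0).

Lemma size_e0 : size e0 = N.
Proof. by apply: supp0; rewrite phi_e0 oner_eq0. Qed.

Lemma Phi_allsupp k : allsupp N (nseq k phi0).
Proof. by move=> i; rewrite size_nseq nth_nseq => ->. Qed.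

Lemma Phi_supp k : supported (k * N) (Phi k).
Proof. by have := tprod_supp (@Phi_allsupp k); rewrite size_nseq. Qed.

Lemma Phi_eq0 k w : size w <> (k * N)%N -> Phi k w = 0.
Proof. by move=> h; apply/eqP; apply/negP => /negP /Phi_supp. Qed.

Lemma PhiD k m u v : size u = (k * N)%N -> Phi (k + m) (u ++ v) = Phi k u * Phi m v.
Proof. by move=> su; rewrite /Phi nseqD tprod_cat // size_nseq. Qed.

Lemma PhiDr k m u v : size v = (m * N)%N -> Phi (k + m) (u ++ v) = Phi k u * Phi m v.
Proof.
move=> sv; have [su|su] := eqVneq (size u) (k * N)%N; first exact: PhiD.
rewrite [Phi k u]Phi_eq0 ?mul0r; last exact/eqP.
rewrite Phi_eq0 //.
by rewrite size_cat sv mulnDl => /eqP; rewrite eqn_add2r (negPf su).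
Qed.

Lemma Phi0 w : Phi 0 w = (w == [::])%:R.
Proof. by []. Qed.

Lemma Phi1 w : Phi 1 w = phi0 w.
Proof. exact: tprod1. Qed.

Lemma Phi_cat_e0 k u : Phi k.+1 (u ++ e0) = Phi k u.
Proof. by rewrite -addn1 PhiDr ?Phi1 ?phi_e0 ?mulr1 // mul1n size_e0. Qed.

Variables (R : algType K) (pi : {lrmorphism A -> R}).
Hypothesis pi_surj : forall a, exists p, pi p = a.
Hypothesis pi_ker : forall p, pi p = 0 -> annih (range Phi) p.
Let Rn n := pi @` homogeneous n.

Lemma positive_partE : positive_part Rn = pi @` [set p | const_coef p = 0].
Proof.
pose Z : set A := [set p | const_coef p = 0].
have Zsub : is_subspace Z.
  split=> [|k p q hp hq]; first exact: mcoeff0.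
  by rewrite /Z /= /const_coef mcoeffD mcoeffZ -/(const_coef p) -/(const_coef q) hp hq mulr0 addr0.
apply/seteqP; split=> [a [M [c [hc ->]]]|_ [p hp <-]].
  have /choice[q hq] n : exists q, homogeneous n q /\ pi q = c n.
    by have [q ? ?] := hc n; exists q.
  exists (\sum_(n < M) q n.+1).
    apply: (subspace_sum (S := Z)) => // n _; apply/eqP; apply/negP => /negP /(hq n.+1).1.
    by rewrite fm1.
  by rewrite raddf_sum; apply: eq_bigr => n _ /=; rewrite (hq n.+1).2.
pose t (w : {fmonom 'I_2}) := p@_w *: mon K w.
pose M := (\sum_(w <- msupp p) (size w).+1)%N.
exists M, (fun n => pi (\sum_(w <- msupp p | size w == n) t w)); split.
  move=> n; exists (\sum_(w <- msupp p | size w == n) t w) => //.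
  apply: (subspace_sum (S := homogeneous n)) => [|w /eqP <-]; first exact: homog_subspace.
  apply: (subspaceZ (S := homogeneous _)); first exact: homog_subspace.
  exact: mon_homog.
rewrite {1}(monE p) (@graded_split _ _ _ (fun w : {fmonom _} => size w) _ M.+1); last first.
  by move=> w hw; rewrite ltnS /M (big_rem w) //= ltnW // leq_addr.
rewrite big_ord_recl big1 ?add0r; first by rewrite linear_sum.
move=> w /eqP/size0nil w0; rewrite (_ : p@_w = 0) ?scale0r //.
rewrite -[RHS]hp /const_coef; congr (_@__).
by apply/eqP; rewrite fmP fm1 w0.
Qed.

(** Pairing with [Phi k] turns the equation into a recursion: [x 0 = 0], [x 1 = 1], and
    [x k.+1 = x k] afterwards. So [p] would have to behave like the infinite series of the powers of
    [e0], while its words have bounded length. *)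
Lemma quasi_regular_free p : pi (mon K e0) <> pi p - pi p * pi (mon K e0).
Proof.
move=> E; pose x k := pairing (Phi k) p.
have hx k : pairing (Phi k) (mon K e0) = x k - pairing (fun w => Phi k (w ++ e0)) p.
  pose q : A := p - p * mon K e0.
  have hz : pi (mon K e0 - q) = 0.
    rewrite 2!raddfB /= rmorphM /=.
    by apply/eqP; rewrite subr_eq0; apply/eqP.
  have := pi_ker hz (imageT Phi k) [::] [::].
  under eq_fun do rewrite cats0.
  by rewrite 2!raddfB /= pairing_monr => /eqP; rewrite subr_eq0 => /eqP.
have x0 : x 0%N = 0.
  have := hx 0%N; rewrite pairing_mon Phi_eq0 ?size_e0; last lia.
  rewrite (_ : pairing _ p = 0) ?subr0 => [<- //|].
  rewrite /pairing big1 // => w _; rewrite Phi_eq0 ?mulr0 // size_cat size_e0; lia.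
have xS k : x k.+1 = 1.
  elim: k => [|k IH].
    have := hx 1%N; rewrite pairing_mon Phi1 phi_e0.
    under [in X in _ - X]eq_fun do rewrite Phi_cat_e0.
    by rewrite -/(x 0%N) x0 subr0.
  have := hx k.+2; rewrite pairing_mon Phi_eq0 ?size_e0; last nia.
  under [in X in _ - X]eq_fun do rewrite Phi_cat_e0.
  by rewrite -/(x k.+1) IH => /esym/eqP; rewrite subr_eq0 => /eqP.
pose M := (\sum_(w <- msupp p) (size w).+1)%N.
have := xS M; rewrite /x /pairing big_seq big1 => [/esym/eqP|w hw]; first by rewrite oner_eq0.
rewrite Phi_eq0 ?mulr0 //.
have : (size w < M.+1 * N)%N.
  apply: (@leq_trans (M.+1)); last by rewrite leq_pmulr.
  by rewrite ltnS /M (big_rem w) //= ltnW // leq_addr.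
by move=> h1 h2; move: h1; rewrite h2 ltnn.
Qed.

Lemma positive_part_not_radical : ~ is_jacobson_radical (positive_part Rn).
Proof.
rewrite positive_partE; apply: (@not_radical _ _ _ (pi (mon K e0))).
- split; first by exists 0; [exact: mcoeff0 | exact: raddf0].
  move=> k _ _ [p hp <-] [q hq <-]; exists (k *: p + q); last by rewrite linearP.
  by rewrite /= /const_coef mcoeffD mcoeffZ -/(const_coef p) -/(const_coef q) hp hq mulr0 addr0.
- move=> _ _ [p hp <-] [q hq <-]; exists (p * q); last by rewrite rmorphM.
  by rewrite /= const_coefM hp mul0r.
- exists (mon K e0) => //=; apply/eqP; apply/negP => /negP /mon_homog.
  by rewrite fm1 size_e0 => h; move: N0; rewrite -h.
- by move=> _ [p _ <-]; exact: quasi_regular_free.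
Qed.
End Periodic.

Lemma unital_not_radical (K : fieldType) (B : algType K) : ~ is_jacobson_radical [set: B].
Proof.
apply: (@not_radical _ _ _ 1) => // s _; rewrite mulr1 subrr => /eqP.
by rewrite oner_eq0.
Qed.

(** * Finitely generated modules over K[X] *)

Section PolySubmodules.
Variable K : fieldType.
Implicit Types m : nat.

Definition poly_submod m (M : set ('I_m -> {poly K})) :=
  M (fun=> 0) /\ forall p u v, M u -> M v -> M (fun i => p * u i + v i).

Lemma nonincreasing_stationary (s : nat -> nat) : (forall n, s n.+1 <= s n)%N ->
  exists N, forall n, (N <= n)%N -> s n = s N.
Proof.
move=> hs.
have hle n k : (s (n + k) <= s n)%N.
  elim: k => [|k IH]; first by rewrite addn0.
  by rewrite addnS; apply: leq_trans (hs _) IH.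
have : exists v, `[< exists n, s n = v >] by exists (s 0%N); apply/asboolP; exists 0%N.
case/ex_minnP => v /asboolP[N sN] vmin; exists N => n Nn.
apply/eqP; rewrite eqn_leq; apply/andP; split; first by rewrite -(subnKC Nn).
by rewrite sN; apply: vmin; apply/asboolP; exists n.
Qed.

Lemma ascending_le (T : Type) (M : nat -> set T) : (forall n, M n `<=` M n.+1) ->
  forall n k, (n <= k)%N -> M n `<=` M k.
Proof.
move=> h n k /subnKC <-; elim: (k - n)%N => [|j IH]; first by rewrite addn0.
by rewrite addnS => x /IH; exact: h.
Qed.

(** Once the least size of a nonzero element is stationary, an element of least size divides all
    elements of the later ideals, by Euclidean division. *)
Lemma poly_ideal_acc (I : nat -> set {poly K}) :
  (forall n, I n 0 /\ forall p u v, I n u -> I n v -> I n (p * u + v)) ->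
  (forall n, I n `<=` I n.+1) -> exists N, forall n, (N <= n)%N -> I n = I N.
Proof.
move=> hI asc; have mono := ascending_le asc.
have [[n0 [p0 Ip0 p0n0]]|allz] := pselect (exists n, exists2 p, I n p & p != 0); last first.
  exists 0%N => n _; apply/seteqP; split=> p Ip.
    have -> : p = 0 by apply/eqP; apply/negP => /negP hp; apply: allz; exists n, p.
    exact: (hI _).1.
  have -> : p = 0 by apply/eqP; apply/negP => /negP hp; apply: allz; exists 0%N, p.
  exact: (hI _).1.
have ex n : exists v, `[< exists2 p, I (n0 + n)%N p & p != 0 /\ size p = v >].
  exists (size p0); apply/asboolP; exists p0 => //; apply: (mono n0) => //.
  exact: leq_addr.
pose s n := ex_minn (ex n).
have hs n : exists2 p, I (n0 + n)%N p & p != 0 /\ size p = s n.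
  by rewrite /s; case: ex_minnP => v /asboolP.
have smin n p : I (n0 + n)%N p -> p != 0 -> (s n <= size p)%N.
  by rewrite /s => Ip p0'; case: ex_minnP => v _; apply; apply/asboolP; exists p.
have [|N sN] := @nonincreasing_stationary s.
  move=> n; have [p Ip [pn0 <-]] := hs n; apply: smin => //.
  by rewrite addnS; exact: asc.
exists (n0 + N)%N => n hn; apply/seteqP; split=> p; last exact: mono.
move=> Ip; have [g Ig [gn0 sg]] := hs N.
have nn : n = (n0 + (n - n0))%N by lia.
have Ign : I n g by apply: (mono _ _ hn).
rewrite (divp_eq p g); apply: (hI _).2 => //.
have Imod : I n (p %% g).
  have -> : p %% g = - (p %/ g) * g + p by rewrite {3}(divp_eq p g) mulNr addKr.
  exact: (hI n).2.
have -> : p %% g = 0.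
  apply/eqP; apply/negP => /negP h0.
  have := smin (n - n0)%N _ _ h0; rewrite -nn => /(_ Imod).
  rewrite sN; last by lia.
  by rewrite -sg leqNgt ltn_modp gn0.
exact: (hI _).1.
Qed.

(** Induction on the rank: the ideal of first coordinates and the submodule of vectors with first
    coordinate 0 both become stationary, and together they determine the module in an ascending
    chain. *)
Lemma poly_submod_acc m (M : nat -> set ('I_m -> {poly K})) :
  (forall n, poly_submod (M n)) -> (forall n, M n `<=` M n.+1) ->
  exists N, forall n, (N <= n)%N -> M n = M N.
Proof.
elim: m M => [|m IH] M hM asc.
  exists 0%N => n _; have E (u : 'I_0 -> {poly K}) : u = fun=> 0.
    by apply/funext => -[].
  by apply/seteqP; split=> u _; rewrite (E u); exact: (hM _).1.
have mono := ascending_le asc.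
pose ext (u : 'I_m -> {poly K}) : 'I_m.+1 -> {poly K} :=
  fun i => if unlift ord0 i is Some j then u j else 0.
pose M' n : set ('I_m -> {poly K}) := [set u | M n (ext u)].
pose I n : set {poly K} := [set p | exists2 u, M n u & u ord0 = p].
have [N1 h1] : exists N, forall n, (N <= n)%N -> M' n = M' N.
  apply: IH => [n|n u]; last exact: asc.
  split.
    rewrite /M' /= (_ : ext _ = fun=> 0); first exact: (hM n).1.
    by apply/funext => i; rewrite /ext; case: unlift.
  move=> p u v hu hv; rewrite /M' /= (_ : ext _ = fun i => p * ext u i + ext v i).
    exact: (hM n).2.
  by apply/funext => i; rewrite /ext; case: unlift => //; rewrite mulr0 addr0.
have [N2 h2] : exists N, forall n, (N <= n)%N -> I n = I N.
  apply: poly_ideal_acc => [n|n p [u hu <-]]; last by exists u => //; exact: asc.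
  split; first by exists (fun=> 0) => //; exact: (hM n).1.
  move=> p _ _ [u hu <-] [v hv <-]; exists (fun i => p * u i + v i) => //.
  exact: (hM n).2.
exists (N1 + N2)%N => n hn; apply/seteqP; split=> u; last exact: mono.
move=> Mu.
have [v Mv v0] : I (N1 + N2)%N (u ord0).
  by rewrite (h2 (N1 + N2)%N) ?leq_addl // -(h2 n) ?(leq_trans (leq_addl _ _) hn) //; exists u.
pose w i := (-1) * v i + u i.
have Mw : M n w by apply: (hM n).2 => //; exact: (mono _ _ hn).
pose w' j := w (lift ord0 j).
have wE : w = ext w'.
  apply/funext => i; rewrite /ext; case: unliftP => [j|] -> //.
  by rewrite /w v0 mulN1r addNr.
have : M' n w' by rewrite /M' /= -wE.
rewrite (h1 n) ?(leq_trans (leq_addr _ _) hn) // -(h1 (N1 + N2)%N) ?leq_addr // /M' /= -wE => Mw'.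
have -> : u = fun i => 1 * w i + v i.
  by apply/funext => i; rewrite /w mul1r mulN1r addrC addrA subrr add0r.
exact: (hM _).2.
Qed.
End PolySubmodules.

Section StandardIdentity.
Variables (C : comNzRingType) (m n : nat).
Hypothesis mn : (m.+1 * m.+1 < n)%N.

(** Expand every matrix in matrix units. For a fixed choice [h] of units the coefficient is a
    determinant, and by the pigeonhole principle [h] repeats a unit, so two rows agree. *)
Lemma standard_identity (M : 'I_n -> 'M[C]_m.+1) :
  \sum_(s : 'S_n) (-1) ^+ s *: \prod_i M (s i) = 0.
Proof.
pose T := ('I_m.+1 * 'I_m.+1)%type.
pose D (t : T) : 'M[C]_m.+1 := delta_mx t.1 t.2.
have ME i : M i = \sum_(t : T) M i t.1 t.2 *: D t.
  rewrite {1}[M i]matrix_sum_delta pair_bigA /=; apply: eq_bigr => t _ //.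
have E (s : 'S_n) : \prod_i M (s i) =
    \sum_(h : {ffun 'I_n -> T}) (\prod_i M (s i) (h i).1 (h i).2) *: \prod_i D (h i).
  under eq_bigr do rewrite ME.
  rewrite bigA_distr_bigA; apply: eq_bigr => h _.
  by rewrite scaler_prod.
under eq_bigr do rewrite E scaler_sumr.
rewrite exchange_big /= big1 // => h _.
under eq_bigr do rewrite scalerA.
rewrite -scaler_suml; set d := (X in X *: _).
suff -> : d = 0 by rewrite scale0r.
pose X := \matrix_(i < n, j < n) M j (h i).1 (h i).2.
have -> : d = \det X.
  by apply: eq_bigr => s _; congr (_ * _); apply: eq_bigr => i _; rewrite mxE.
have [i [j ij hij]] : exists i, exists2 j, i != j & h i = h j.
  apply: contrapT => hn.
  have : injective h.
    move=> i j hij; apply: contrapT => /eqP ij; apply: hn; exists i; exists j => //.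
  move=> /leq_card; rewrite card_ord card_prod !card_ord; lia.
apply: (determinant_alternate ij) => k; rewrite !mxE hij //.
Qed.
End StandardIdentity.

Section FinitelyGenerated.
Variables (K : fieldType) (P : algType K) (z : P) (m : nat) (g : 'I_m.+1 -> P).
Local Notation ev := (horner_alg z).

Lemma left_noetherian : (forall a, exists c : 'I_m.+1 -> {poly K}, a = \sum_i ev (c i) * g i) ->
  forall L : nat -> set P, (forall n, is_left_ideal (L n)) -> ascending L -> stationary L.
Proof.
move=> gen L hL asc.
pose M n : set ('I_m.+1 -> {poly K}) := [set c | L n (\sum_i ev (c i) * g i)].
have [||N hN] := @poly_submod_acc K m.+1 M; last first.
- exists N => n hn; apply/seteqP; split=> a; have [c ->] := gen a => h.
    by have : M n c by []; rewrite hN.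
  by have : M N c by []; rewrite -(hN n).
- by move=> n c; exact: asc.
- move=> n; have [[L0 LD] LM] := hL n; split.
    by rewrite /M /= big1 // => i _; rewrite rmorph0 mul0r.
  move=> p u v hu hv; rewrite /M /=.
  rewrite (_ : \sum_i _ = 1 *: (ev p * \sum_i ev (u i) * g i) + \sum_i ev (v i) * g i).
    by apply: LD => //; exact: LM.
  rewrite scale1r mulr_sumr -big_split /=; apply: eq_bigr => i _.
  by rewrite rmorphD rmorphM mulrDl mulrA.
Qed.

Lemma right_noetherian : (forall a, exists c : 'I_m.+1 -> {poly K}, a = \sum_i g i * ev (c i)) ->
  forall L : nat -> set P, (forall n, is_right_ideal (L n)) -> ascending L -> stationary L.
Proof.
move=> gen L hL asc.
pose M n : set ('I_m.+1 -> {poly K}) := [set c | L n (\sum_i g i * ev (c i))].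
have [||N hN] := @poly_submod_acc K m.+1 M; last first.
- exists N => n hn; apply/seteqP; split=> a; have [c ->] := gen a => h.
    by have : M n c by []; rewrite hN.
  by have : M N c by []; rewrite -(hN n).
- by move=> n c; exact: asc.
- move=> n; have [[L0 LD] LM] := hL n; split.
    by rewrite /M /= big1 // => i _; rewrite rmorph0 mulr0.
  move=> p u v hu hv; rewrite /M /=.
  rewrite (_ : \sum_i _ = 1 *: ((\sum_i g i * ev (u i)) * ev p) + \sum_i g i * ev (v i)).
    by apply: LD => //; exact: LM.
  rewrite scale1r mulr_suml -big_split /=; apply: eq_bigr => i _.
  by rewrite rmorphD mulrC rmorphM mulrDr mulrA.
Qed.

(* Right multiplications are K[z]-linear endomorphisms of the left K[z]-module
   P, hence given by matrices over the commutative ring K[z]. *)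
Lemma fg_PI : (forall a, exists c : 'I_m.+1 -> {poly K}, a = \sum_i ev (c i) * g i) ->
  satisfies_PI P.
Proof.
move=> gen; pose n := (m.+1 * m.+1).+1.
pose w (s : 'S_n) : seq 'I_n := [seq s i | i <- index_enum 'I_n].
pose St : freealg K n := \sum_(s : 'S_n) (-1) ^+ s *: mon K (w s).
exists n, St; split.
  apply/eqP => /(congr1 (mcoeff (FMonom (w 1%g)))); rewrite mcoeff0 raddf_sum /= (bigD1 1%g) //=.
  rewrite big1 ?addr0 => [|s s1].
    by rewrite odd_perm1 scale1r mcoeff_mon eqxx => /eqP; rewrite oner_eq0.
  rewrite mcoeffZ mcoeff_mon (_ : w s == _ = false) ?mulr0 //.
  apply: contraNF s1 => /eqP h; apply/eqP/permP => i.
  by move/eq_in_map: h => -> //; rewrite mem_index_enum.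
move=> b.
have /choice[M hM] i : exists X : 'M[{poly K}]_m.+1, forall j, g j * b i = \sum_k ev (X j k) * g k.
  have /choice[c hc] j := gen (g j * b i).
  exists (\matrix_(j, k) c j k) => j; rewrite hc; apply: eq_bigr => k _.
  by rewrite mxE.
have hprod (s : seq 'I_n) j : g j * \prod_(i <- s) b i = \sum_k ev ((\prod_(i <- s) M i) j k) * g k.
  elim: s j => [|i s IH] j.
    rewrite !big_nil mulr1 (bigD1 j) //= mxE eqxx rmorph1 mul1r big1 ?addr0 //.
    by move=> k kj; rewrite mxE eq_sym (negPf kj) rmorph0 mul0r.
  rewrite !big_cons mulrA hM mulr_suml.
  under [LHS]eq_bigr do rewrite -mulrA IH mulr_sumr.
  rewrite exchange_big /=; apply: eq_bigr => k _.
  rewrite mxE rmorph_sum mulr_suml; apply: eq_bigr => l _.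
  by rewrite rmorphM mulrA.
have fE : fa_eval b St = \sum_(s : 'S_n) (-1) ^+ s *: \prod_(i <- w s) b i.
  rewrite -[LHS]/(lin_ext (fun w => \prod_(i <- w) b i) _) linear_sum.
  by apply: eq_bigr => s _; rewrite linearZ /= lin_ext_mon.
(* The matrix identity says that right multiplication by the value of [St] kills all generators;
   applied to 1, this gives the value itself. *)
have [c one] := gen 1.
rewrite -[fa_eval b St]mul1r one mulr_suml big1 // => j _.
rewrite -mulrA fE mulr_sumr.
have E (s : 'S_n) : g j * ((-1) ^+ s *: \prod_(i <- w s) b i) =
    \sum_k ev (((-1) ^+ s *: \prod_i M (s i)) j k) * g k.
  rewrite -scalerAr hprod scaler_sumr; apply: eq_bigr => k _.
  rewrite /w big_map mxE; case: (odd_perm s); rewrite /= ?expr1 ?expr0 ?scale1r ?mul1r //.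
  by rewrite scaleN1r mulN1r rmorphN mulNr.
under eq_bigr do rewrite E.
rewrite exchange_big /= big1 ?mulr0 // => k _.
rewrite -mulr_suml -rmorph_sum -summxE standard_identity ?mxE ?rmorph0 ?mul0r //.
Qed.
End FinitelyGenerated.

Lemma sum_only (V : nmodType) n (F : nat -> V) k : (k < n)%N -> (forall i, i != k -> F i = 0) ->
  \sum_(i < n) F i = F k.
Proof.
move=> kn h; rewrite (bigD1 (Ordinal kn)) //= big1 ?addr0 // => i hi.
by apply: h; apply: contraNN hi => /eqP E; apply/eqP/val_inj.
Qed.

(** * The quotient defined by a periodic functional *)

Section Components.
Variable K : fieldType.
Local Notation A := (freealg K 2).
Implicit Types p q : A.

Definition hcomp (n : nat) p : A := lin_ext (fun w => (size w == n)%:R *: mon K w) p.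

HB.instance Definition _ n := GRing.Linear.copy (hcomp n) (lin_ext (fun w => (size w == n)%:R *: mon K w)).

Lemma hcomp_homog n p : homogeneous n (hcomp n p).
Proof.
apply: (subspace_sum (S := homogeneous n)) => [|w _]; first exact: homog_subspace.
apply: (subspaceZ (S := homogeneous n)); first exact: homog_subspace.
case: eqP => [<-|_]; last by rewrite scale0r; exact: (@homog_subspace K 2 n).1.
by rewrite scale1r; exact: mon_homog.
Qed.

Lemma pairing_hcomp L n p : pairing L (hcomp n p) = pairing (fun w => (size w == n)%:R * L w) p.
Proof.
rewrite /hcomp /lin_ext linear_sum; apply: eq_bigr => w _.
by rewrite linearZ /= linearZ /= pairing_mon.
Qed.

Lemma hcomp_same n p : homogeneous n p -> hcomp n p = p.
Proof.
move=> hp; rewrite {2}(monE p) /hcomp /lin_ext; apply: eq_big_seq => w.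
by rewrite -mcoeff_neq0 => /hp ->; rewrite eqxx scale1r.
Qed.

Lemma hcomp_other m n p : homogeneous m p -> m != n -> hcomp n p = 0.
Proof.
move=> hp mn; rewrite /hcomp /lin_ext big_seq big1 // => w.
by rewrite -mcoeff_neq0 => /hp ->; rewrite (negPf mn) scale0r scaler0.
Qed.

Definition width p := (\sum_(w <- msupp p) (size w).+1)%N.

Lemma size_lt_width p w : p@_w != 0 -> (size w < width p)%N.
Proof. by rewrite mcoeff_neq0 => hw; rewrite /width (big_rem w) //= leq_addr. Qed.

Lemma hcomp_sumE n p : hcomp n p = \sum_(w <- msupp p | size w == n) p@_w *: mon K w.
Proof.
rewrite big_mkcond; apply: eq_bigr => w _.
by case: eqP => _; rewrite ?scale1r // scale0r scaler0.
Qed.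

Lemma hcompE p : p = \sum_(n < width p) hcomp n p.
Proof.
under eq_bigr do rewrite hcomp_sumE.
rewrite -(@graded_split _ _ _ (fun w : {fmonom _} => size w) _ (width p)) => [|w].
  exact: monE.
by rewrite -mcoeff_neq0; exact: size_lt_width.
Qed.

Lemma hcomp_width p n : (width p <= n)%N -> hcomp n p = 0.
Proof.
move=> h; rewrite /hcomp /lin_ext big_seq big1 // => w.
rewrite -mcoeff_neq0 => /size_lt_width hw.
rewrite (_ : size w == n = false) ?scale0r ?scaler0 //.
by apply/eqP => E; move: hw; rewrite E ltnNge h.
Qed.

Lemma homogM m n p q : homogeneous m p -> homogeneous n q -> homogeneous (m + n) (p * q).
Proof.
move=> hp hq; rewrite (monE p) (monE q) mulr_suml big_seq.
apply: (subspace_sum (S := homogeneous _)) => [|w]; first exact: homog_subspace.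
rewrite -mcoeff_neq0 => /hp sw; rewrite mulr_sumr big_seq.
apply: (subspace_sum (S := homogeneous _)) => [|v]; first exact: homog_subspace.
rewrite -mcoeff_neq0 => /hq sv; rewrite -scalerAl -scalerAr -mon_cat.
do 2![apply: (subspaceZ (S := homogeneous _)); first exact: homog_subspace].
by rewrite -sw -sv -size_cat; exact: mon_homog.
Qed.
End Components.

Section Coordinates.
Variables (K : fieldType) (n : nat).
Local Notation A := (freealg K 2).

Definition of_coords (c : 'rV[K]_#|{: n.-tuple 'I_2}|) : A := \sum_i c 0 i *: mon K (enum_val i).

Lemma of_coords_is_linear : linear of_coords.
Proof.
move=> a c d; rewrite /of_coords scaler_sumr -big_split; apply: eq_bigr => i _ /=.
by rewrite !mxE scalerDl scalerA.
Qed.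

HB.instance Definition _ := GRing.isLinear.Build K _ A _ of_coords of_coords_is_linear.

Definition coords (p : A) : 'rV[K]_#|{: n.-tuple 'I_2}| :=
  \row_i p@_(FMonom (enum_val i : n.-tuple 'I_2)).

Lemma of_coords_homog c : homogeneous n (of_coords c).
Proof.
apply: (subspace_sum (S := homogeneous n)) => [|i _]; first exact: homog_subspace.
apply: (subspaceZ (S := homogeneous n)); first exact: homog_subspace.
by rewrite -[n in homogeneous n](size_tuple (enum_val i)); exact: mon_homog.
Qed.

Lemma coordsK p : homogeneous n p -> of_coords (coords p) = p.
Proof.
move=> hp; apply/malgP => -[w]; rewrite /of_coords raddf_sum /=.
under eq_bigr do rewrite mcoeffZ mcoeff_mon mxE.
have [sw|sw] := eqVneq (size w) n; last first.
  have -> : p@_(FMonom w) = 0.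
    by apply/eqP; apply: contraNT sw => /hp <-.
  apply: big1 => i _; rewrite (_ : _ == w = false) ?mulr0 //.
  by apply: contraNF sw => /eqP <-; rewrite size_tuple.
have sw' : size w == n by rewrite sw.
rewrite (bigD1 (enum_rank (Tuple sw'))) //= enum_rankK eqxx mulr1 big1 ?addr0 // => i hi.
rewrite (_ : _ == w = false) ?mulr0 //; apply: contraNF hi => /eqP E.
by apply/eqP/enum_val_inj; rewrite enum_rankK; apply: val_inj.
Qed.

Lemma pairing_of_coords L c : pairing L (of_coords c) = \sum_i c 0 i * L (enum_val i).
Proof.
by rewrite linear_sum; apply: eq_bigr => i _; rewrite linearZ /= pairing_mon.
Qed.
End Coordinates.
Arguments of_coords {K} n c.
Arguments coords {K} n p.

Section PeriodicQuotient.
Variables (K : fieldType) (N : nat) (phi0 : seq 'I_2 -> K) (e0 : seq 'I_2).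
Hypotheses (N0 : (0 < N)%N) (supp0 : supported N phi0) (phi_e0 : phi0 e0 = 1).
Local Notation A := (freealg K 2).
Local Notation Ph := (Phi N phi0).
Implicit Types p q : A.

(* Homogeneous, because [Ph k] is supported on words of length [k * N]. *)
Definition periodic_ideal : set A := annih (range Ph).
Local Notation J := periodic_ideal.

Lemma periodic_idealP p : J p <-> forall k u v, pairing (fun w => Ph k (u ++ w ++ v)) p = 0.
Proof.
split=> [h k u v|h _ [k _ <-] u v]; last exact: h.
exact: (h _ (imageT _ _)).
Qed.

Lemma periodic_ideal_sub : is_subspace J.
Proof. exact: (annih_ideal _).1.1. Qed.

Lemma periodic_ideal_mull p q : J q -> J (p * q).
Proof. exact: (annih_ideal _).1.2. Qed.

Lemma periodic_ideal_mulr p q : J p -> J (p * q).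
Proof. exact: (annih_ideal _).2.2. Qed.

Lemma periodic_ideal_hcomp n p : J p -> J (hcomp n p).
Proof.
move=> /periodic_idealP Jp; apply/periodic_idealP => k u v; rewrite pairing_hcomp.
have [E|E] := eqVneq (size u + n + size v)%N (k * N)%N.
  rewrite -[RHS](Jp k u v); apply: eq_bigr => w _; congr (_ * _).
  case: eqP => [_|sw]; first by rewrite mul1r.
  rewrite Phi_eq0 ?mulr0 // !size_cat => h; apply: sw; lia.
rewrite /pairing big1 // => w _; case: eqP => [sw|_]; last by rewrite mul0r mulr0.
rewrite Phi_eq0 ?mulr0 // !size_cat sw => h; move/eqP: E; apply; lia.
Qed.

Variables (P : algType K) (tau : {lrmorphism A -> P}).
Hypothesis tau_surj : forall a, exists p, tau p = a.
Hypothesis tau_ker : forall p, tau p = 0 <-> J p.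
Let Pn n := tau @` homogeneous n.

Lemma tau_grading : is_grading Pn.
Proof.
split.
- move=> n; have [h0 hD] := @homog_subspace K 2 n; split; first by exists 0; rewrite ?raddf0.
  by move=> k _ _ [p hp <-] [q hq <-]; exists (k *: p + q); [exact: hD | rewrite linearP].
- move=> m n _ _ [p hp <-] [q hq <-]; exists (p * q); last by rewrite rmorphM.
  exact: homogM.
- move=> a; have [p <-] := tau_surj a.
  exists (width p), (fun n => tau (hcomp n p)); split.
    by move=> n; exists (hcomp n p) => //; exact: hcomp_homog.
  by rewrite {1}(hcompE p) raddf_sum.
- move=> M c hc0 csum n nM.
  have /choice[q hq] m : exists q, homogeneous m q /\ tau q = c m.
    by have [q ? ?] := hc0 m; exists q.
  have Jq : J (\sum_(m < M) q m).
    by apply/tau_ker; rewrite raddf_sum -[RHS]csum; apply: eq_bigr => m _; exact: (hq m).2.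
  rewrite -(hq n).2; apply/tau_ker.
  have := periodic_ideal_hcomp n Jq; rewrite raddf_sum /= (bigD1 (Ordinal nM)) //= (hcomp_same (hq n).1).
  rewrite big1 ?addr0 // => m hm; apply: hcomp_other (hq m).1 _.
  by apply: contraNN hm => /eqP mn; apply/eqP/val_inj.
Qed.

Lemma e0_notin_periodic_ideal : ~ J (mon K e0).
Proof.
move=> /periodic_idealP/(_ 1%N [::] [::]); rewrite pairing_mon cats0 Phi1 // phi_e0 => /eqP.
by rewrite oner_eq0.
Qed.

Lemma positive_part_neq0 : positive_part Pn <> [set 0].
Proof.
move=> h; have : [set 0] (tau (mon K e0)); last by move/tau_ker; exact: e0_notin_periodic_ideal.
rewrite -h; exists N, (fun n => if n == N then tau (mon K e0) else 0); split.
  move=> n; case: eqP => [->|_].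
    by exists (mon K e0) => //; rewrite -(size_e0 supp0 phi_e0); exact: mon_homog.
  by exists 0; rewrite ?raddf0 //; exact: (@homog_subspace K 2 n).1.
have NN : (N.-1 < N)%N by rewrite prednK.
rewrite (bigD1 (Ordinal NN)) //= prednK // eqxx big1 ?addr0 // => i hi.
case: eqP => // iN; case/eqP: hi; apply: val_inj => /=.
by move: iN; clear; lia.
Qed.

Lemma max_component p : ~ J p -> exists n, ~ J (hcomp n p) /\ forall i, (n < i)%N -> J (hcomp i p).
Proof.
move=> Jp; have ex : exists n, `[< ~ J (hcomp n p) >].
  apply: contrapT => hn; apply: Jp; rewrite (hcompE p).
  apply: subspace_sum => [|i _]; first exact: periodic_ideal_sub.
  by apply: contrapT => hi; apply: hn; exists (i : nat); apply/asboolP.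
have bd n : `[< ~ J (hcomp n p) >] -> (n <= width p)%N.
  move=> /asboolP hn; rewrite leqNgt; apply/negP => hw; apply: hn.
  by rewrite hcomp_width ?(ltnW hw) //; exact: periodic_ideal_sub.1.
case: (ex_maxnP ex bd) => n /asboolP hn hmax; exists n; split=> // i ni.
apply: contrapT => hi; have := hmax i; rewrite leqNgt ni => /(_ _)/negP; apply.
  by apply/asboolP.
by [].
Qed.

Lemma pairing_hcompE L p : pairing L p = \sum_(n < width p) pairing L (hcomp n p).
Proof. by rewrite {1}(hcompE p) raddf_sum. Qed.

(** The ideals need not be homogeneous, so [p] and [q] are compared through their top components
    outside the ideal. Contexts [u, v] and [u', v'] detecting these are joined into [p v u' q]; the
    functional [Ph (s + t)] then multiplies the two detected values. *)
Lemma tau_prime : prime_alg P.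
Proof.
move=> J1 J2 id1 id2 J12; apply: contrapT => /not_orP[n1 n2].
have nz (I : set P) : is_ideal I -> I <> [set 0] -> exists p, I (tau p) /\ ~ J p.
  move=> [[[I0 _] _] _] hI; apply: contrapT => hn; apply: hI; apply/seteqP; split=> a.
    have [p <-] := tau_surj a => Ip; apply/tau_ker; apply: contrapT => Jp.
    by apply: hn; exists p.
  by move=> ->.
have [p [pJ1 /max_component[n [np pmax]]]] := nz _ id1 n1.
have [q [qJ2 /max_component[m [nq qmax]]]] := nz _ id2 n2.
have wit r k : ~ J (hcomp k r) -> exists s u v, pairing (fun w => Ph s (u ++ w ++ v)) (hcomp k r) != 0.
  move=> h; apply: contrapT => hn; apply: h; apply/periodic_idealP => s u v.
  by apply/eqP; apply/negP => /negP h; apply: hn; exists s, u, v.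
have [s [u [v hs]]] := wit _ _ np; have [t [u' [v' ht]]] := wit _ _ nq.
have sz : (size u + n + size v = s * N)%N.
  apply: contrapT => h; move: hs.
  by rewrite (kills_supp (@Phi_supp _ _ _ supp0 s) (@hcomp_homog K _ _) h) eqxx.
have sz' : (size u' + m + size v' = t * N)%N.
  apply: contrapT => h; move: ht.
  by rewrite (kills_supp (@Phi_supp _ _ _ supp0 t) (@hcomp_homog K _ _) h) eqxx.
pose g w := pairing (fun w' => Ph (s + t) (u ++ (w ++ v ++ u' ++ w') ++ v')) q.
have gE r : pairing (fun w => Ph (s + t) (u ++ w ++ v')) (r * (mon K (v ++ u') * q)) = pairing g r.
  rewrite pairingM; congr (pairing _ r); apply/funext => w; rewrite pairing_monl /g.
  by congr (pairing _ q); apply/funext => w'; rewrite -!catA.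
have Jx : J (p * (mon K (v ++ u') * q)).
  by apply/tau_ker; rewrite rmorphM; apply: J12 => //; rewrite rmorphM; exact: id2.1.2.
have g0 : pairing g p = 0 by rewrite -gE; move/periodic_idealP: Jx; apply.
(* Above [n] the components of [p] are in the ideal. Below [n], a component of [q] of degree at most
   [m] gives words too short for [Ph (s + t)], and one of larger degree is in the ideal. *)
have term i : i != n -> pairing g (hcomp i p) = 0.
  move=> inn; have [lt|gt|E] := ltngtP i n; last by rewrite E eqxx in inn.
    have gw w (sw : size w = i) (j : nat) :
        pairing (fun w' => Ph (s + t) (u ++ (w ++ v ++ u' ++ w') ++ v')) (hcomp j q) = 0.
      have [jm|mj] := leqP j m; last first.
        have /periodic_idealP/(_ (s + t)%N (u ++ w ++ v ++ u') v') h := qmax _ mj.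
        by rewrite -[RHS]h; congr (pairing _ _); apply/funext => w'; rewrite -!catA.
      apply: (pairing_eq0 (@hcomp_homog K j q)) => w' sw'; apply: (Phi_eq0 supp0).
      rewrite !size_cat sw sw' mulnDl -sz -sz'; move: jm lt; clear; lia.
    apply: (pairing_eq0 (@hcomp_homog K i p)) => w sw.
    by rewrite /g pairing_hcompE; apply: big1 => j _; exact: gw.
  by rewrite -gE; have /periodic_idealP := periodic_ideal_mulr (mon K (v ++ u') * q) (pmax _ gt); apply.
have ht' : pairing (fun w => Ph t (u' ++ w ++ v')) q = pairing (fun w => Ph t (u' ++ w ++ v')) (hcomp m q).
  rewrite pairing_hcomp; apply: eq_bigr => w _; congr (_ * _).
  case: eqP => [_|sw]; first by rewrite mul1r.
  rewrite mul0r; apply: (Phi_eq0 supp0); rewrite !size_cat -sz'; move: sw; clear; lia.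
have gn : pairing g (hcomp n p) = pairing (fun w => Ph s (u ++ w ++ v)) (hcomp n p) *
    pairing (fun w => Ph t (u' ++ w ++ v')) (hcomp m q).
  rewrite -pairingZR -ht'; apply: (eq_pairing (@hcomp_homog K n p)) => w sw.
  rewrite /g -pairingZL; congr (pairing _ q); apply/funext => w'.
  have su : size (u ++ w ++ v) = (s * N)%N by rewrite !size_cat sw addnA.
  rewrite -(PhiD phi0 t (u' ++ w' ++ v') su).
  by rewrite -!catA.
have nw : (n < width p)%N.
  by rewrite ltnNge; apply/negP => /hcomp_width h; apply: np; rewrite h; exact: periodic_ideal_sub.1.
have E : pairing g p = pairing g (hcomp n p).
  by rewrite pairing_hcompE; exact: (@sum_only _ _ (fun i => pairing g (hcomp i p)) _ nw term).
by have := mulf_neq0 hs ht; rewrite -gn -E g0 eqxx.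
Qed.

(* Complete blocks to the left and to the right of an element only contribute
   scalar factors, so membership in the ideal is tested by short words. *)
Definition short := {k : 'I_N & k.-tuple 'I_2}.
Definition short_word (x : short) : seq 'I_2 := tagged x.

Lemma short_wordP u : (size u < N)%N -> exists x, short_word x = u.
Proof.
move=> h; have hs : size u == Ordinal h by [].
by exists (Tagged (fun k : 'I_N => k.-tuple 'I_2) (Tuple hs)).
Qed.

(** The rounded quotient is harmless: if the total length is not a multiple of [N], then [Ph]
    vanishes there. *)
Definition probe n (x : short * short) (w : seq 'I_2) :=
  Ph ((size (short_word x.1) + n + size (short_word x.2)) %/ N) (short_word x.1 ++ w ++ short_word x.2).

Lemma periodic_ideal_probe n p : homogeneous n p -> (forall x, pairing (probe n x) p = 0) -> J p.
Proof.
move=> hp hx; apply/periodic_idealP => k u v.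
have [E|E] := eqVneq (size u + n + size v)%N (k * N)%N; last first.
  by apply: (kills_supp (@Phi_supp _ _ _ supp0 k) hp); apply/eqP.
have Eu := divn_eq (size u) N; have Ev := divn_eq (size v) N.
have lu := ltn_pmod (size u) N0; have lv := ltn_pmod (size v) N0.
set a := (size u %/ N)%N in Eu; set b := (size v %/ N)%N in Ev.
set a' := (size u %% N)%N in Eu lu; set b' := (size v %% N)%N in Ev lv.
have [x hx1] : exists x, short_word x = drop (a * N) u.
  by apply: short_wordP; rewrite size_drop; move: Eu lu; clear; lia.
have [y hy1] : exists y, short_word y = take b' v.
  by apply: short_wordP; rewrite size_takel //; move: Ev; clear; lia.
have kab : (k - (a + b) + (a + b) = k)%N.
  have : ((a + b) * N <= k * N)%N by rewrite -E mulnDl; move: Eu Ev; clear; lia.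
  by rewrite leq_pmul2r // => h; rewrite subnK.
set j := (k - (a + b))%N in kab.
have sj : ((size (short_word x) + n + size (short_word y)) %/ N = j)%N.
  have -> : (size (short_word x) + n + size (short_word y) = j * N)%N.
    rewrite hx1 hy1 size_drop size_takel; last by move: Ev; clear; lia.
    have : (k * N = j * N + (a * N + b * N))%N by rewrite -kab !mulnDl.
    by move: E Eu Ev; clear; lia.
  by rewrite mulnK.
transitivity (pairing (fun w => Ph a (take (a * N) u) * (probe n (x, y) w * Ph b (drop b' v))) p).
  congr (pairing _ p); apply/funext => w.
  have -> : u ++ w ++ v = take (a * N) u ++ (short_word x ++ w ++ short_word y) ++ drop b' v.
    rewrite hx1 hy1 -!catA cat_take_drop.
    by rewrite [take _ u ++ _]catA cat_take_drop.
  have -> : k = (a + (j + b))%N by rewrite addnCA kab.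
  rewrite PhiD; last by rewrite size_takel //; move: Eu; clear; lia.
  rewrite PhiDr /probe /= ?sj //.
  by rewrite size_drop; move: Ev; clear; lia.
by rewrite pairingZL pairingZR hx mul0r mulr0.
Qed.

Definition probe_mx n := \matrix_(i < #|{: n.-tuple 'I_2}|, x < #|{: short * short}|)
  probe n (enum_val x) (enum_val i).

Lemma of_coords_J n c : J (of_coords n c) <-> c *m probe_mx n = 0.
Proof.
have E x : (c *m probe_mx n) 0 (enum_rank x) = pairing (probe n x) (of_coords n c).
  by rewrite mxE pairing_of_coords; apply: eq_bigr => i _; rewrite mxE enum_rankK.
split=> [/periodic_idealP h|h].
  apply/rowP => x; rewrite -[x]enum_valK E mxE; exact: h.
apply: (periodic_ideal_probe (@of_coords_homog _ n c)) => x; rewrite -E h mxE //.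
Qed.

(** Modulo the ideal, degree [n] is isomorphic to the row space of [probe_mx n], whose number of
    columns does not depend on [n]. The pseudo-inverse lifts this row space back to spanning
    elements. *)
Lemma tau_growth : linear_growth Pn.
Proof.
exists #|{: short * short}| => n.
exists (fun t => tau (of_coords n (row t (pinvmx (probe_mx n))))); split.
  by move=> t; exists (of_coords n (row t (pinvmx (probe_mx n)))) => //; exact: of_coords_homog.
move=> _ [p hp <-]; exists (fun t => (coords n p *m probe_mx n) 0 t).
transitivity (tau (of_coords n (coords n p *m probe_mx n *m pinvmx (probe_mx n)))); last first.
  rewrite mulmx_sum_row (raddf_sum (of_coords n)) (raddf_sum tau); apply: eq_bigr => t _.
  by rewrite /= linearZ /= linearZ.
apply/eqP; rewrite -subr_eq0 -raddfB; apply/eqP/tau_ker.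
rewrite -{1}(coordsK hp) -raddfB; apply/of_coords_J.
by rewrite mulmxBl mulmxKpV ?submxMl ?subrr.
Qed.
End PeriodicQuotient.

(** * Regular elements and finite generation *)

(** Lines replace the Zariski topology: on the line from a point good for the first [k] conditions
    to one good for the last, each condition is a nonzero polynomial, and so is their product. A
    closed field contains a nonroot. *)
Lemma generic_nonzero (K : closedFieldType) (V : lmodType K) (D : nat -> V -> K) k :
  (forall i v w, exists q : {poly K}, forall x, D i (v + x *: (w - v)) = q.[x]) ->
  (forall i, (i < k)%N -> exists v, D i v != 0) ->
  exists v, forall i, (i < k)%N -> D i v != 0.
Proof.
move=> line; elim: k => [|k IH] hD; first by exists 0.
have [v hv] := IH (fun i ik => hD i (ltnW ik)); have [w hw] := hD k (ltnSn k).
have /choice[q hq] i := line i v w.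
have v0 i : (q i).[0] = D i v by rewrite -hq scale0r addr0.
have w1 : (q k).[1] = D k w by rewrite -hq scale1r addrC subrK.
have [x hx] : exists x, ~~ root (\prod_(i < k.+1) q i) x.
  apply/closed_nonrootP/prodf_neq0 => i _; apply/eqP => qi0.
  have [ik|ik] := ltnP i k.
    by have := hv i ik; rewrite -v0 qi0 horner0 eqxx.
  have E : i = k :> nat by apply/eqP; rewrite eqn_leq ik -ltnS ltn_ord.
  by move: hw; rewrite -w1 -E qi0 horner0 eqxx.
exists (v + x *: (w - v)) => i ik; rewrite hq.
by have := hx; rewrite /root horner_prod => /prodf_neq0/(_ (Ordinal ik) isT).
Qed.

Lemma det_line (K : fieldType) n (X Y : 'M[K]_n) :
  exists q : {poly K}, forall x, \det (X + x *: Y) = q.[x].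
Proof.
exists (\det (map_mx polyC X + 'X *: map_mx polyC Y)) => x.
rewrite -horner_evalE -det_map_mx; congr (\det _); apply/matrixP => i j.
by rewrite !mxE /= horner_evalE hornerD hornerM hornerX !hornerC.
Qed.

Lemma leq_rank_ker (K : fieldType) m n n' (X : 'M[K]_(m, n)) (Y : 'M[K]_(m, n')) :
  (forall c : 'rV_m, c *m X = 0 -> c *m Y = 0) -> (\rank Y <= \rank X)%N.
Proof.
move=> h; have : (kermx X <= kermx Y)%MS.
  apply/sub_kermxP/row_matrixP => i; rewrite row_mul row0; apply: h.
  by apply/sub_kermxP; exact: row_sub.
move=> /mxrankS; rewrite !mxrank_ker; have := rank_leq_row X; have := rank_leq_row Y; lia.
Qed.

Section Cut.
Variables (K : fieldType) (a b : nat) (H : 'M[K]_(a, b)).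

(** An idempotent with the same column space as [H]. *)
Definition cut_proj := H *m pinvmx H.
(* [H] and [H C H] have the same kernels as soon as [cut_mx C] is invertible;
   this is an open condition on [C] that holds for [C = pinvmx H]. *)
Definition cut_mx (C : 'M[K]_(b, a)) := 1%:M - cut_proj + H *m C *m cut_proj.

Lemma cut_projK : cut_proj *m H = H.
Proof. by rewrite /cut_proj mulmxKpV // submx_refl. Qed.

Lemma cut_mx_pinv : cut_mx (pinvmx H) = 1%:M.
Proof. by rewrite /cut_mx -/cut_proj /cut_proj mulmxA mulmxKpV ?submx_refl // subrK. Qed.

Lemma cut_left C n (c : 'M_(n, a)) : \det (cut_mx C) != 0 -> c *m (H *m C *m H) = 0 -> c *m H = 0.
Proof.
move=> hd hc; have hu : cut_mx C \in unitmx by rewrite unitmxE unitfE.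
suff h : c *m cut_proj = 0 by rewrite -[H in c *m H]cut_projK mulmxA h mul0mx.
rewrite -[LHS](mulmxK hu) (_ : _ *m cut_mx C = 0) ?mul0mx //.
rewrite /cut_mx mulmxDr mulmxBr mulmx1 -[X in _ - X + _]mulmxA.
have -> : cut_proj *m cut_proj = cut_proj by rewrite {2}/cut_proj mulmxA cut_projK.
have E1 : cut_proj *m (H *m C *m cut_proj) = H *m C *m H *m pinvmx H.
  rewrite !(mulmxA cut_proj) cut_projK /cut_proj.
  by rewrite !mulmxA.
by rewrite subrr add0r -(mulmxA c cut_proj) E1 mulmxA hc mul0mx.
Qed.

Lemma cut_right C n (d : 'M_(b, n)) : \det (cut_mx C) != 0 -> H *m C *m H *m d = 0 -> H *m d = 0.
Proof.
move=> hd hc; have hu : cut_mx C \in unitmx by rewrite unitmxE unitfE.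
rewrite -[LHS](mulKmx hu) (_ : cut_mx C *m _ = 0) ?mulmx0 //.
have E1 : H *m C *m cut_proj *m (H *m d) = 0.
  by rewrite -(mulmxA _ cut_proj) (mulmxA cut_proj) cut_projK mulmxA hc.
by rewrite /cut_mx mulmxDl mulmxBl mul1mx (mulmxA cut_proj) cut_projK subrr add0r E1.
Qed.

Lemma cut_line (C C' : 'M[K]_(b, a)) : exists q : {poly K}, forall x,
  \det (cut_mx (C + x *: C')) = q.[x].
Proof.
have [q hq] := det_line (cut_mx C) (H *m C' *m cut_proj); exists q => x; rewrite -hq.
by congr (\det _); rewrite /cut_mx mulmxDr mulmxDl addrA -scalemxAr -scalemxAl.
Qed.
End Cut.

Section Regular.
Variables (K : fieldType) (N : nat) (phi0 : seq 'I_2 -> K) (e0 : seq 'I_2).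
Hypotheses (N0 : (0 < N)%N) (supp0 : supported N phi0) (phi_e0 : phi0 e0 = 1).
Local Notation A := (freealg K 2).
Local Notation Ph := (Phi N phi0).
Local Notation J := (periodic_ideal N phi0).
Implicit Types p q : A.

Definition word_at k (s : 'I_#|{: k.-tuple 'I_2}|) : seq 'I_2 := tval (enum_val s).

Lemma size_word_at k s : size (@word_at k s) = k.
Proof. exact: size_tuple. Qed.

Lemma word_at_inj k : injective (@word_at k).
Proof. by move=> s t /val_inj/enum_val_inj. Qed.

Lemma word_atP k w : size w = k -> exists s, @word_at k s = w.
Proof. by move=> /eqP h; exists (enum_rank (Tuple h)); rewrite /word_at enum_rankK. Qed.

Definition hankel i : 'M[K]_(#|{: i.-tuple 'I_2}|, #|{: (N - i).-tuple 'I_2}|) :=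
  \matrix_(s, t) phi0 (word_at s ++ word_at t).

(** In a context where a block is open after [i] letters, a factor of degree [N] first supplies the
    [N - i] letters that close it and then [i] letters of the next block; hence the order of the
    indices, transposed to that of [hankel i]. *)
Definition cut_coef i p : 'M[K]_(#|{: (N - i).-tuple 'I_2}|, #|{: i.-tuple 'I_2}|) :=
  \matrix_(t, s) p@_(FMonom (word_at t ++ word_at s)).

Lemma cat_word_at_eq k l (t t' : 'I_#|{: k.-tuple 'I_2}|) (s s' : 'I_#|{: l.-tuple 'I_2}|) :
  (word_at t ++ word_at s == word_at t' ++ word_at s') = (t == t') && (s == s').
Proof. by rewrite eqseq_cat ?size_word_at // !(inj_eq (@word_at_inj _)). Qed.

Definition of_coef i (C : 'M[K]_(#|{: (N - i).-tuple 'I_2}|, #|{: i.-tuple 'I_2}|)) : A :=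
  \sum_t \sum_s C t s *: mon K (word_at t ++ word_at s).

Lemma mcoeff_of_coef i C w : (of_coef C)@_(FMonom w) =
  \sum_t \sum_s C t s * (@word_at (N - i) t ++ @word_at i s == w)%:R.
Proof.
rewrite raddf_sum; apply: eq_bigr => t _; rewrite raddf_sum; apply: eq_bigr => s _.
by rewrite /= mcoeffZ mcoeff_mon.
Qed.

Lemma of_coefK i C : cut_coef i (of_coef C) = C.
Proof.
apply/matrixP => t s; rewrite mxE mcoeff_of_coef.
rewrite (bigD1 t) //= [X in _ + X]big1 => [|t' /negPf ht]; last first.
  by apply: big1 => s' _; rewrite cat_word_at_eq ht mulr0.
rewrite addr0 (bigD1 s) //= [X in _ + X]big1 => [|s' /negPf hs]; last first.
  by rewrite cat_word_at_eq hs andbF mulr0.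
by rewrite addr0 eqxx mulr1.
Qed.

Lemma coefK i p : (i <= N)%N -> homogeneous N p -> of_coef (cut_coef i p) = p.
Proof.
move=> iN hp; apply/malgP => -[w].
have [sw|sw] := eqVneq (size w) N; last first.
  have -> : p@_(FMonom w) = 0 by apply/eqP; apply: contraNT sw => /hp <-.
  rewrite mcoeff_of_coef big1 // => t _; rewrite big1 // => s _.
  rewrite (_ : _ == w = false) ?mulr0 //.
  by apply: contraNF sw => /eqP <-; rewrite size_cat !size_word_at subnK.
have [|t ht] := @word_atP (N - i) (take (N - i) w); first by rewrite size_takel // sw leq_subr.
have [|s hs] := @word_atP i (drop (N - i) w); first by rewrite size_drop sw subKn.
have -> : w = word_at t ++ word_at s by rewrite ht hs cat_take_drop.
by have /matrixP/(_ t s) := of_coefK (cut_coef i p); rewrite !mxE.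
Qed.

Lemma pairing_coef i L p : (i <= N)%N -> homogeneous N p -> pairing L p =
  \sum_t \sum_s cut_coef i p t s * L (word_at t ++ word_at s).
Proof.
move=> iN hp; rewrite -{1}(coefK iN hp) raddf_sum; apply: eq_bigr => t _.
rewrite raddf_sum; apply: eq_bigr => s _.
by rewrite /= linearZ /= pairing_mon.
Qed.

Definition cut_det i p := \det (cut_mx (hankel i) (cut_coef i p)).

Lemma cut_det_line i v w : exists q : {poly K}, forall x, cut_det i (v + x *: (w - v)) = q.[x].
Proof.
have [q hq] := cut_line (hankel i) (cut_coef i v) (cut_coef i (w - v)).
exists q => x; rewrite -hq /cut_det; congr (\det (cut_mx _ _)); apply/matrixP => s t.
by rewrite !mxE mcoeffD mcoeffZ.
Qed.

Lemma cut_det_hcomp i p : (i <= N)%N -> cut_det i (hcomp N p) = cut_det i p.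
Proof.
move=> iN; congr (\det (cut_mx _ _)); apply/matrixP => t s; rewrite !mxE.
set w := (_ ++ _); have sw : size w = N by rewrite size_cat !size_word_at subnK.
rewrite [in RHS](monE p) hcomp_sumE !raddf_sum big_mkcond; apply: eq_bigr => v _ /=.
rewrite mcoeffZ mcoeff_mon; case: eqP => [//|h].
by case: ((v : seq _) =P w) => [E|]; [case: h; rewrite E | rewrite mulr0].
Qed.

Variable zeta : A.
Hypothesis zeta_homog : homogeneous N zeta.
Hypothesis zeta_det : forall i, (i < N)%N -> cut_det i zeta != 0.

Lemma zeta_cut i (f g : seq 'I_2 -> K) : (i <= N)%N ->
  pairing (fun z => f (take (N - i) z) * g (drop (N - i) z)) zeta =
  \sum_t \sum_s f (word_at t) * cut_coef i zeta t s * g (word_at s).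
Proof.
move=> iN; rewrite (pairing_coef _ iN zeta_homog); apply: eq_bigr => t _; apply: eq_bigr => s _.
by rewrite take_size_cat ?drop_size_cat ?size_word_at //; ring.
Qed.

(** Lengthens the right context to at least [N] letters, so that an unfinished block can always be
    completed inside it. *)
Lemma kills_pad k u v p : pairing (fun w => Ph k (u ++ w ++ v)) p =
  pairing (fun w => Ph k.+1 (u ++ w ++ (v ++ e0))) p.
Proof.
congr (pairing _ p); apply/funext => w.
by rewrite -(Phi_cat_e0 supp0 phi_e0) -!catA.
Qed.

Lemma sum_word_at i (G : 'I_#|{: i.-tuple 'I_2}| -> K) s0 y : word_at s0 = y ->
  \sum_s G s * (y == word_at s)%:R = G s0.
Proof.
move=> <-; rewrite (bigD1 s0) //= eqxx mulr1 big1 ?addr0 // => s /negPf hs.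
by rewrite (inj_eq (@word_at_inj _)) eq_sym hs mulr0.
Qed.

(** Let [u p] stop after [i] letters of a block, and let [c] record [p] according to these letters,
    the complete blocks being evaluated. Contexts for [p] compute [c H], those for [p * zeta]
    compute [c H C H], with [H] the Hankel matrix and [C] the coefficients of [zeta]; the two have
    the same kernel. *)
Lemma regular_right n p : homogeneous n p -> J (p * zeta) -> J p.
Proof.
move=> hp /periodic_idealP hJ; apply/periodic_idealP => k u v.
have [E|E] := eqVneq (size u + n + size v)%N (k * N)%N; last first.
  by apply: (kills_supp (@Phi_supp _ _ _ supp0 k) hp); apply/eqP.
rewrite kills_pad; set V := v ++ e0.
have sV : size V = (size v + N)%N by rewrite size_cat (size_e0 supp0 phi_e0).
have Ex := divn_eq (size u + n) N; have iN := ltn_pmod (size u + n) N0.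
set a := ((size u + n) %/ N)%N in Ex; set i := ((size u + n) %% N)%N in Ex iN.
have leN : (i <= N)%N := ltnW iN.
have ak : (a <= k)%N by rewrite -(leq_pmul2r N0) -E; move: Ex; clear; lia.
have sv2 : size (drop (N - i) V) = ((k - a) * N)%N.
  by rewrite size_drop sV mulnBl; move: E Ex leN; clear; lia.
have [|t0 ht0] := @word_atP (N - i) (take (N - i) V).
  by rewrite size_takel // sV; move: (leq_subr i N); clear; lia.
suff h t : pairing (fun w => Ph a.+1 (u ++ w ++ @word_at (N - i) t)) p = 0.
  transitivity (pairing (fun w => Ph a.+1 (u ++ w ++ word_at t0) * Ph (k - a) (drop (N - i) V)) p).
    congr (pairing _ p); apply/funext => w.
    have -> : k.+1 = (a.+1 + (k - a))%N by rewrite addSn subnKC.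
    by rewrite -PhiDr // ht0 -!catA cat_take_drop.
  by rewrite pairingZR h mul0r.
pose F w := Ph a (take (a * N) (u ++ w)).
pose c := \row_s pairing (fun w => F w * (drop (a * N) (u ++ w) == @word_at i s)%:R) p.
have cE (G : 'I_#|{: i.-tuple 'I_2}| -> K) (L : seq 'I_2 -> K) :
    (forall w s, size w = n -> drop (a * N) (u ++ w) = word_at s -> L w = F w * G s) ->
    pairing L p = \sum_s c 0 s * G s.
  move=> hL; transitivity (pairing (fun w => \sum_s G s * (F w * (drop (a * N) (u ++ w) == @word_at i s)%:R)) p).
    apply: (eq_pairing hp) => w sw.
    have [|s0 hs0] := @word_atP i (drop (a * N) (u ++ w)).
      by rewrite size_drop size_cat sw; move: Ex; clear; lia.
    rewrite (hL w s0) //; under eq_bigr do rewrite mulrCA.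
    by rewrite -mulr_sumr (sum_word_at _ hs0).
  by rewrite pairing_sumL; apply: eq_bigr => s _; rewrite !mxE mulrC.
have su w : size w = n -> size (take (a * N) (u ++ w)) = (a * N)%N.
  by move=> sw; rewrite size_takel // size_cat sw; move: Ex; clear; lia.
have key1 : pairing (fun w => Ph a.+1 (u ++ w ++ word_at t)) p = (c *m hankel i) 0 t.
  rewrite mxE; apply: cE => w s sw hs; rewrite mxE.
  rewrite catA -[u ++ w](cat_take_drop (a * N)) -catA hs -addn1 PhiD ?su // Phi1 //.
have key2 r : (c *m (hankel i *m cut_coef i zeta *m hankel i)) 0 r = 0.
  have := hJ a.+2 u (word_at r); rewrite pairingM => h0; rewrite -[RHS]h0 mxE; apply/esym/cE => w s sw hs.
  transitivity (pairing (fun z => F w * (phi0 (word_at s ++ take (N - i) z)) * phi0 (drop (N - i) z ++ word_at r)) zeta).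
    apply: (eq_pairing zeta_homog) => z sz.
    have -> : u ++ (w ++ z) ++ word_at r = take (a * N) (u ++ w) ++ (word_at s ++ take (N - i) z) ++ (drop (N - i) z ++ word_at r).
      by rewrite -hs -!catA [take (N - i) z ++ _]catA cat_take_drop [take _ _ ++ _]catA cat_take_drop -!catA.
    rewrite -addn2 PhiD ?su // -[2%N]/(1 + 1)%N PhiD ?Phi1 ?mulrA //.
    by rewrite size_cat size_word_at size_takel ?sz ?leq_subr // mul1n subnKC.
  rewrite (zeta_cut (fun z => F w * phi0 (word_at s ++ z)) (fun z => phi0 (z ++ word_at r)) leN).
  rewrite exchange_big mxE mulr_sumr; apply: eq_bigr => s' _.
  rewrite mxE mulr_suml mulr_sumr; apply: eq_bigr => t' _; rewrite !mxE; ring.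
rewrite key1 (cut_left (zeta_det iN) (c := c)) ?mxE //.
by apply/rowP => r; rewrite key2 mxE.
Qed.

(** The mirror argument: [i] is now the offset at which [u] stops, and the column [c] records [p] by
    the letters that complete a block begun by [zeta]. *)
Lemma regular_left n p : homogeneous n p -> J (zeta * p) -> J p.
Proof.
move=> hp /periodic_idealP hJ; apply/periodic_idealP => k u v.
have [E|E] := eqVneq (size u + n + size v)%N (k * N)%N; last first.
  by apply: (kills_supp (@Phi_supp _ _ _ supp0 k) hp); apply/eqP.
rewrite kills_pad; set V := v ++ e0.
have sV : size V = (size v + N)%N by rewrite size_cat (size_e0 supp0 phi_e0).
have Ex := divn_eq (size u) N; have iN := ltn_pmod (size u) N0.
set b := (size u %/ N)%N in Ex; set i := (size u %% N)%N in Ex iN.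
have leN : (i <= N)%N := ltnW iN.
have bk : (b <= k)%N by rewrite -(leq_pmul2r N0) -E; move: Ex; clear; lia.
set a := (k - b)%N.
have sy w : size w = n -> size (w ++ V) = (N - i + a * N)%N.
  by move=> sw; rewrite size_cat sw sV mulnBl; move: E Ex leN; clear; lia.
have [|s0 hs0] := @word_atP i (drop (b * N) u).
  by rewrite size_drop; move: Ex; clear; lia.
suff h s : pairing (fun w => Ph a.+1 (@word_at i s ++ w ++ V)) p = 0.
  transitivity (pairing (fun w => Ph b (take (b * N) u) * Ph a.+1 (word_at s0 ++ w ++ V)) p).
    congr (pairing _ p); apply/funext => w.
    have -> : k.+1 = (b + a.+1)%N by rewrite addnS /a subnKC.
    rewrite -PhiD; first by rewrite hs0 [in RHS]catA cat_take_drop.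
    by rewrite size_takel //; move: Ex; clear; lia.
  by rewrite pairingZL h mulr0.
pose F w := Ph a (drop (N - i) (w ++ V)).
pose c := \col_t pairing (fun w => F w * (take (N - i) (w ++ V) == @word_at (N - i) t)%:R) p.
have cE (G : 'I_#|{: (N - i).-tuple 'I_2}| -> K) (L : seq 'I_2 -> K) :
    (forall w t, size w = n -> take (N - i) (w ++ V) = word_at t -> L w = F w * G t) ->
    pairing L p = \sum_t G t * c t 0.
  move=> hL; transitivity (pairing (fun w => \sum_t G t * (F w * (take (N - i) (w ++ V) == @word_at (N - i) t)%:R)) p).
    apply: (eq_pairing hp) => w sw.
    have [|t0 ht0] := @word_atP (N - i) (take (N - i) (w ++ V)).
      by rewrite size_takel // sy // leq_addr.
    rewrite (hL w t0) //; under eq_bigr do rewrite mulrCA.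
    by rewrite -mulr_sumr (sum_word_at _ ht0).
  by rewrite pairing_sumL; apply: eq_bigr => t _; rewrite !mxE.
have key1 s' : pairing (fun w => Ph a.+1 (word_at s' ++ w ++ V)) p = (hankel i *m c) s' 0.
  rewrite mxE; apply: cE => w t sw ht; rewrite mxE.
  have -> : word_at s' ++ w ++ V = (word_at s' ++ word_at t) ++ drop (N - i) (w ++ V).
    by rewrite -ht -catA cat_take_drop.
  by rewrite -add1n PhiD ?Phi1 1?mulrC // size_cat !size_word_at mul1n subnKC.
have key2 r : (hankel i *m cut_coef i zeta *m hankel i *m c) r 0 = 0.
  have := hJ a.+2 (word_at r) V; rewrite pairingM => h0; rewrite -[RHS]h0.
  transitivity (pairing (fun z => phi0 (word_at r ++ take (N - i) z) *
      pairing (fun w => Ph a.+1 (drop (N - i) z ++ w ++ V)) p) zeta).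
    rewrite (zeta_cut (fun z => phi0 (word_at r ++ z)) (fun z => pairing (fun w => Ph a.+1 (z ++ w ++ V)) p) leN).
    rewrite -mulmxA mxE exchange_big; apply: eq_bigr => s' _.
    rewrite key1 mxE mulr_suml; apply: eq_bigr => t' _; rewrite !mxE; ring.
  apply: (eq_pairing zeta_homog) => z sz; rewrite -pairingZL.
  congr (pairing _ p); apply/funext => w.
  have -> : word_at r ++ (z ++ w) ++ V = (word_at r ++ take (N - i) z) ++ (drop (N - i) z ++ w ++ V).
    by rewrite -!catA [take _ z ++ _]catA cat_take_drop.
  rewrite -[a.+2]add1n PhiD ?Phi1 //.
  by rewrite size_cat size_word_at size_takel ?sz ?leq_subr // mul1n subnKC.
rewrite key1 (cut_right (zeta_det iN) (d := c)) ?mxE //.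
by apply/colP => r; rewrite key2 mxE.
Qed.
End Regular.

(** Taking the coefficients from [pinvmx] of the [i]-th Hankel matrix makes the [i]-th determinant
    1, so a generic element satisfies all [N] conditions. They involve only its component of degree
    [N]. *)
Lemma exists_zeta (K : closedFieldType) N (phi0 : seq 'I_2 -> K) :
  exists zeta, homogeneous N zeta /\ forall i, (i < N)%N -> cut_det N phi0 i zeta != 0.
Proof.
have [|i _|z hz] := @generic_nonzero K _ (cut_det N phi0) N.
- by move=> i v w; exact: cut_det_line.
- exists (of_coef (pinvmx (hankel N phi0 i))).
  by rewrite /cut_det of_coefK cut_mx_pinv det1 oner_neq0.
exists (hcomp N z); split; first exact: hcomp_homog.
by move=> i iN; rewrite cut_det_hcomp ?hz // ltnW.
Qed.

Section Generation.
Variables (K : fieldType) (N : nat) (phi0 : seq 'I_2 -> K) (e0 : seq 'I_2).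
Hypotheses (N0 : (0 < N)%N) (supp0 : supported N phi0) (phi_e0 : phi0 e0 = 1).
Local Notation A := (freealg K 2).
Local Notation J := (periodic_ideal N phi0).
Local Notation M := (probe_mx N phi0).
Implicit Types p q : A.

(** Stands for left or right multiplication by [zeta], so that both module structures are treated at
    once. *)
Variable Z : {linear A -> A}.
Hypothesis Z_homog : forall n p, homogeneous n p -> homogeneous (N + n) (Z p).
Hypothesis Z_reg : forall n p, homogeneous n p -> J (Z p) -> J p.

Definition Z_mx n := \matrix_i coords (N + n) (Z (mon K (@word_at n i))).

Lemma of_coords_Z n c : of_coords (N + n) (c *m Z_mx n) = Z (of_coords n c).
Proof.
rewrite mulmx_sum_row (raddf_sum (of_coords (N + n))) (raddf_sum Z); apply: eq_bigr => i _ /=.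
rewrite linearZ /= linearZ /= rowK coordsK //.
by apply: Z_homog; rewrite -{1}(size_word_at i); exact: mon_homog.
Qed.

Lemma ker_Z n (c : 'rV_#|{: n.-tuple 'I_2}|) : c *m (Z_mx n *m M (N + n)) = 0 -> c *m M n = 0.
Proof.
rewrite mulmxA => /(of_coords_J N0 supp0); rewrite of_coords_Z => h.
by apply/(of_coords_J N0 supp0); apply: Z_reg h; exact: of_coords_homog.
Qed.

Lemma rank_step n : (\rank (M n) <= \rank (Z_mx n *m M (N + n)))%N.
Proof. by apply: leq_rank_ker => c; exact: ker_Z. Qed.

Lemma rank_mono n : (\rank (M n) <= \rank (M (N + n)))%N.
Proof. by apply: leq_trans (rank_step n) _; exact: mxrankM_maxr. Qed.

(** In each residue class modulo [N] the ranks increase and are bounded by the number of columns;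
    the largest of the [N] thresholds serves for all classes. *)
Lemma rank_stable : exists n1, forall n, (n1 <= n)%N -> \rank (M n) = \rank (M (N + n)).
Proof.
pose T := #|{: short N * short N}|.
have rT n : (\rank (M n) <= T)%N by exact: rank_leq_col.
have /choice[k hk] (i : 'I_N) : exists k, forall j, (k <= j)%N ->
    (T - \rank (M (j * N + i)) = T - \rank (M (k * N + i)))%N.
  apply: (@nonincreasing_stationary (fun j => T - \rank (M (j * N + i)))%N) => j.
  apply: leq_sub2l; rewrite mulSn -addnA; exact: rank_mono.
exists ((\max_i k i).+1 * N)%N => n hn.
have i0 := ltn_pmod n N0; pose i := Ordinal i0.
have kn : (k i <= n %/ N)%N.
  by apply: leq_trans (leq_bigmax i) _; rewrite leq_divRL //; apply: leq_trans hn; rewrite leq_mul2r leqnSn orbT.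
have h1 := hk i _ kn; have h2 := hk i _ (leqW kn).
have E : (N + n = (n %/ N).+1 * N + i)%N by rewrite mulSn -addnA -divn_eq.
have En : (n = n %/ N * N + i)%N := divn_eq n N.
move: h1 h2; rewrite -E -En => <- /eqP h.
apply/eqP; move: h (rT n) (rT (N + n)%N); clear; move: (\rank _) (\rank _) => x y; lia.
Qed.

(* [Z] is injective modulo the ideal, so the bounded dimensions of the components
   cannot decrease along [n -> N + n] and are eventually constant. *)
Lemma eventually_onto : exists n1, forall n q, (n1 <= n)%N -> homogeneous (N + n) q ->
  exists2 p, homogeneous n p & J (q - Z p).
Proof.
have [n1 hn1] := rank_stable; exists n1 => n q hn hq.
have sub : (Z_mx n *m M (N + n) <= M (N + n))%MS by exact: submxMl.
have : (M (N + n) <= Z_mx n *m M (N + n))%MS.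
  by rewrite -(mxrank_leqif_sup sub) eqn_leq mxrankM_maxr -hn1 // rank_step.
move=> /(submx_trans (submxMl (coords (N + n) q) _)) /submxP[c hc].
exists (of_coords n c); first exact: of_coords_homog.
rewrite -(coordsK hq) -of_coords_Z -raddfB; apply/(of_coords_J N0 supp0).
by rewrite mulmxBl hc mulmxA subrr.
Qed.

Variables (P : algType K) (tau : {lrmorphism A -> P}).
Hypothesis tau_surj : forall a, exists p, tau p = a.
Hypothesis tau_ker : forall p, tau p = 0 <-> J p.

(** Finite generation stated as an induction principle, to be applied with [S] the combinations of
    finitely many images of words with coefficients in [K[z]], on either side. *)
Lemma generation : exists n2, forall S : set P, is_subspace S ->
  (forall w, (size w < n2)%N -> S (tau (mon K w))) ->
  (forall p, S (tau p) -> S (tau (Z p))) -> forall a, S a.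
Proof.
have [n1 hn1] := eventually_onto; exists (N + n1)%N => S Ssub Sgen SZ a.
have hom n p : homogeneous n p -> S (tau p).
  elim/ltn_ind: n p => n IH p hp; have [hn|hn] := ltnP n (N + n1).
    rewrite -(coordsK hp) /of_coords raddf_sum.
    apply: subspace_sum => // i _ /=; rewrite linearZ; apply: subspaceZ => //.
    by apply: Sgen; rewrite size_tuple.
  have En : n = (N + (n - N))%N by move: hn; clear; lia.
  have nn : (n1 <= n - N)%N by move: hn; clear; lia.
  rewrite En in hp; have [q hq Jq] := hn1 _ _ nn hp.
  have -> : tau p = tau (Z q) by apply/eqP; rewrite -subr_eq0 -raddfB; apply/eqP/tau_ker.
  apply: SZ; apply: IH hq; move: N0 hn; clear; lia.
have [p <-] := tau_surj a; rewrite (hcompE p) raddf_sum.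
by apply: subspace_sum => // n _; apply: hom; exact: hcomp_homog.
Qed.
End Generation.

Section Multiplications.
Variables (K : fieldType) (B : algType K) (z : B).

Definition lmul p : B := z * p.
Definition rmul p : B := p * z.

Lemma lmul_is_linear : linear lmul.
Proof. by move=> k p q; rewrite /lmul mulrDr scalerAr. Qed.

Lemma rmul_is_linear : linear rmul.
Proof. by move=> k p q; rewrite /rmul mulrDl scalerAl. Qed.

HB.instance Definition _ := GRing.isLinear.Build K B B _ lmul lmul_is_linear.
HB.instance Definition _ := GRing.isLinear.Build K B B _ rmul rmul_is_linear.
End Multiplications.

Section Noetherian.
Variables (K : closedFieldType) (N : nat) (phi0 : seq 'I_2 -> K) (e0 : seq 'I_2).
Hypotheses (N0 : (0 < N)%N) (supp0 : supported N phi0) (phi_e0 : phi0 e0 = 1).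
Local Notation A := (freealg K 2).
Local Notation J := (periodic_ideal N phi0).
Variables (P : algType K) (tau : {lrmorphism A -> P}).
Hypothesis tau_surj : forall a, exists p, tau p = a.
Hypothesis tau_ker : forall p, tau p = 0 <-> J p.

Lemma short_gens n2 : exists m (g : 'I_m.+1 -> P),
  forall w, (size w < n2)%N -> exists i, g i = tau (mon K w).
Proof.
pose G := {k : 'I_n2.+1 & k.-tuple 'I_2}.
pose x0 : G := @Tagged _ (@ord0 n2) (fun k : 'I_n2.+1 => k.-tuple 'I_2) [tuple].
have G0 : (0 < #|{: G}|)%N by apply/card_gt0P; exists x0.
have GE : #|{: G}|.-1.+1 = #|{: G}| by rewrite prednK.
exists #|{: G}|.-1, (fun i => tau (mon K (tagged (enum_val (cast_ord GE i))))) => w wn.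
have wn' : (size w < n2.+1)%N by exact: ltnW.
have hs : size w == Ordinal wn' by [].
pose x : G := Tagged (fun k : 'I_n2.+1 => k.-tuple 'I_2) (Tuple hs).
by exists (cast_ord (esym GE) (enum_rank x)); rewrite cast_ordKV enum_rankK.
Qed.

Lemma left_generated : exists (z : P) m (g : 'I_m.+1 -> P),
  forall a, exists c : 'I_m.+1 -> {poly K}, a = \sum_i horner_alg z (c i) * g i.
Proof.
have [zeta [zh zd]] := exists_zeta N phi0.
have [||n2 hn2] := @generation K N phi0 N0 supp0 (lmul zeta) _ _ P tau tau_surj tau_ker.
- by move=> n p hp; exact: (homogM zh hp).
- by move=> n p; exact: (regular_left N0 supp0 phi_e0 zh zd).
have [m [g hg]] := short_gens n2.
exists (tau zeta), m, g; apply: hn2.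
- split; first by exists (fun=> 0); rewrite big1 // => i _; rewrite rmorph0 mul0r.
  move=> k _ _ [c ->] [d ->]; exists (fun i => k *: c i + d i).
  rewrite scaler_sumr -big_split; apply: eq_bigr => i _ /=.
  by rewrite linearP /= mulr_algl mulrDl scalerAl.
- move=> w /hg[j <-]; exists (fun i => (i == j)%:R).
  rewrite (bigD1 j) //= eqxx rmorph1 mul1r big1 ?addr0 // => i /negPf ->.
  by rewrite rmorph0 mul0r.
- move=> p [c pc]; exists (fun i => 'X * c i).
  rewrite /= /lmul rmorphM /= pc mulr_sumr.
  by apply: eq_bigr => i _; rewrite rmorphM /= horner_algX mulrA.
Qed.

Lemma right_generated : exists (z : P) m (g : 'I_m.+1 -> P),
  forall a, exists c : 'I_m.+1 -> {poly K}, a = \sum_i g i * horner_alg z (c i).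
Proof.
have [zeta [zh zd]] := exists_zeta N phi0.
have [||n2 hn2] := @generation K N phi0 N0 supp0 (rmul zeta) _ _ P tau tau_surj tau_ker.
- by move=> n p hp; rewrite addnC; exact: (homogM hp zh).
- by move=> n p; exact: (regular_right N0 supp0 phi_e0 zh zd).
have [m [g hg]] := short_gens n2.
exists (tau zeta), m, g; apply: hn2.
- split; first by exists (fun=> 0); rewrite big1 // => i _; rewrite rmorph0 mulr0.
  move=> k _ _ [c ->] [d ->]; exists (fun i => k *: c i + d i).
  rewrite scaler_sumr -big_split; apply: eq_bigr => i _ /=.
  by rewrite linearP /= mulr_algl mulrDr scalerAr.
- move=> w /hg[j <-]; exists (fun i => (i == j)%:R).
  rewrite (bigD1 j) //= eqxx rmorph1 mulr1 big1 ?addr0 // => i /negPf ->.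
  by rewrite rmorph0 mulr0.
- move=> p [c pc]; exists (fun i => c i * 'X).
  rewrite /= /rmul rmorphM /= pc mulr_suml.
  by apply: eq_bigr => i _; rewrite rmorphM /= horner_algX mulrA.
Qed.

Lemma tau_noetherian : noetherian_alg P.
Proof.
split.
  have [z [m [g hg]]] := left_generated; exact: left_noetherian hg.
have [z [m [g hg]]] := right_generated; exact: right_noetherian hg.
Qed.

Lemma tau_PI : satisfies_PI P.
Proof. have [z [m [g hg]]] := left_generated; exact: fg_PI hg. Qed.
End Noetherian.

Section PeriodicImage.
Variables (K : closedFieldType) (N : nat) (phi0 : seq 'I_2 -> K) (e0 : seq 'I_2).
Hypotheses (N0 : (0 < N)%N) (supp0 : supported N phi0) (phi_e0 : phi0 e0 = 1).
Local Notation A := (freealg K 2).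
Local Notation J := (periodic_ideal N phi0).
Variables (R : algType K) (pi : {lrmorphism A -> R}).
Hypothesis pi_surj : forall a, exists p, pi p = a.
Hypothesis pi_ker : forall p, pi p = 0 -> J p.

Lemma one_notin_periodic_ideal : ~ J 1.
Proof.
move=> /periodic_idealP/(_ 0%N [::] [::]); rewrite -mon_nil pairing_mon Phi0 /= => /eqP.
by rewrite oner_eq0.
Qed.

(** Because the ideal contains the kernel of [pi], the quotient by its image is a quotient of [R]
    and has exactly this ideal as kernel over the free algebra. *)
Lemma pi_J p : (pi @` J) (pi p) <-> J p.
Proof.
split=> [[q Jq E]|Jp]; last by exists p.
have : J (p - q) by apply: pi_ker; rewrite raddfB /= E subrr.
by move=> h; rewrite -[p](subrK q) -[p - q]scale1r; apply: (periodic_ideal_sub N phi0).2.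
Qed.

Lemma image_ideal : is_ideal (pi @` J).
Proof.
have S : is_subspace (pi @` J).
  split; first by exists 0; [exact: (periodic_ideal_sub N phi0).1 | exact: raddf0].
  move=> k _ _ [p Jp <-] [q Jq <-]; exists (k *: p + q); last by rewrite linearP.
  exact: (periodic_ideal_sub N phi0).2.
split; split=> // a b.
  have [p <-] := pi_surj a => -[q Jq <-]; exists (p * q); last by rewrite rmorphM.
  exact: periodic_ideal_mull.
have [p <-] := pi_surj b => -[q Jq <-]; exists (q * p); last by rewrite rmorphM.
exact: periodic_ideal_mulr.
Qed.

Lemma image_proper : ~ (pi @` J) 1.
Proof. by rewrite -(rmorph1 pi) => /pi_J; exact: one_notin_periodic_ideal. Qed.

Definition image_pideal := Defs.ProperIdeal image_ideal image_proper.

Lemma periodic_image : exists (P : algType K) (Pn : nat -> set P) (phi : {lrmorphism R -> P}),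
  [/\ is_grading Pn,
      forall n a, (pi @` homogeneous n) a -> Pn n (phi a),
      forall p, exists a, phi a = p
    & positive_part Pn <> [set 0]] /\
  [/\ prime_alg P, noetherian_alg P, linear_growth Pn & satisfies_PI P].
Proof.
pose P : algType K := quotalg image_pideal.
pose phi : {lrmorphism R -> P} := quot_pi image_pideal.
pose tau : {lrmorphism A -> P} := phi \o pi.
have phi_surj : forall p, exists a, phi a = p by exact: quot_pi_surj.
have tau_surj a : exists p, tau p = a.
  by have [x <-] := phi_surj a; have [p <-] := pi_surj x; exists p.
have tau_ker p : tau p = 0 <-> J p.
  have E : phi (pi p) = 0 <-> (pi @` J) (pi p).
    by rewrite -(raddf0 phi) (quot_piE image_pideal) subr0.
  by rewrite -pi_J -E.
exists P, (fun n => tau @` homogeneous n), phi; split; split.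
- exact: (tau_grading N0 supp0 tau_surj tau_ker).
- by move=> n _ [p hp <-]; exists p.
- exact: phi_surj.
- exact: (positive_part_neq0 N0 supp0 phi_e0 tau_ker).
- exact: (tau_prime supp0 tau_surj tau_ker).
- exact: (tau_noetherian N0 supp0 phi_e0 tau_surj tau_ker).
- exact: (tau_growth N0 supp0 tau_ker).
- exact: (tau_PI N0 supp0 phi_e0 tau_surj tau_ker).
Qed.
End PeriodicImage.

Theorem theorem0p1 (K : closedFieldType) (xi : nat)
  (f : 'I_xi -> freealg K 2) (d : 'I_xi -> nat)
  (f_homog : forall j, homogeneous (d j) (f j))
  (d_gt1 : forall j, (1 < d j)%N)
  (r : nat -> nat)
  (r_count : forall i, r i = #|[set j | (2 ^ i < d j <= 2 ^ i.+1)%N]%SET|)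
  (d_gap : forall j n, ~~ in_gap n (d j))
  (r_sparse : sparse_counts r) :
  let R : algType K := rel_alg f_homog d_gt1 in
  let Rn : nat -> set R := rel_comp f_homog d_gt1 in
  [/\ exists u v : seq 'I_2, size u = size v /\
        let b : 'I_2 -> R := fun i =>
          rel_pi f_homog d_gt1 (monomial K (if i == 0 then u else v)) in
        free_generators b /\ graded_subset Rn (subalg_gen b),
      ~ is_jacobson_radical [set: R],
      ~ is_jacobson_radical (positive_part Rn)
    & exists (P : algType K) (Pn : nat -> set P) (phi : {lrmorphism R -> P}),
        [/\ is_grading Pn,
            forall n a, Rn n a -> Pn n (phi a),
            forall p, exists a, phi a = p
          & positive_part Pn <> [set 0]] /\
        [/\ prime_alg P, noetherian_alg P, linear_growth Pn
          & satisfies_PI P]].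
Proof.
move=> R Rn.
have [N [D [phi [e hsys]]]] := final_system f_homog d_gt1 r_count d_gap r_sparse.
pose pi : {lrmorphism freealg K 2 -> R} := quot_pi (rel_ideal f_homog d_gt1).
have pi_surj a : exists p, pi p = a by exact: quot_pi_surj.
have pi_ker p : pi p = 0 -> annih (range (blocks N phi)) p.
  rewrite -(raddf0 pi) => /(quot_piE (rel_ideal f_homog d_gt1)); rewrite subr0.
  apply: annih_gen => _ [j _ <-] _ [s _ <-].
  by apply: (sys_kill hsys); exists j.
(* The tensor powers of [phi 0] are the concatenations with constant index 0. *)
have pi_ker0 p : pi p = 0 -> annih (range (Phi N (phi 0))) p.
  move=> /pi_ker h _ [k _ <-].
  have -> : Phi N (phi 0) k = blocks N phi (nseq k 0) by rewrite /blocks map_nseq.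
  by apply: h; exists (nseq k 0).
have N0 := sys_pos hsys; have supp0 : supported N (phi 0) by exact: (sys_supp hsys).
have phi_e0 : phi 0 (e 0) = 1 by rewrite (sys_dual hsys).
split.
- exists (e 0), (e 1); split; first by rewrite !(sys_size hsys).
  move=> b; have hb i : b i = pi (mon K (e i)).
    rewrite /b monomialE; congr (pi (mon K _)).
    by case: i => [[|[|//]] ?] /=; congr e; apply: val_inj.
  split; first exact: (system_free hsys hb pi_ker).
  exact: (system_graded hsys hb).
- exact: unital_not_radical.
- exact: (positive_part_not_radical N0 supp0 phi_e0 pi_ker0).
- exact: (periodic_image N0 supp0 phi_e0 pi_surj pi_ker0).
Qed.
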